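(* Let $R$ be a one-dimensional reduced semilocal Cohen–Macaulay ring with large residue fields, and let $\mathcal{E}\in\mathfrak{R}_R$ be a regular fractional ideal. (a) If $R$ is analytically reduced, then $\Gamma_{\mathcal{E}}$ satisfies (E1). (b) If $R$ is residually rational, then $\Gamma_{\mathcal{E}}$ satisfies (E2). In particular, if $R$ is admissible, then $\Gamma_{\mathcal{E}}$ is good.
   Context: All rings are commutative and unitary. A one-dimensional Noetherian ring $R$ is Cohen–Macaulay if $\operatorname{depth}(R_{\mathfrak m})=1$ for all maximal ideals $\mathfrak m$. $Q_R$ is the total ring of fractions of $R$, $Q_R^{\mathrm{reg}}$ the set of its regular elements, $T^{\mathrm{reg}}:=T\cap Q_R^{\mathrm{reg}}$ for $T\subseteq Q_R$, and $\overline{R}$ the integral closure of $R$ in $Q_R$. A fractional ideal of $R$ is an $R$-submodule $\mathcal{E}\subseteq Q_R$ with $r\mathcal{E}\subseteq R$ for some $r\in R^{\mathrm{reg}}$; it is regular if $\mathcal{E}^{\mathrm{reg}}\ne\emptyset$. $\mathfrak{R}_R$ is the set of regular fractional ideals. Let $R$ be a one-dimensional semilocal Cohen–Macaulay ring. $\mathfrak{V}_R$ is the set of valuation rings of $Q_R$ over $R$, i.e. subrings $V$ with $R\subseteq V\subsetneq Q_R$ such that $Q_R\setminus V$ is multiplicatively closed. This set is finite and nonempty; each $V\in\mathfrak{V}_R$ is a discrete valuation ring in the sense that it has a unique regular maximal ideal $\mathfrak{m}_V$, which is invertible and is the only regular prime ideal of $V$. The associated discrete valuation $\nu_V\colon Q_R\to\mathbb{Z}\cup\{\infty\}$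 is $\nu_V(x)=\max\{k\in\mathbb{Z}\mid x\in\mathfrak{m}_V^k\}$, with $\nu_V(x)=\infty$ if $x\in\bigcap_k\mathfrak{m}_V^k$. Set $\nu=(\nu_V)_{V\in\mathfrak{V}_R}$ and, for $\mathcal{E}\in\mathfrak{R}_R$, $\Gamma_{\mathcal{E}}:=\nu(\mathcal{E}^{\mathrm{reg}})\subseteq\mathbb{Z}^{\mathfrak{V}_R}$. $R$ is analytically reduced if its completion $\widehat{R}$ at the Jacobson radical is reduced; residually rational if $\overline{R}/\mathfrak{n}=R/(\mathfrak{n}\cap R)$ for all maximal ideals $\mathfrak{n}$ of $\overline{R}$; it has large residue fields if $|R/\mathfrak{m}|\ge|\mathfrak{V}_{R_{\mathfrak{m}}}|$ for all maximal ideals $\mathfrak{m}$ of $R$. $R$ is admissible if it is a one-dimensional semilocal Cohen–Macaulay ring that is analytically reduced and residually rational with large residue fields. With $I=\mathfrak{V}_R$ and $\mathbb{N}=\{0,1,\dots\}$, properties of a subset $E\subseteq\mathbb{Z}^I$ (componentwise order and minimum): (E0) there is $\alpha\in\mathbb{Z}^I$ with $\alpha+\mathbb{N}^I\subseteq E$; (E1) if $\alpha,\beta\in E$, then $\min\{\alpha,\beta\}\in E$; (E2) for any $\alpha,\beta\in E$ and $j\in I$ with $\alpha_j=\beta_j$ there is $\varepsilon\in E$ with $\varepsilon_j>\alpha_j=\beta_j$ and $\varepsilon_i\ge\min\{\alpha_i,\beta_i\}$ for all $i\in I\setminus\{j\}$, with equality if $\alpha_i\neq\beta_i$. $E$ is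 good if it satisfies (E0), (E1) and (E2). *)

(* Defs.v *)
From HB Require Import structures.
From mathcomp Require Import all_boot all_order all_algebra.
From mathcomp Require Import generic_quotient ring_quotient.
From mathcomp Require Import ring.
From mathcomp Require Import boolp classical_sets functions cardinality.
From mathcomp Require Import constructive_ereal.

Set Implicit Arguments.
Unset Strict Implicit.
Unset Printing Implicit Defensive.

Import Order.TTheory GRing.Theory Num.Theory.

Local Open Scope classical_set_scope.
Local Open Scope card_scope.
Local Open Scope ring_scope.
Local Open Scope quotient_scope.

(* Subrings and their ideals are sets of elements of an ambient ring [A], so   *)
(* that [R], its integral closure and its valuation rings are all treated      *)
(* alike; a whole ring is the subring [setT].                                  *)

Section Ideals.
Variable A : comPzRingType.
Implicit Types (S I J M P : set A) (x y : A).

Definition subring S : Prop :=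
  [/\ S 1, forall x y, S x -> S y -> S (x - y) &
      forall x y, S x -> S y -> S (x * y)].

Definition ideal S I : Prop :=
  [/\ I `<=` S, I 0, forall x y, I x -> I y -> I (x + y) &
      forall a x, S a -> I x -> I (a * x)].

Definition prime_ideal S P : Prop :=
  [/\ ideal S P, P <> S &
      forall x y, S x -> S y -> P (x * y) -> P x \/ P y].

Definition maximal_ideal S M : Prop :=
  [/\ ideal S M, M <> S &
      forall I, ideal S I -> M `<=` I -> I = M \/ I = S].

Definition jacobson S : set A :=
  [set x | S x /\ forall M, maximal_ideal S M -> M x].

Definition ideal_prod I J : set A :=
  [set x | exists2 s : seq (A * A),
     forall p, p \in s -> I p.1 /\ J p.2 & x = \sum_(p <- s) p.1 * p.2].

Fixpoint ideal_pow S I (n : nat) : set A :=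
  if n is n'.+1 then ideal_prod I (ideal_pow S I n') else S.

Definition gen_ideal (s : seq A) : set A :=
  [set x | exists c : 'I_(size s) -> A, x = \sum_i c i * s`_i].

(* The set of cosets of [I] of the elements of [S]: for an ideal [I] of [S]    *)
(* this is S / I, and for a subring [S'] of [S] it is the image of             *)
(* S' / (I `&` S') in S / I.                                                   *)
Definition quotient_set S I : set (set A) :=
  [set [set x + y | y in I] | x in S].

Definition regular : set A := [set x | GRing.lreg x].

Definition reduced : Prop := forall x n, x ^+ n = 0 -> x = 0.

Definition noetherian : Prop :=
  forall I, ideal setT I -> exists s : seq A, I = gen_ideal s.

Definition prime_chain (n : nat) (C : nat -> set A) : Prop :=
  (forall i, (i <= n)%N -> prime_ideal setT (C i)) /\
  (forall i, (i < n)%N -> C i `<` C i.+1).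

Definition krull_dim (n : nat) : Prop :=
  (exists C, prime_chain n C) /\
  (forall k C, prime_chain k C -> (k <= n)%N).

Definition semilocal : Prop := finite_set [set M | maximal_ideal setT M].

Definition regular_sequence (s : seq A) : Prop :=
  gen_ideal s <> setT /\
  forall i a, (i < size s)%N ->
    gen_ideal (take i s) (s`_i * a) -> gen_ideal (take i s) a.

(* The depth of a local ring: the greatest length of a regular sequence in its *)
(* maximal ideal, which is its Jacobson radical.                               *)
Definition depth (n : nat) : Prop :=
  (exists s, [/\ regular_sequence s, [set` s] `<=` jacobson setT & size s = n]) /\
  (forall s, regular_sequence s -> [set` s] `<=` jacobson setT ->
     (size s <= n)%N).

Lemma maximal_prime M : maximal_ideal setT M -> prime_ideal setT M.
Proof.
move=> [[MT M0 MD MM] MnT Mmax]; split=> // x y _ _ Mxy.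
have [Mx|Mx] := pselect (M x); [by left|right].
pose I := [set z | exists2 m, M m & exists r, z = m + r * x].
have IdI : ideal setT I.
  split=> //.
  - by exists 0 => //; exists 0; rewrite mul0r addr0.
  - move=> _ _ [m Mm [r ->]] [m' Mm' [r' ->]]; exists (m + m'); first exact: MD.
    by exists (r + r'); rewrite mulrDl addrACA.
  - move=> a _ _ [m Mm [r ->]]; exists (a * m); first exact: MM.
    by exists (a * r); rewrite mulrDr mulrA.
have MI : M `<=` I by move=> z Mz; exists z => //; exists 0; rewrite mul0r addr0.
have [IM|IT] := Mmax _ IdI MI.
  by case: Mx; rewrite -IM; exists 0 => //; exists 1; rewrite add0r mul1r.
have [m Mm [r e1]] : I 1 by rewrite IT.
rewrite -[y]mul1r e1 mulrDl; apply: MD; first by rewrite mulrC; exact: MM.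
by rewrite -mulrA; exact: MM.
Qed.

Lemma ideal_pow_ideal I n :
  [/\ ideal_pow setT I n 0,
      forall x y, ideal_pow setT I n x -> ideal_pow setT I n y ->
        ideal_pow setT I n (x + y) &
      forall a x, ideal_pow setT I n x -> ideal_pow setT I n (a * x)].
Proof.
elim: n => [//|n [I0 ID IM]]; split=> /=.
- by exists [::] => //; rewrite big_nil.
- move=> _ _ [s hs ->] [t ht ->]; exists (s ++ t); last by rewrite big_cat.
  by move=> p; rewrite mem_cat => /orP[/hs|/ht].
- move=> a _ [s hs ->]; exists [seq (p.1, a * p.2) | p <- s].
    by move=> _ /mapP[p /hs[I1 I2] ->]; split=> //; exact: IM.
  by rewrite big_map mulr_sumr; apply: eq_bigr => p _ /=; rewrite mulrCA.
Qed.

End Ideals.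

(* Excluding 0 makes the ring of fractions nonzero, hence a [comNzRingType].   *)

Record multset (R : comNzRingType) := MultSet {
  multset_set :> R -> Prop;
  multset0 : ~ multset_set 0;
  multset1 : multset_set 1;
  multsetM : forall x y, multset_set x -> multset_set y -> multset_set (x * y)
}.

Module Loc.
Section Loc.
Variables (R : comNzRingType) (S : multset R).

Definition dom : Type := (R * {s : R | s \in (multset_set S : set R)})%type.
HB.instance Definition _ := Choice.on dom.
Implicit Types x y z : dom.

Local Notation num x := (x.1 : R).
Local Notation den x := (sval x.2 : R).

Lemma denP x : S (den x). Proof. by case: x => ? [s hs] /=; rewrite inE in hs. Qed.

Definition frac (a s : R) (hs : S s) : dom := (a, exist _ s (mem_set hs)).

Definition equivl x y : bool :=
  `[< exists2 u, S u & u * (num x * den y - num y * den x) = 0 >].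

Lemma equivl_refl : reflexive equivl.
Proof.
by move=> x; apply/asboolP; exists 1; [exact: multset1|rewrite subrr mulr0].
Qed.

Lemma equivl_sym : symmetric equivl.
Proof.
suff h x y : equivl x y -> equivl y x by move=> x y; apply/idP/idP; exact: h.
move=> /asboolP[u Su h]; apply/asboolP; exists u => //.
by rewrite -opprB mulrN h oppr0.
Qed.

Lemma equivl_trans : transitive equivl.
Proof.
move=> y x z /asboolP[u Su hu] /asboolP[v Sv hv]; apply/asboolP.
exists (u * v * den y).
  by apply: multsetM; [exact: multsetM|exact: denP].
have -> : u * v * den y * (num x * den z - num z * den x) =
  v * den z * (u * (num x * den y - num y * den x)) +
  u * den x * (v * (num y * den z - num z * den y)) by ring.
by rewrite hu hv !mulr0 addr0.
Qed.

Canonical equivl_equiv := EquivRel equivl equivl_refl equivl_sym equivl_trans.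

Definition type := {eq_quot equivl}.
HB.instance Definition _ : EqQuotient _ equivl type := EqQuotient.on type.
HB.instance Definition _ := Choice.on type.

Lemma eq_pi x y : equivl x y -> \pi_type x = \pi_type y.
Proof. by move=> h; apply/eqmodP. Qed.

Lemma repr_pi x : exists2 u, S u &
  u * (num x * den (repr (\pi_type x)) - num (repr (\pi_type x)) * den x) = 0.
Proof.
suff : equivl x (repr (\pi_type x)) by move=> /asboolP.
by have /eqmodP : x = repr (\pi_type x) %[mod type] by rewrite reprK.
Qed.

Definition addl x y : dom :=
  frac (num x * den y + num y * den x) (multsetM (denP x) (denP y)).
Definition oppl x : dom := (- num x, x.2).
Definition mull x y : dom := frac (num x * num y) (multsetM (denP x) (denP y)).

Definition tol (a : R) : type := \pi_type (frac a (multset1 S)).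
Definition add (a b : type) : type := \pi_type (addl (repr a) (repr b)).
Definition opp (a : type) : type := \pi_type (oppl (repr a)).
Definition mul (a b : type) : type := \pi_type (mull (repr a) (repr b)).

Lemma pi_add x y : add (\pi_type x) (\pi_type y) = \pi_type (addl x y).
Proof.
have [u Su hu] := repr_pi x; have [v Sv hv] := repr_pi y.
apply: eq_pi; rewrite equivl_sym; apply/asboolP; exists (u * v).
  exact: multsetM.
move: (repr (\pi_type x)) (repr (\pi_type y)) hu hv => x' y' hu hv /=.
rewrite [LHS](_ : _ =
  v * den y * den y' * (u * (num x * den x' - num x' * den x)) +
  u * den x * den x' * (v * (num y * den y' - num y' * den y))); last by ring.
by rewrite hu hv !mulr0 addr0.
Qed.

Lemma pi_opp x : opp (\pi_type x) = \pi_type (oppl x).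
Proof.
have [u Su hu] := repr_pi x.
apply: eq_pi; rewrite equivl_sym; apply/asboolP; exists u => //.
move: (repr (\pi_type x)) hu => x' hu /=.
rewrite [LHS](_ : _ = - (u * (num x * den x' - num x' * den x))); last by ring.
by rewrite hu oppr0.
Qed.

Lemma pi_mul x y : mul (\pi_type x) (\pi_type y) = \pi_type (mull x y).
Proof.
have [u Su hu] := repr_pi x; have [v Sv hv] := repr_pi y.
apply: eq_pi; rewrite equivl_sym; apply/asboolP; exists (u * v).
  exact: multsetM.
move: (repr (\pi_type x)) (repr (\pi_type y)) hu hv => x' y' hu hv /=.
rewrite [LHS](_ : _ =
  v * num y * den y' * (u * (num x * den x' - num x' * den x)) +
  u * num x' * den x * (v * (num y * den y' - num y' * den y))); last by ring.
by rewrite hu hv !mulr0 addr0.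
Qed.

Lemma eq_pi1 x y : num x * den y = num y * den x -> \pi_type x = \pi_type y.
Proof.
move=> h; apply: eq_pi; apply/asboolP; exists 1; first exact: multset1.
by rewrite h subrr mulr0.
Qed.

Lemma addA : associative add.
Proof.
elim/quotW=> x; elim/quotW=> y; elim/quotW=> z.
by rewrite (pi_add y z) (pi_add x y) !pi_add; apply: eq_pi1 => /=; ring.
Qed.

Lemma addC : commutative add.
Proof.
elim/quotW=> x; elim/quotW=> y.
by rewrite !pi_add; apply: eq_pi1 => /=; ring.
Qed.

Lemma add0 : left_id (tol 0) add.
Proof. by elim/quotW=> x; rewrite pi_add; apply: eq_pi1 => /=; ring. Qed.

Lemma addN : left_inverse (tol 0) opp add.
Proof. by elim/quotW=> x; rewrite pi_opp pi_add; apply: eq_pi1 => /=; ring. Qed.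

HB.instance Definition _ := GRing.isZmodule.Build type addA addC add0 addN.

Lemma mulA : associative mul.
Proof.
elim/quotW=> x; elim/quotW=> y; elim/quotW=> z.
by rewrite (pi_mul y z) (pi_mul x y) !pi_mul; apply: eq_pi1 => /=; ring.
Qed.

Lemma mulC : commutative mul.
Proof.
elim/quotW=> x; elim/quotW=> y.
by rewrite !pi_mul; apply: eq_pi1 => /=; ring.
Qed.

Lemma mul1 : left_id (tol 1) mul.
Proof. by elim/quotW=> x; rewrite pi_mul; apply: eq_pi1 => /=; ring. Qed.

Lemma mulD : left_distributive mul add.
Proof.
elim/quotW=> x; elim/quotW=> y; elim/quotW=> z.
rewrite (pi_add x y) (pi_mul x z) (pi_mul y z) pi_mul pi_add.
by apply: eq_pi1 => /=; ring.
Qed.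

Lemma nonzero1 : tol 1 != tol 0.
Proof.
apply/eqP => /eqmodP/asboolP[u Su]; rewrite /= !mulr1 subr0 mulr1 => u0.
by apply: (multset0 (m := S)); rewrite -u0.
Qed.

HB.instance Definition _ :=
  GRing.Zmodule_isComNzRing.Build type mulA mulC mul1 mulD nonzero1.

Lemma tol_is_zmod_morphism : zmod_morphism tol.
Proof.
move=> a b; rewrite /tol.
rewrite -[RHS]/(add (\pi_type _) (opp (\pi_type _))) pi_opp pi_add.
by apply: eq_pi1 => /=; ring.
Qed.

Lemma tol_is_monoid_morphism : monoid_morphism tol.
Proof.
split=> // a b; rewrite -[RHS]/(mul (\pi_type _) (\pi_type _)) pi_mul.
by apply: eq_pi1 => /=; ring.
Qed.

HB.instance Definition _ :=
  GRing.isZmodMorphism.Build R type tol tol_is_zmod_morphism.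
HB.instance Definition _ :=
  GRing.isMonoidMorphism.Build R type tol tol_is_monoid_morphism.

End Loc.
End Loc.
HB.export Loc.

Notation localization := Loc.type.

Section Localizations.
Variable R : comNzRingType.

Lemma regular0 : ~ @regular R 0.
Proof. by move=> /lreg_neq0; rewrite eqxx. Qed.

Definition regular_multset : multset R :=
  @MultSet R (@regular R) regular0 (@lreg1 R) (@lregM R).

Definition total_frac : comNzRingType := localization regular_multset.

Definition to_frac : {rmorphism R -> total_frac} := @Loc.tol R regular_multset.

Variables (P : set R) (primeP : prime_ideal setT P).

Lemma prime_compl0 : ~ (~` P) 0.
Proof. by case: primeP => -[_ P0 _ _] _ _; exact. Qed.

Lemma prime_compl1 : (~` P) 1.
Proof.
case: primeP => -[_ _ _ PM] PT _ P1; apply: PT.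
by rewrite -subTset => x _; rewrite -[x]mulr1; exact: PM.
Qed.

Lemma prime_complM x y : (~` P) x -> (~` P) y -> (~` P) (x * y).
Proof. by case: primeP => _ _ PM nPx nPy /(PM _ _ I I)[]. Qed.

Definition prime_compl : multset R :=
  MultSet prime_compl0 prime_compl1 prime_complM.

Definition localization_at : comNzRingType := localization prime_compl.

End Localizations.

(* The I-adic completion of R: Cauchy sequences modulo null sequences. *)
Module Completion.
Section Completion.
Variables (R : comNzRingType) (I : set R).
Local Notation pow := (ideal_pow setT I).

Definition cauchy : {pred nat -> R} := fun x =>
  `[< forall n, exists N, forall p q, (N <= p)%N -> (N <= q)%N ->
        pow n (x p - x q) >].

Lemma powN n x : pow n x -> pow n (- x).
Proof. by case: (ideal_pow_ideal I n) => _ _ h /(h (-1)); rewrite mulN1r. Qed.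

Lemma powD n x y : pow n x -> pow n y -> pow n (x + y).
Proof. by case: (ideal_pow_ideal I n) => _ + _; exact. Qed.

Lemma powM n a x : pow n x -> pow n (a * x).
Proof. by case: (ideal_pow_ideal I n) => _ _; exact. Qed.

Lemma pow0 n : pow n 0. Proof. by case: (ideal_pow_ideal I n). Qed.

Lemma cauchy_subring : GRing.subring_closed cauchy.
Proof.
split.
- by apply/asboolP => n; exists 0%N => p q _ _; rewrite subrr; exact: pow0.
- move=> x y /asboolP hx /asboolP hy; apply/asboolP => n.
  have [N hN] := hx n; have [N' hN'] := hy n.
  exists (maxn N N') => p q; rewrite !geq_max => /andP[p1 p2] /andP[q1 q2].
  rewrite [X in pow n X](_ : _ = (x p - x q) + - (y p - y q)); last first.
    by rewrite /= !fctE; ring.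
  by apply: powD; [exact: hN|apply: powN; exact: hN'].
- move=> x y /asboolP hx /asboolP hy; apply/asboolP => n.
  have [N hN] := hx n; have [N' hN'] := hy n.
  exists (maxn N N') => p q; rewrite !geq_max => /andP[p1 p2] /andP[q1 q2].
  rewrite [X in pow n X](_ : _ = y p * (x p - x q) + x q * (y p - y q)).
    by apply: powD; apply: powM; [exact: hN|exact: hN'].
  by rewrite /= !fctE; ring.
Qed.

HB.instance Definition _ := GRing.isSubringClosed.Build (nat -> R) cauchy
  cauchy_subring.

Definition cauchy_seq : Type := {x : nat -> R | x \in cauchy}.
HB.instance Definition _ := [isSub of cauchy_seq for @proj1_sig _ _].
HB.instance Definition _ := [Choice of cauchy_seq by <:].
HB.instance Definition _ := [SubChoice_isSubComNzRing of cauchy_seq by <:].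

Definition null : {pred cauchy_seq} := fun x =>
  `[< forall n, exists N, forall p, (N <= p)%N -> pow n (val x p) >].

Lemma null_zmod : zmod_closed null.
Proof.
split; first by apply/asboolP => n; exists 0%N => p _; exact: pow0.
move=> x y /asboolP hx /asboolP hy; apply/asboolP => n.
have [N hN] := hx n; have [N' hN'] := hy n.
exists (maxn N N') => p; rewrite geq_max => /andP[p1 p2].
by apply: powD; [exact: hN|apply: powN; exact: hN'].
Qed.

HB.instance Definition _ := GRing.isZmodClosed.Build cauchy_seq null null_zmod.

Lemma nullM a x : x \in null -> a * x \in null.
Proof.
move=> /asboolP hx; apply/asboolP => n; have [N hN] := hx n.
by exists N => p hp; apply: powM; exact: hN.
Qed.

Definition type : Type := Quotient.quot null.
HB.instance Definition _ := GRing.Zmodule.on type.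

Lemma eq_pi (x y : cauchy_seq) : x - y \in null -> \pi_type x = \pi_type y.
Proof. by move=> h; apply/eqP; rewrite -Quotient.idealrBE. Qed.

Lemma repr_pi (x : cauchy_seq) : x - repr (\pi_type x) \in null.
Proof. by rewrite Quotient.idealrBE reprK. Qed.

Lemma pi_add (x y : cauchy_seq) : \pi_type x + \pi_type y = \pi_type (x + y).
Proof. by rewrite !piE. Qed.

Definition one : type := \pi_type 1.
Definition mul (a b : type) : type := \pi_type (repr a * repr b).

Lemma pi_mul x y : mul (\pi_type x) (\pi_type y) = \pi_type (x * y).
Proof.
symmetry; apply: eq_pi.
have := repr_pi x; have := repr_pi y.
move: (repr (\pi_type x)) (repr (\pi_type y)) => x' y' hy hx.
rewrite [X in X \in _](_ : _ = y * (x - x') + x' * (y - y')); last by ring.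
by apply: rpredD; exact: nullM.
Qed.

Lemma mulA : associative mul.
Proof.
by elim/quotW=> x; elim/quotW=> y; elim/quotW=> z;
rewrite (pi_mul y z) (pi_mul x y) !pi_mul mulrA.
Qed.

Lemma mulC : commutative mul.
Proof. by elim/quotW=> x; elim/quotW=> y; rewrite (pi_mul x y) (pi_mul y x) mulrC. Qed.

Lemma mul1 : left_id one mul.
Proof. by elim/quotW=> x; rewrite pi_mul mul1r. Qed.

Lemma mulD : left_distributive mul +%R.
Proof.
elim/quotW=> x; elim/quotW=> y; elim/quotW=> z.
by rewrite pi_add (pi_mul x z) (pi_mul y z) pi_mul pi_add mulrDl.
Qed.

HB.instance Definition _ :=
  GRing.Zmodule_isComPzRing.Build type mulA mulC mul1 mulD.

End Completion.
End Completion.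
HB.export Completion.

Notation completion := Completion.type.

Section Valuations.
Variable R : comNzRingType.
Local Notation Q := (total_frac R).
Implicit Types (V : set Q) (x : Q).

Definition base_ring : set Q := range (@to_frac R).

Definition integral_closure : set Q := [set x | integralOver (@to_frac R) x].

Definition valuation_rings : set (set Q) :=
  [set V | [/\ subring V, base_ring `<=` V, V `<` setT &
              forall x y, ~ V x -> ~ V y -> ~ V (x * y)]].

(* The regular maximal ideal m_V of V, chosen as the unique set with this      *)
(* property; [set0] is only a default value.                                   *)
Definition val_max V : set Q :=
  xget set0 [set M | maximal_ideal V M /\ M `&` @regular Q !=set0].

(* The power m_V^k; for k < 0 it is the inverse (V : m_V^(-k)) of m_V^(-k).    *)
Definition val_max_pow V (k : int) : set Q :=
  match k with
  | Posz n => ideal_pow V (val_max V) n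
  | Negz n => [set x | forall y, ideal_pow V (val_max V) n.+1 y -> V (x * y)]
  end.

(* The default value 0 is never used when V is a discrete valuation ring. *)
Definition valuation V x : \bar int :=
  if `[< forall k, val_max_pow V k x >] then +oo%E
  else (xget 0 [set k | val_max_pow V k x /\
                        forall l, val_max_pow V l x -> l <= k])%:E.

Record fractional_ideal (E : set Q) : Prop := FractionalIdeal {
  fractional_ideal0 : E 0;
  fractional_idealD : forall x y, E x -> E y -> E (x + y);
  fractional_idealZ : forall (r : R) x, E x -> E (to_frac R r * x);
  fractional_ideal_den : exists2 r, (base_ring `&` @regular Q) r &
                           forall x, E x -> base_ring (r * x)
}.

Definition regular_fractional_ideal (E : set Q) : Prop :=
  fractional_ideal E /\ E `&` @regular Q !=set0.

Definition value_set (E : set Q) : set (valuation_rings -> int) :=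
  [set alpha | exists2 x, (E `&` @regular Q) x &
     forall V : valuation_rings, valuation (val V) x = (alpha V)%:E].

End Valuations.

Arguments base_ring R _ : clear implicits.
Arguments integral_closure R _ : clear implicits.
Arguments valuation_rings R _ : clear implicits.

Section RingProperties.
Variable R : comNzRingType.

Definition cohen_macaulay_dim1 : Prop :=
  [/\ noetherian R, krull_dim R 1 &
      forall (m : set R) (hm : maximal_ideal setT m),
        depth (localization_at (maximal_prime hm)) 1].

Definition analytically_reduced : Prop :=
  reduced (completion (jacobson [set: R])).

Definition residually_rational : Prop :=
  forall n, maximal_ideal (integral_closure R) n ->
    quotient_set (integral_closure R) n = quotient_set (base_ring R) n.

Definition large_residue_fields : Prop :=
  forall (m : set R) (hm : maximal_ideal setT m),
    quotient_set setT m #>=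
      valuation_rings (localization_at (maximal_prime hm)).

Definition admissible : Prop :=
  [/\ cohen_macaulay_dim1, semilocal R, analytically_reduced,
      residually_rational & large_residue_fields].

End RingProperties.

Section Good.
Variable I : Type.
Implicit Types (E : set (I -> int)) (alpha beta eps : I -> int).

Definition propE0 E : Prop :=
  exists alpha, forall n : I -> nat, E (fun i => alpha i + (n i)%:Z).

Definition propE1 E : Prop :=
  forall alpha beta, E alpha -> E beta ->
    E (fun i => Num.min (alpha i) (beta i)).

Definition propE2 E : Prop :=
  forall alpha beta (j : I), E alpha -> E beta -> alpha j = beta j ->
    exists eps, [/\ E eps, eps j > alpha j &
      forall i, i <> j ->
        eps i >= Num.min (alpha i) (beta i) /\
        (alpha i <> beta i -> eps i = Num.min (alpha i) (beta i))].

Definition good E : Prop := [/\ propE0 E, propE1 E & propE2 E].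

End Good.

(* Main.v *)
(* A regular element [alpha] of the Jacobson radical makes the total ring of    *)
(* fractions [Q] equal to [R[1 / alpha]].  For any ring [B] between [R] and     *)
(* [Q], the argument of Krull and Akizuki bounds [B / alpha B] by               *)
(* [R / alpha ^ m R], which is Artinian.  This makes the valuation rings over   *)
(* [R] discrete and finite in number, and weak approximation holds for them.    *)
(* Reducedness of [R] enters through the fact that every element of [Q] is the  *)
(* product of an idempotent and a unit, so that elements of finite value at all *)
(* valuations are regular.                                                      *)
(* (E1): a combination [p x + q y] takes the minimal values at all the          *)
(* valuations centered in [m] unless [(p : q)] lies in a set of at most as many *)
(* points of the projective line over [R / m] as there are such valuations.     *)
(* (E2): subtract from [x] the multiple of [y] with the same residue.           *)
(* (E0): if the integral closure had no conductor, an element of the completion *)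
(* of [R] whose approximations in [R] have large values would be a nonzero      *)
(* nilpotent.                                                                   *)

Require Import Defs.
From HB Require Import structures.
From mathcomp Require Import all_boot all_order all_algebra.
From mathcomp Require Import generic_quotient ring_quotient ring.
From mathcomp Require Import boolp classical_sets functions cardinality.
From mathcomp Require Import constructive_ereal.

Set Implicit Arguments.
Unset Strict Implicit.
Unset Printing Implicit Defensive.

Import Order.TTheory GRing.Theory Num.Theory.

Local Open Scope classical_set_scope.
Local Open Scope ring_scope.
Local Open Scope quotient_scope.

(** * Noetherian rings of dimension one *)

(** Everything is measured against a regular element [alpha] of the Jacobson radical. It exists
    because a maximal ideal without regular elements would, in a reduced ring, become zero in its
    own localization, against depth 1 ([maximal_ideal_regular], [jacobson_regular]). Dimension one
    gives the minimal condition on ideals containing a fixed regular element ([regular_min]), whence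
    Q = R[1/alpha].

    Valuation theory of fields carries over to Q, despite its zero divisors, because every element
    of Q is an idempotent times a unit: [unitize] replaces an element by a unit that differs from it
    by an element of infinite value wherever it is itself finite. [krull_akizuki] transports chain
    conditions from R to rings between R and Q. It yields uniformizers ([uniformizerP]) and
    [finite_valrings]; [weak_approximation] follows the classical pattern.

    For (E1), let x and y have values A and B. At a valuation centered in m, at most one class of c
    modulo m makes the value of x + c y exceed the minimum ([cancels_unique]). The residue field at
    m has at least as many classes as there are such valuations, so either some c is good at all of
    them, or every valuation centered in m cancels for some class; then B <= A at all of them and y
    itself is good ([local_minimum]). The Chinese remainder theorem glues the choices over all m
    ([global_minimum]).

    For (E2), residual rationality gives c in R with the same residue as x / y at the chosen
    valuation ([residue_rational]). Changed to a d outside all maximal ideals, it makes x - d y gain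
    value there without spoiling the others ([cancellation]).

    For (E0), analytic reducedness yields m such that alpha ^ m maps the integral closure into R
    ([conductor]). If y in E is regular, every element whose values are at least those of alpha ^ m
    y lies in R y, hence in E, and [unit_with_values] realizes all such values. *)

Definition max_member T (F : set (set T)) I :=
  F I /\ forall J, F J -> I `<=` J -> J = I.

Definition min_member T (F : set (set T)) I :=
  F I /\ forall J, F J -> J `<=` I -> J = I.

Section NoetherianRings.
Variable R : comNzRingType.
Implicit Types (I J M P : set R) (F : set (set R)).
Local Notation ideal := (@Defs.ideal R setT).
Local Notation maximal_ideal := (@Defs.maximal_ideal R setT).
Local Notation prime_ideal := (@Defs.prime_ideal R setT).

Lemma ideal0 I : ideal I -> I 0. Proof. by case. Qed.
Lemma idealD I x y : ideal I -> I x -> I y -> I (x + y).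
Proof. by case=> _ _ + _; exact. Qed.
Lemma idealM I a x : ideal I -> I x -> I (a * x).
Proof. by case=> _ _ _; exact. Qed.
Lemma idealMC I a x : ideal I -> I x -> I (x * a).
Proof. by rewrite mulrC; exact: idealM. Qed.
Lemma idealB I x y : ideal I -> I x -> I y -> I (x - y).
Proof. by move=> hI Ix Iy; apply: idealD => //; rewrite -mulN1r; exact: idealM. Qed.
Lemma ideal_sum I (T : Type) (s : seq T) (P : pred T) (f : T -> R) :
  ideal I -> (forall i, P i -> I (f i)) -> I (\sum_(i <- s | P i) f i).
Proof. by move=> [_ I0 ID _] h; elim/big_ind : _. Qed.

Lemma ideal1 I : ideal I -> I 1 -> I = setT.
Proof.
move=> hI I1; rewrite predeqE => x; split=> // _.
by rewrite -[x]mulr1; exact: idealM.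
Qed.

Definition ideal_adj I x : set R := [set z | exists2 y, I y & exists r, z = y + r * x].

Lemma ideal_adjP I x : ideal I -> ideal (ideal_adj I x).
Proof.
move=> hI; split=> //.
- by exists 0; [exact: ideal0|exists 0; rewrite mul0r addr0].
- move=> _ _ [y Iy [r ->]] [z Iz [s ->]]; exists (y + z); first exact: idealD.
  by exists (r + s); ring.
- move=> c _ _ [y Iy [r ->]]; exists (c * y); first exact: idealM.
  by exists (c * r); ring.
Qed.

Lemma sub_ideal_adj I x : I `<=` ideal_adj I x.
Proof. by move=> y Iy; exists y => //; exists 0; rewrite mul0r addr0. Qed.

Lemma mem_ideal_adj I x : ideal I -> ideal_adj I x x.
Proof. by move=> hI; exists 0; [exact: ideal0|exists 1; rewrite add0r mul1r]. Qed.

Lemma ideal_adj_sub I J x : ideal J -> I `<=` J -> J x -> ideal_adj I x `<=` J.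
Proof. by move=> hJ IJ Jx _ [y /IJ Jy [r ->]]; apply: idealD => //; exact: idealM. Qed.

Definition ideal_colon I x : set R := [set r | I (r * x)].

Lemma ideal_colonP I x : ideal I -> ideal (ideal_colon I x).
Proof.
move=> hI; split=> //; rewrite /ideal_colon /=.
- by rewrite mul0r; exact: ideal0.
- by move=> y z Iy Iz; rewrite mulrDl; exact: idealD.
- by move=> c y Iy; rewrite -mulrA; exact: idealM.
Qed.

Lemma sub_ideal_colon I x : ideal I -> I `<=` ideal_colon I x.
Proof. by move=> hI y Iy; exact: idealMC. Qed.

Definition principal (c : R) : set R := [set x | exists r, x = r * c].

Lemma principalP c : ideal (principal c).
Proof.
split=> //; first by exists 0; rewrite mul0r.
- by move=> _ _ [r ->] [s ->]; exists (r + s); rewrite mulrDl.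
- by move=> d _ _ [r ->]; exists (d * r); rewrite mulrA.
Qed.

Lemma sub_principal c I : ideal I -> I c -> principal c `<=` I.
Proof. by move=> hI Ic _ [r ->]; exact: idealM. Qed.

Lemma gen_idealP (s : seq R) I : ideal I ->
  (forall x, x \in s -> I x) -> gen_ideal s `<=` I.
Proof.
move=> hI sI _ [c ->]; apply: ideal_sum => // i _.
by apply: idealM => //; apply: sI; rewrite mem_nth.
Qed.

Lemma mem_gen_ideal (s : seq R) x : x \in s -> gen_ideal s x.
Proof.
move=> xs; have hi : (index x s < size s)%N by rewrite index_mem.
exists (fun i => (i == Ordinal hi)%:R).
rewrite (bigD1 (Ordinal hi)) //= eqxx mul1r nth_index // big1 ?addr0 //.
by move=> i /negbTE ->; rewrite mul0r.
Qed.

Hypothesis noethR : noetherian R.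

(** Otherwise choice produces a strictly increasing chain in [F]; its union is finitely generated,
    hence reached at a finite stage. *)
Lemma noetherian_max F : F !=set0 -> (forall I, F I -> ideal I) ->
  exists I, max_member F I.
Proof.
move=> [I0 FI0] Fid; apply: contrapT => nomax.
have step I : exists J, F I -> [/\ F J, I `<=` J & J <> I].
  have [FI|nFI] := pselect (F I); last by exists I.
  apply: contrapT => nJ; apply: nomax; exists I; split=> // J FJ IJ.
  by apply: contrapT => JI; apply: nJ; exists J.
have [g gP] := choice step.
pose C n := iter n g I0.
have FC n : F (C n) by elim: n => //= n /gP[].
have CS n : C n `<=` C n.+1 by have [] := gP _ (FC n).
have Cmono m n : (m <= n)%N -> C m `<=` C n.
  elim: n => [|n IH]; first by rewrite leqn0 => /eqP->.
  rewrite leq_eqVlt => /orP[/eqP-> //|]; rewrite ltnS => /IH h.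
  exact: subset_trans h (CS n).
pose U : set R := [set x | exists n, C n x].
have hU : ideal U.
  split=> //; first by exists 0%N; exact: ideal0 (Fid _ (FC _)).
  - move=> x y [m hx] [n hy]; exists (maxn m n).
    by apply: idealD; [exact: Fid|exact: Cmono (leq_maxl _ _) _ hx
                                 |exact: Cmono (leq_maxr _ _) _ hy].
  - by move=> c x _ [n hx]; exists n; apply: idealM => //; exact: Fid.
have [s Us] := noethR hU.
have [N hN] : exists N, forall x, x \in s -> C N x.
  have : forall x, x \in s -> U x by move=> x /mem_gen_ideal; rewrite -Us.
  elim: s {Us} => [|x s IH] h; first by exists 0%N.
  have [y ys|N hN] := IH; first by apply: h; rewrite inE ys orbT.
  have [n hn] := h x (mem_head _ _).
  exists (maxn N n) => y; rewrite inE => /orP[/eqP->|/hN].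
    exact: Cmono (leq_maxr _ _) _ hn.
  exact: Cmono (leq_maxl _ _) _.
have [_ _] := gP _ (FC N); apply; rewrite eqEsubset; split; last exact: CS.
move=> x Cx; apply: (gen_idealP (Fid _ (FC N)) hN).
by rewrite -Us; exists N.+1.
Qed.

Lemma sub_maximal_ideal I : ideal I -> I <> setT ->
  exists2 M, maximal_ideal M & I `<=` M.
Proof.
move=> hI IT.
have [|J []|M [[hM MT IM] Mmax]] :=
  @noetherian_max [set J | [/\ ideal J, J <> setT & I `<=` J]]; first 2 last.
- exists M => //; split=> // J hJ MJ.
  have [->|JT] := pselect (J = setT); [by right|left].
  by apply: Mmax => //; split=> //; exact: subset_trans MJ.
- by exists I; split.
- by [].
Qed.

(** An ideal maximal among those missing [T] is prime: enlarging it by [x] or by [y] meets [T], and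
    the product of the two elements found is again in [T]. *)
Lemma prime_avoiding (T : set R) : T 1 -> (forall x y, T x -> T y -> T (x * y)) ->
  ~ T 0 -> exists2 P, prime_ideal P & P `&` T = set0.
Proof.
move=> T1 TM T0.
have [|J []|P [[hP PT] Pmax]] :=
  @noetherian_max [set J | ideal J /\ J `&` T = set0]; first 2 last.
- exists P => //; split=> //.
    by move=> PE; have : (P `&` T) 1 by [rewrite PE]; rewrite PT.
  move=> x y _ _ Pxy; apply: contrapT => /not_orP[Px Py].
  have h z : ~ P z -> exists p r, P p /\ T (p + r * z).
    move=> Pz; apply: contrapT => nT; apply: Pz.
    rewrite -(Pmax (ideal_adj P z)); first exact: mem_ideal_adj.
      split; first exact: ideal_adjP.
      rewrite -subset0 => _ [[p Pp [r ->]] Tpr]; apply: nT; by exists p, r.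
    exact: sub_ideal_adj.
  have [p [r [Pp Tp]]] := h _ Px; have [q [s [Pq Tq]]] := h _ Py.
  have : (P `&` T) ((p + r * x) * (q + s * y)).
    split; last exact: TM.
    have -> : (p + r * x) * (q + s * y) = (q + s * y) * p + r * x * q + r * s * (x * y).
      by ring.
    by do 2?[apply: idealD => //]; exact: idealM.
  by rewrite PT.
- exists [set 0]; split; last by rewrite -subset0 => _ [->].
  by split=> //; [move=> _ _ -> ->; rewrite addr0|move=> c _ _ ->; rewrite mulr0].
- by [].
Qed.

Section DimensionOne.
Hypothesis dimR : krull_dim R 1.

(** If [P] lay properly inside a maximal [M], a prime [P0] avoiding all [s * c ^+ n] with [s]
    outside [P] would give the chain [P0 < P < M]. Regularity of [c] keeps 0 out of the avoided
    set. *)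
Lemma regular_prime_maximal P c : prime_ideal P -> P c -> regular c -> maximal_ideal P.
Proof.
move=> [hP PT Pprime] Pc regc.
have [M maxM PM] := sub_maximal_ideal hP PT.
suff <- : M = P by [].
apply: contrapT => MP.
pose T : set R := [set x | exists n s, ~ P s /\ x = s * c ^+ n].
have nP1 : ~ P 1 by move=> /(ideal1 hP).
have [|x y [m [s [Ps ->]]] [n [t [Pt ->]]]|[n [s [Ps e]]]|P0 primeP0 P0T] :=
  @prime_avoiding T.
- by exists 0%N, 1; rewrite mulr1.
- exists (m + n)%N, (s * t); split; first by move=> /(Pprime _ _ I I)[].
  by rewrite exprD; ring.
- apply: Ps; suff -> : s = 0 by exact: ideal0.
  have regcn : injective ( *%R (c ^+ n)) := lregX (n := n) regc.
  by apply: regcn; rewrite mulr0 mulrC.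
have P0P : P0 `<` P.
  split; last first.
    move=> /(_ _ Pc) P0c; suff : (P0 `&` T) c by rewrite P0T.
    by split=> //; exists 1%N, 1; rewrite mul1r expr1.
  move=> x P0x; apply: contrapT => Px; suff : (P0 `&` T) x by rewrite P0T.
  by split=> //; exists 0%N, x; rewrite mulr1.
have PltM : P `<` M.
  by split=> // MsP; apply: MP; rewrite eqEsubset.
have [_ /(_ 2%N (fun i => if i is i'.+1 then if i' is _.+1 then M else P else P0))] := dimR.
suff h : prime_chain 2 (fun i => if i is i'.+1 then if i' is _.+1 then M else P else P0).
  by move=> /(_ h).
split; first by case=> [|[|[|]]] // _; exact: maximal_prime.
by case=> [|[|]].
Qed.

(* Noetherian induction on [I]: either [I] is prime, hence maximal, or          *)
(* [x * y \in I] with [x, y \notin I], and an ideal [J] containing [I] is       *)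
(* determined inside a larger one by [J + (x)] and [J : x].                     *)
Lemma regular_min c F : regular c -> F !=set0 ->
  (forall I, F I -> ideal I /\ I c) -> exists I, min_member F I.
Proof.
move=> regc.
pose good I := forall F, F !=set0 -> (forall J, F J -> ideal J /\ I `<=` J) ->
  exists J, min_member F J.
suff : good (principal c).
  move=> gc F0 FP; apply: gc => // J /FP[hJ Jc]; split=> //.
  exact: sub_principal.
apply: contrapT => ngc.
have [|I []|I [[hI Ic nI] Imax]] :=
  @noetherian_max [set I | [/\ ideal I, I c & ~ good I]]; first 2 last.
- have goodS J : ideal J -> I `<=` J -> J <> I -> good J.
    move=> hJ IJ JI; apply: contrapT => nJ; apply: JI; apply: Imax => //.
    by split=> //; exact: IJ.
  apply: nI => G [G0 GG0] GP.
  have [IT|IT] := pselect (I = setT).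
    exists G0; split=> // J /GP[_]; rewrite IT => TJ _.
    have [_] := GP _ GG0; rewrite IT => TG0.
    by rewrite eqEsubset; split=> x _; [exact: TG0|exact: TJ].
  have [primeI|nprime] := pselect (prime_ideal I).
    have [_ _ Im] := regular_prime_maximal primeI Ic regc.
    have [GI|nGI] := pselect (G I).
      by exists I; split=> // J /GP[_ IJ] JI; rewrite eqEsubset.
    have GT J : G J -> J = setT.
      by move=> GJ; have [hJ /(Im _ hJ)[JI|//]] := GP _ GJ; rewrite JI in GJ.
    by exists G0; split=> // J /GT -> _; rewrite (GT _ GG0).
  have [x [y [Ix Iy Ixy]]] : exists x y, [/\ ~ I x, ~ I y & I (x * y)].
    apply: contrapT => h; apply: nprime; split=> // x y _ _ Ixy.
    by apply: contrapT => /not_orP[Ix Iy]; apply: h; exists x, y.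
  have gx : good (ideal_adj I x).
    apply: goodS; [exact: ideal_adjP|exact: sub_ideal_adj|].
    by move=> e; apply: Ix; rewrite -e; exact: mem_ideal_adj.
  have gy : good (ideal_colon I x).
    apply: goodS; [exact: ideal_colonP|exact: sub_ideal_colon|].
    by move=> e; apply: Iy; rewrite -e /ideal_colon /= mulrC.
  have [||_ [[J1 GJ1 <-] J1min]] := gx [set ideal_adj J x | J in G].
    - by exists (ideal_adj G0 x), G0.
    - move=> _ [J /GP[hJ IJ] <-]; split; first exact: ideal_adjP.
      by apply: ideal_adj_sub; [exact: ideal_adjP| |exact: mem_ideal_adj];
         apply: subset_trans IJ _; exact: sub_ideal_adj.
  have [||_ [[J [GJ JJ1] <-] Jmin]] := gy [set ideal_colon J x |
      J in [set J | G J /\ ideal_adj J x = ideal_adj J1 x]].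
    - by exists (ideal_colon J1 x), J1.
    - move=> _ [J [/GP[hJ IJ] _] <-]; split; first exact: ideal_colonP.
      by move=> r; exact: IJ.
  exists J; split=> // K GK KJ; rewrite eqEsubset; split=> //.
  have [hK IK] := GP _ GK; have [hJ IJ] := GP _ GJ.
  have KJ1 : ideal_adj K x = ideal_adj J1 x.
    apply: J1min; first by exists K.
    rewrite -JJ1; apply: ideal_adj_sub; [exact: ideal_adjP| |exact: mem_ideal_adj].
    by apply: subset_trans KJ _; exact: sub_ideal_adj.
  have KJ2 : ideal_colon K x = ideal_colon J x.
    by apply: Jmin; [exists K|move=> r /KJ].
  move=> z Jz; have : ideal_adj K x z by rewrite KJ1 -JJ1; exact: sub_ideal_adj.
  move=> [k Kk [r zE]]; have : ideal_colon J x r.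
    rewrite /ideal_colon /=; have -> : r * x = z - k by rewrite zE; ring.
    by apply: idealB => //; exact: KJ.
  by rewrite -KJ2 zE => Krx; exact: idealD.
- exists (principal c); split=> //; first exact: principalP.
  by exists 1; rewrite mul1r.
- by [].
Qed.

Lemma jacobson_unit c r : jacobson [set: R] c -> exists s, (1 - r * c) * s = 1.
Proof.
move=> [_ Jc].
have [e|nT] := pselect (principal (1 - r * c) = setT).
  have : principal (1 - r * c) 1 by rewrite e.
  by move=> [s e1]; exists s; rewrite mulrC -e1.
have [M maxM sM] := sub_maximal_ideal (principalP _) nT.
have [hM MT _] := maxM; case: MT; apply: (ideal1 hM).
have -> : 1 = (1 - r * c) + r * c :> R by ring.
apply: idealD => //; last by apply: idealM => //; exact: Jc.
by apply: sM; exists 1; rewrite mul1r.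
Qed.

(** The ideals generated by [c] and [y ^+ h] become stationary, so [y ^+ h] is congruent to
    [r * y ^+ h.+1] modulo [c], and [1 - r * y] is invertible. *)
Lemma jacobson_expr_dvd c y : regular c -> jacobson [set: R] y ->
  exists h, principal c (y ^+ h).
Proof.
move=> regc Jy.
pose X h : set R := ideal_adj (principal c) (y ^+ h).
have [||_ [[h _ <-] hmin]] := @regular_min c (range X) regc.
- by exists (X 0%N), 0%N.
- move=> _ [h _ <-]; split; first exact: ideal_adjP (principalP c).
  by apply: sub_ideal_adj; exists 1; rewrite mul1r.
exists h.
have : X h.+1 = X h.
  apply: hmin; first by exists h.+1.
  apply: ideal_adj_sub; [exact: ideal_adjP (principalP c)|exact: sub_ideal_adj|].
  by rewrite exprS; apply: idealM; [exact: ideal_adjP (principalP c)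
    |exact: mem_ideal_adj (principalP c)].
move=> e; have : X h (y ^+ h) by exact: mem_ideal_adj (principalP c).
rewrite -e => -[z cz [r yE]].
have [s hs] := jacobson_unit r Jy.
have zE : z = (1 - r * y) * y ^+ h.
  by rewrite mulrBl mul1r {1}yE exprS; ring.
have -> : y ^+ h = s * z by rewrite zE mulrA [s * _]mulrC hs mul1r.
by apply: idealM => //; exact: principalP.
Qed.

(** This is nilpotence of the Jacobson radical of the Artinian ring [R / (c)]. *)
Lemma jacobson_pow_sub c : regular c -> jacobson [set: R] c ->
  exists k, ideal_pow setT (jacobson [set: R]) k `<=` principal c.
Proof.
move=> regc Jc; set J := jacobson [set: R].
have hpow k : ideal (ideal_pow setT J k).
  by have [? ? ?] := ideal_pow_ideal J k; split=> // *; auto.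
pose X k : set R := [set z | exists2 u, ideal_pow setT J k u & principal c (z - u)].
have hX k : ideal (X k).
  have hc := principalP c; split=> //.
  - by exists 0; [exact: ideal0|rewrite subrr; exact: ideal0].
  - move=> z w [u Ju cu] [v Jv cv]; exists (u + v); first exact: idealD.
    by rewrite opprD addrACA; exact: idealD.
  - move=> b z _ [u Ju cu]; exists (b * u); first exact: idealM.
    by rewrite -mulrBr; exact: idealM.
have [||_ [[k _ <-] kmin]] := @regular_min c (range X) regc.
- by exists (X 0%N), 0%N.
- move=> _ [k _ <-]; split=> //; exists 0; first exact: ideal0.
  by rewrite subr0; exists 1; rewrite mul1r.
have powS : ideal_pow setT J k.+1 `<=` ideal_pow setT J k.
  move=> _ [s sP ->]; rewrite big_seq; apply: ideal_sum => // p /sP[_ p2].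
  exact: idealM.
have XS : X k.+1 = X k.
  by apply: kmin; [exists k.+1|move=> z [u /powS Ju cu]; exists u].
exists k => z Jz; apply: contrapT => cz.
have hc := principalP c.
(* A minimal [I] with [J ^ k I] not inside [(c)] turns out to be generated by [c] and [p.1 * x] with
   [p.1] in [J]; as in Nakayama's lemma [x] then lies in [(c)]. *)
pose G : set (set R) := [set I | [/\ ideal I, I c &
  exists u x, [/\ ideal_pow setT J k u, I x & ~ principal c (u * x)]]].
have [||I [[hI Ic [u [x [Ju Ix ux]]]] Imin]] := @regular_min c G regc.
- by exists setT; split=> //; exists z, 1; rewrite mulr1.
- by move=> I [].
have [v Jv cv] : X k.+1 u by rewrite XS; exists u => //; rewrite subrr; exact: ideal0.
have [p [[Jp1 Jp2] px]] : exists p : R * R,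
    (J p.1 /\ ideal_pow setT J k p.2) /\ ~ principal c (p.1 * p.2 * x).
  case: Jv => s sP vE; apply: contrapT => h; apply: ux.
  have -> : u * x = (u - v) * x + v * x by ring.
  apply: idealD => //; first exact: idealMC.
  rewrite vE mulr_suml big_seq; apply: ideal_sum => // p ps.
  by apply: contrapT => cp; apply: h; exists p; split=> //; exact: sP.
have IE : ideal_adj (principal c) (p.1 * x) = I.
  apply: Imin.
    split; [exact: ideal_adjP|apply: sub_ideal_adj; by exists 1; rewrite mul1r|].
    exists p.2, (p.1 * x); split=> //; first exact: mem_ideal_adj.
    by rewrite mulrA [p.2 * _]mulrC.
  by apply: ideal_adj_sub => //; [exact: sub_principal|exact: idealM].
have : ideal_adj (principal c) (p.1 * x) x by rewrite IE.
move=> [d cd [r xE]].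
have [s hs] := jacobson_unit r Jp1.
have dE : d = (1 - r * p.1) * x by rewrite mulrBl mul1r {1}xE; ring.
have xd : x = s * d by rewrite dE mulrA [s * _]mulrC hs mul1r.
by apply: ux; apply: idealM => //; rewrite xd; exact: idealM.
Qed.

End DimensionOne.

(** * Generic elements in reduced Noetherian rings *)

Section Reduced.
Hypothesis redR : reduced R.

Lemma reduced_mul2 (x y : R) : x * (x * y) = 0 -> x * y = 0.
Proof.
by move=> h; apply: (redR (n := 2)); rewrite expr2 -[RHS](mulr0 y) -h; ring.
Qed.

(* Choosing [a] with [ann (ann a)] maximal makes [ann a] minimal, and           *)
(* [ann (a + b) = ann a `&` ann b] when [a * b = 0] as R is reduced.            *)
Lemma reduced_generic (X : set R) : X !=set0 -> (forall x y, X x -> X y -> X (x + y)) ->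
  exists2 a, X a & forall b, X b -> a * b = 0 -> b = 0.
Proof.
move=> [x0 Xx0] XD.
pose ann2 a : set R := [set b | forall r, a * r = 0 -> b * r = 0].
have h2 a : ideal (ann2 a).
  split=> //; first by move=> r _; rewrite mul0r.
  - by move=> x y hx hy r ar; rewrite mulrDl hx // hy // addr0.
  - by move=> b x _ hx r ar; rewrite -mulrA hx // mulr0.
have [|I [a _ <-]|_ [[a Xa <-] amax]] := @noetherian_max [set ann2 a | a in X];
  first 2 last.
- exists a => // b Xb ab.
  have sab r : (a + b) * r = 0 -> a * r = 0.
    move=> abr; apply: reduced_mul2.
    have -> : a * (a * r) = a * ((a + b) * r) - r * (a * b) by ring.
    by rewrite abr ab !mulr0 subr0.
  have e : ann2 (a + b) = ann2 a.
    apply: amax; first by exists (a + b) => //; exact: XD.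
    by move=> x hx r /sab; exact: hx.
  have : ann2 a (a + b) by rewrite -e.
  move=> /(_ b ab) abb; apply: (redR (n := 2)); rewrite expr2 -abb mulrDl ab add0r //.
- by exists (ann2 x0), x0.
- exact: h2.
Qed.

(** Take [y] generic in the annihilator of [x]. By reducedness, what kills [x + y] kills [x], so it
    is an element of that annihilator killed by [y], that is 0. *)
Lemma reduced_add_regular (x : R) : exists2 y, x * y = 0 & regular (x + y).
Proof.
have [||y xy yP] := @reduced_generic [set y | x * y = 0].
- by exists 0; rewrite /= mulr0.
- by move=> y z /= xy xz; rewrite mulrDr xy xz addr0.
exists y => // u v /eqP; rewrite -subr_eq0 -mulrBr => /eqP e.
apply/eqP; rewrite -subr_eq0; apply/eqP.
have xuv : x * (u - v) = 0.
  apply: reduced_mul2; have -> : x * (x * (u - v)) = x * ((x + y) * (u - v)) - (x * y) * (u - v).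
    by ring.
  by rewrite e xy !mulr0 mul0r subr0.
apply: yP => //; have -> : y * (u - v) = (x + y) * (u - v) - x * (u - v) by ring.
by rewrite e xuv subr0.
Qed.

End Reduced.

End NoetherianRings.

(** * The Krull-Akizuki argument and existence of valuation rings *)

Section SubringTheory.
Variables (Q : comNzRingType) (S : set Q) (subS : subring S).

Lemma subring1 : S 1. Proof. by case: subS. Qed.
Lemma subringB x y : S x -> S y -> S (x - y). Proof. by case: subS => _ + _; exact. Qed.
Lemma subringM x y : S x -> S y -> S (x * y). Proof. by case: subS => _ _; exact. Qed.
Lemma subring0 : S 0. Proof. by rewrite -(subrr 1); apply: subringB; exact: subring1. Qed.
Lemma subringN x : S x -> S (- x).
Proof. by rewrite -sub0r; apply: subringB; exact: subring0. Qed.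
Lemma subringD x y : S x -> S y -> S (x + y).
Proof. by move=> Sx Sy; rewrite -[y]opprK; apply: subringB => //; exact: subringN. Qed.
Lemma subringX x n : S x -> S (x ^+ n).
Proof.
by move=> Sx; elim: n => [|n IH]; [rewrite expr0; exact: subring1
  |rewrite exprS; exact: subringM].
Qed.
Lemma subring_sum (T : Type) (s : seq T) (P : pred T) (f : T -> Q) :
  (forall i, P i -> S (f i)) -> S (\sum_(i <- s | P i) f i).
Proof. by move=> h; elim/big_ind : _ => //; [exact: subring0|exact: subringD]. Qed.
(** The subring [S[x]] of [Q]. *)
Definition poly_image (x : Q) : set Q :=
  [set y | exists2 p : {poly Q}, forall i, S p`_i & y = p.[x]].

Lemma subring_poly_image x : subring (poly_image x).
Proof.
split.
- exists 1; last by rewrite hornerE.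
  by move=> i; rewrite coef1; case: eqP => _; [exact: subring1|exact: subring0].
- move=> _ _ [p hp ->] [q hq ->]; exists (p - q); last by rewrite hornerD hornerN.
  by move=> i; rewrite coefB; exact: subringB.
- move=> _ _ [p hp ->] [q hq ->]; exists (p * q); last by rewrite hornerM.
  by move=> i; rewrite coefM; apply: subring_sum => j _; exact: subringM.
Qed.

Lemma sub_poly_image x : S `<=` poly_image x.
Proof.
move=> c Sc; exists c%:P; last by rewrite hornerC.
by move=> i; rewrite coefC; case: eqP => _ //; exact: subring0.
Qed.

Lemma mem_poly_image x : poly_image x x.
Proof.
exists 'X; last by rewrite hornerX.
by move=> i; rewrite coefX; case: eqP => _; [exact: subring1|exact: subring0].
Qed.

End SubringTheory.

Lemma expr_inv1 (Q : comNzRingType) (x y : Q) n : x * y = 1 -> x ^+ n * y ^+ n = 1.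
Proof. by move=> h; rewrite -exprMn h expr1n. Qed.

(* The properties of a one-dimensional reduced semilocal Cohen-Macaulay ring    *)
(* [A] inside its total ring of fractions [Q] = [A[1/a]], where [a] is a        *)
(* regular element of the Jacobson radical, that the valuation theory needs.    *)
Record dim1_setting (Q : comUnitRingType) (A : set Q) (a : Q) : Prop := {
  dim1_subring : subring A;
  dim1_unit : a \is a GRing.unit;
  dim1_mem : A a;
  dim1_denominator : forall q, exists h, A (a ^+ h * q);
  dim1_local : forall f r, A r -> f * (1 - a * r) = 0 -> f = 0;
  dim1_min : forall k (F : set (set Q)), F !=set0 ->
    (forall I, F I -> ideal A I /\ I (a ^+ k)) -> exists I, min_member F I;
  dim1_max : forall F : set (set Q), F !=set0 ->
    (forall I, F I -> ideal A I) -> exists I, max_member F I;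
  dim1_idem : forall x : Q,
    exists e u, [/\ e * e = e, u \is a GRing.unit & x = e * u]
}.

Section Valuations.
Variables (Q : comUnitRingType) (A : set Q) (a : Q).
Hypothesis settingA : dim1_setting A a.

Let subA : subring A. Proof. by case: settingA. Qed.
Let aU : a \is a GRing.unit. Proof. by case: settingA. Qed.
Let Aa : A a. Proof. by case: settingA. Qed.
Let Apow : forall q, exists h, A (a ^+ h * q). Proof. by case: settingA. Qed.

Local Notation ai := (a^-1).
Let aai : a * ai = 1. Proof. exact: divrr. Qed.
Let aaiX n : a ^+ n * ai ^+ n = 1. Proof. exact: expr_inv1. Qed.

(* The sequence [a ^ -m A + a B n] exhausts [B n] because the ideals            *)
(* [(a ^ k B n `&` A) + a A] of [A] have a minimal member, at [k = m] say.      *)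
Lemma krull_akizuki (B : nat -> set Q) :
  (forall n, subring (B n) /\ A `<=` B n) -> (forall n, B n.+1 `<=` B n) ->
  exists m n0, forall n x, (n0 <= n)%N -> B n x ->
    exists r b, [/\ A r, B n b & x = ai ^+ m * r + a * b].
Proof.
move=> Bsub Bdec.
have Bmono n k : (n <= k)%N -> B k `<=` B n.
  elim: k => [|k IH]; first by rewrite leqn0 => /eqP->.
  rewrite leq_eqVlt => /orP[/eqP-> //|]; rewrite ltnS => /IH h.
  exact: subset_trans (Bdec k) h.
pose I n k : set Q := [set r | A r /\
  exists b s, [/\ B n b, A s & r = a ^+ k * b + a * s]].
have hI n k : ideal A (I n k) /\ I n k (a ^+ 1).
  have [sB AB] := Bsub n; split; last first.
    split; first by rewrite expr1.
    exists 0, 1; split; [exact: subring0|exact: subring1|by rewrite expr1; ring].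
  split.
  - by move=> r [].
  - split; first exact: subring0.
    by exists 0, 0; split; [exact: subring0|exact: subring0|ring].
  - move=> x y [Ax [b [s [Bb As xE]]]] [Ay [c [t [Bc At yE]]]].
    split; first exact: subringD.
    exists (b + c), (s + t); split; [exact: subringD|exact: subringD|].
    by rewrite xE yE; ring.
  - move=> c x Ac [Ax [b [s [Bb As xE]]]]; split; first exact: subringM.
    exists (c * b), (c * s); split; [|exact: subringM|by rewrite xE; ring].
    by apply: subringM => //; exact: AB.
have [||_ [[[n0 m] _ <-] Imin]] := dim1_min settingA (k := 1) (F := [set I p.1 p.2 | p in setT]).
- by exists (I 0%N 0%N), (0%N, 0%N).
- by move=> _ [p _ <-].
have Ieq n k : (n0 <= n)%N -> (m <= k)%N -> I n k = I n0 m.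
  move=> hn hk; apply: Imin; first by exists (n, k).
  move=> r [Ar [b [s [Bb As rE]]]]; split=> //.
  exists (a ^+ (k - m) * b), s; split=> //.
    have [sB AB] := Bsub n0; apply: subringM => //; last exact: Bmono hn _ Bb.
    by apply: subringX => //; exact: AB.
  by rewrite mulrA -exprD subnKC.
exists m, n0 => n x hn Bx.
have [sB AB] := Bsub n.
(* Descent on the power of [1 / a]: above [m], stationarity makes [u] a multiple of [a] up to
   [a ^+ h.+2 * B n], which removes one factor [1 / a]. *)
have main h y : B n y -> (exists u b, [/\ A u, B n b & y = ai ^+ h * u + a * b]) ->
    exists r b, [/\ A r, B n b & y = ai ^+ m * r + a * b].
  move=> By; elim: h => [|h IH] [u [b [Au Bb yE]]].
    exists (a ^+ m * u), b; split=> //.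
      by apply: subringM => //; exact: subringX.
    by rewrite yE; ring: (aaiX m).
  have [hm|hm] := leqP h.+1 m.
    exists (a ^+ (m - h.+1) * u), b; split=> //.
      by apply: subringM => //; exact: subringX.
    rewrite yE -{1}(subnK hm) exprD; congr (_ + _).
    by rewrite -[LHS]mul1r -(aaiX (m - h.+1)); ring.
  have : I n h.+1 u.
    split=> //; exists (y - a * b), 0; split; [|exact: subring0|].
      by apply: subringB => //; apply: subringM => //; exact: AB.
    by rewrite yE; ring: (aaiX h.+1).
  have mh1 : (m <= h.+1)%N by exact: ltnW.
  have -> : I n h.+1 = I n h.+2 by rewrite !Ieq // ltnW.
  move=> [_ [u' [v [Bu' Av uE]]]]; apply: IH.
  exists v, (u' + b); split=> //; first exact: subringD.
  rewrite yE uE !exprS; have := aaiX h; move: (a ^+ h) (ai ^+ h) => p q pq.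
  ring: aai pq.
have [h Ah] := Apow x; apply: (main h) => //; exists (a ^+ h * x), 0.
by split=> //; [exact: subring0|ring: (aaiX h)].
Qed.

Definition valring (V : set Q) : Prop := [/\ subring V, A `<=` V, V `<` setT &
  forall x y, ~ V x -> ~ V y -> ~ V (x * y)].

(* If [C] is maximal among the subrings containing [C0] but not [b^-1], and     *)
(* [x, y \notin C], then [1 \in b C[x]] and [1 \in b C[y]]; when [x * y \in C]  *)
(* the degrees of these two relations can be decreased alternately.             *)
Lemma valring_avoiding (C0 : set Q) b : subring C0 -> A `<=` C0 -> C0 b ->
  b \is a GRing.unit -> ~ C0 b^-1 -> exists V, [/\ valring V, C0 `<=` V & ~ V b^-1].
Proof.
move=> subC0 AC0 C0b bU C0b'.
pose good (C : set Q) := [/\ subring C, C0 `<=` C & ~ C b^-1].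
(* Uniting with [C0] provides for the empty chain. *)
have [|X [gX Xmax]] := @Zorn_bigcup Q [set X | good (X `|` C0)].
  move=> F Fgood Ftot; rewrite /good /=.
  have F0 X : F X -> X b^-1 -> False by move=> /Fgood[_ _ nb] Xb; apply: nb; left.
  split.
  - have two x y : (\bigcup_(X in F) X `|` C0) x -> (\bigcup_(X in F) X `|` C0) y ->
        exists X, [/\ subring X, X `<=` \bigcup_(X in F) X `|` C0, X x & X y].
      move=> [[X FX Xx]|C0x] [[Y FY Yy]|C0y].
      - have [XY|YX] := Ftot _ _ FX FY.
          exists (Y `|` C0); split; [by have [] := Fgood _ FY| |by left; exact: XY|by left].
          by move=> z [Yz|]; [left; exists Y|right].
        exists (X `|` C0); split; [by have [] := Fgood _ FX| |by left|by left; exact: YX].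
        by move=> z [Xz|]; [left; exists X|right].
      - exists (X `|` C0); split; [by have [] := Fgood _ FX| |by left|by right].
        by move=> z [Xz|]; [left; exists X|right].
      - exists (Y `|` C0); split; [by have [] := Fgood _ FY| |by right|by left].
        by move=> z [Yz|]; [left; exists Y|right].
      - by exists C0; split=> // z; right.
    split; first by right; exact: subring1.
    + move=> x y /two h /h[X [sX XU Xx Xy]]; apply: XU; exact: subringB.
    + move=> x y /two h /h[X [sX XU Xx Xy]]; apply: XU; exact: subringM.
  - by move=> z; right.
  - by move=> [[X FX]|//]; exact: F0.
pose C := X `|` C0.
have [sC C0C Cb'] := gX; rewrite -/C in sC C0C Cb'.
have Cb : C b by exact: C0C.
have Cmax D : subring D -> C `<=` D -> ~ D b^-1 -> D `<=` C.
  move=> sD CD Db'; apply: contrapT => DC.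
  have C0D : C0 `<=` D by exact: subset_trans CD.
  apply: (Xmax D); last by rewrite /= setUidl.
  split; first by move=> x Xx; apply: CD; left.
  by move=> DX; apply: DC => x /DX; left.
have expand x : ~ C x -> exists2 p : {poly Q}, forall i, C p`_i & 1 = b * p.[x].
  move=> Cx; have : poly_image C x b^-1.
    apply: contrapT => nb; apply: Cx; apply: (Cmax (poly_image C x)) => //.
    - exact: subring_poly_image.
    - exact: sub_poly_image.
    - exact: mem_poly_image.
  by move=> [p Cp e]; exists p => //; rewrite -e divrr.
have descent n x y (p q : {poly Q}) : (size p + size q <= n)%N -> C (x * y) ->
    (forall i, C p`_i) -> (forall i, C q`_i) -> 1 = b * p.[x] -> 1 = b * q.[y] -> False.
  elim: n x y p q => [|n IH] x y p q.
    rewrite leqn0 addn_eq0 size_poly_eq0 => /andP[/eqP-> _] _ _ _ + _.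
    by rewrite horner0 mulr0 => /eqP; rewrite oner_eq0.
  wlog : x y p q / (size q <= size p)%N.
    move=> W sz Cxy Cp Cq ep eq; have [qp|pq] := leqP (size q) (size p).
      exact: (W x y p q).
    by apply: (W y x q p) => //; [exact: ltnW|rewrite addnC|rewrite mulrC].
  move=> qp sz Cxy Cp Cq ep eq.
  have sp : (1 < size p)%N.
    rewrite ltnNge; apply/negP => /size1_polyC pE; apply: Cb'.
    suff -> : b^-1 = p`_0 by exact: Cp.
    by apply: (mulrI bU); rewrite divrr // ep {1}pE hornerC.
  pose d := (size p).-1.
  have spE : size p = d.+1 by rewrite prednK // ltnW.
  have d0 : (0 < d)%N by rewrite -ltnS -spE.
  (* The relation for [y] times [x ^+ d], rewritten through [x * y], expresses [x ^+ d] times one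
     minus [b] times the constant term of [q] by lower powers of [x]. *)
  pose r : {poly Q} := \sum_(j < d) (q`_j.+1 * (x * y) ^+ j.+1) *: 'X^(d - j.+1).
  have rC i : C r`_i.
    rewrite coef_sum; apply: subring_sum => // j _; rewrite coefZ coefXn.
    apply: subringM => //; first by apply: subringM => //; exact: subringX.
    by case: (i == _); [exact: subring1|exact: subring0].
  have rx : x ^+ d * (1 - b * q`_0) = b * r.[x].
    have qy : q.[y] = \sum_(i < d.+1) q`_i * y ^+ i.
      by apply: horner_coef_wide; rewrite -spE.
    have -> : 1 - b * q`_0 = b * \sum_(j < d) q`_j.+1 * y ^+ j.+1.
      by rewrite {1}eq qy big_ord_recl expr0 mulr1 mulrDr addrAC subrr add0r.
    rewrite mulrCA; congr (_ * _); rewrite mulr_sumr horner_sum.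
    apply: eq_bigr => j _; rewrite hornerZ hornerXn exprMn.
    by rewrite -{1}(subnK (ltn_ord j)) exprD; ring.
  have rs : (size r <= d)%N.
    apply: leq_trans (size_sum _ _ _) _; apply/bigmax_leqP => j _.
    apply: leq_trans (size_scale_leq _ _) _; rewrite size_polyXn.
    by rewrite -subSn ?subSS ?leq_subr // ltn_ord.
  pose p0 := take_poly d p.
  have p0C i : C p0`_i.
    by rewrite coef_take_poly; case: ifP => // _; exact: subring0.
  have p0s : (size p0 <= d)%N by exact: size_take_poly.
  have px : p.[x] = p0.[x] + p`_d * x ^+ d.
    rewrite (horner_coef_wide _ p0s) horner_coef spE big_ord_recr /=; congr (_ + _).
    by apply: eq_bigr => i _; rewrite coef_take_poly ltn_ord.
  (* The relation for [x], multiplied by that same factor, with its leading term replaced by means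
     of [r]. *)
  pose p' := (q`_0)%:P + (1 - b * q`_0) *: p0 + (b * p`_d) *: r.
  apply: (IH x y p' q) => //.
  - rewrite -ltnS; apply: leq_trans sz; rewrite ltn_add2r spE ltnS.
    rewrite /p'; apply: leq_trans (size_polyD _ _) _; rewrite geq_max; apply/andP; split.
      apply: leq_trans (size_polyD _ _) _; rewrite geq_max; apply/andP; split.
        by apply: leq_trans (size_polyC_leq1 _) d0.
      by apply: leq_trans (size_scale_leq _ _) p0s.
    by apply: leq_trans (size_scale_leq _ _) rs.
  - have C1 := subring1 sC => i; rewrite /p' !coefD !coefZ coefC.
    apply: subringD => //; first apply: subringD => //.
    + by case: eqP => _ //; exact: subring0.
    + by apply: subringM => //; apply: subringB => //; exact: subringM.
    + by apply: subringM => //; exact: subringM.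
  - rewrite /p' !hornerD !hornerZ hornerC -[LHS](subrK (b * q`_0)) -[X in X + _]mulr1 {2}ep px.
    have := rx; move: (r.[x]) (p0.[x]) (x ^+ d) => rr pp xd rx'.
    have -> : (1 - b * q`_0) * (b * (pp + p`_d * xd)) =
      b * ((1 - b * q`_0) * pp) + b * p`_d * (xd * (1 - b * q`_0)) by ring.
    rewrite rx'; ring.
exists C; split=> //; split=> //.
- exact: subset_trans C0C.
- by split=> // /(_ b^-1 I).
- move=> x y Cx Cy Cxy; have [p Cp ep] := expand _ Cx; have [q Cq eq] := expand _ Cy.
  exact: (@descent _ x y p q (leqnn _)).
Qed.

End Valuations.

(** * Valuation rings and uniformizers *)

Section ValuationRings.
Variables (Q : comUnitRingType) (A : set Q) (a : Q).
Hypothesis settingA : dim1_setting A a.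

Let subA : subring A. Proof. by case: settingA. Qed.
Let aU : a \is a GRing.unit. Proof. by case: settingA. Qed.
Let Aa : A a. Proof. by case: settingA. Qed.
Let Apow : forall q, exists h, A (a ^+ h * q). Proof. by case: settingA. Qed.

Local Notation ai := (a^-1).
Local Notation valring := (valring A).
Let aai : a * ai = 1. Proof. exact: divrr. Qed.
Let aaiX n : a ^+ n * ai ^+ n = 1. Proof. exact: expr_inv1. Qed.

(** For a valuation ring [V] these are the elements of value infinity: the largest ideal of [Q]
    inside [V]. *)
Definition infinite_at (V : set Q) x := forall q, V (q * x).
(** The maximal ideal of [V], written without inverses because [Q] has zero divisors. Closure under
    addition, [val_idealD], comes from a uniformizer. *)
Definition val_ideal (V : set Q) x := exists2 y, ~ V y & V (x * y).

Lemma infinite_atM V q x : infinite_at V x -> infinite_at V (q * x).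
Proof. by move=> h r; rewrite mulrA. Qed.

Lemma infinite_atN V x : infinite_at V x -> infinite_at V (- x).
Proof. by move=> h r; rewrite mulrN -mulNr. Qed.

Lemma infinite_at_mem V x : infinite_at V x -> V x.
Proof. by move=> /(_ 1); rewrite mul1r. Qed.

Section OneRing.
Variable V : set Q.
Hypothesis valV : valring V.

Lemma valring_subring : subring V. Proof. by case: valV. Qed.
Let V1 : V 1 := subring1 valring_subring.
Let V0 : V 0 := subring0 valring_subring.
Let VB x y : V x -> V y -> V (x - y) := @subringB _ _ valring_subring x y.
Let VD x y : V x -> V y -> V (x + y) := @subringD _ _ valring_subring x y.
Let VM x y : V x -> V y -> V (x * y) := @subringM _ _ valring_subring x y.
Let VX x n : V x -> V (x ^+ n) := @subringX _ _ valring_subring x n.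

Lemma sub_valring : A `<=` V. Proof. by case: valV. Qed.

Lemma valring_coprime x y : ~ V x -> ~ V y -> ~ V (x * y).
Proof. by case: valV => _ _ _; exact. Qed.

Lemma valring_dvd x y : x * y = 1 -> V x \/ V y.
Proof.
move=> xy; apply: contrapT => /not_orP[Vx Vy].
by apply: (valring_coprime Vx Vy); rewrite xy.
Qed.

Lemma valring_inv x : x \is a GRing.unit -> ~ V x -> V x^-1.
Proof. by move=> xU Vx; have [] // := valring_dvd (divrr xU). Qed.

Lemma valring_den : ~ V ai.
Proof.
move=> Vai; case: valV => _ AV [_ nTV] _; apply: nTV => q _.
have [h Aq] := Apow q.
rewrite -[q]mul1r -(aaiX h) mulrAC mulrC; apply: VM; first exact: VX.
exact: AV.
Qed.

Lemma not_infinite_at_unit x : x \is a GRing.unit -> ~ infinite_at V x.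
Proof.
move=> xU /(infinite_atM x^-1)/(infinite_atM ai)/infinite_at_mem.
by rewrite mulVr // mulr1; exact: valring_den.
Qed.

Lemma infinite_at_ideal x : infinite_at V x -> val_ideal V x.
Proof. by move=> h; exists ai; [exact: valring_den|rewrite mulrC]. Qed.

Lemma val_ideal_mem x : val_ideal V x -> V x.
Proof. by move=> [y Vy Vxy]; apply: contrapT => Vx; exact: (valring_coprime Vx Vy). Qed.

Lemma infinite_at_idem e : e * e = e -> infinite_at V e \/ infinite_at V (1 - e).
Proof.
move=> ee; apply: contrapT => /not_orP[/existsNP[q hq] /existsNP[r hr]].
apply: (valring_coprime hq hr).
have -> : q * e * (r * (1 - e)) = q * r * (e - e * e) by ring.
by rewrite ee subrr mulr0.
Qed.

Lemma valring_congr x y : infinite_at V (x - y) -> V x <-> V y.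
Proof.
move=> h; split=> [Vx|Vy].
  have -> : y = x - (x - y) by ring.
  by apply: VB => //; exact: infinite_at_mem.
have -> : x = y + (x - y) by ring.
by apply: VD => //; exact: infinite_at_mem.
Qed.

Lemma val_idealPn x y : ~ val_ideal V x -> V (x * y) -> V y.
Proof. by move=> nx Vxy; apply: contrapT => Vy; apply: nx; exists y. Qed.

Lemma not_val_ideal1 : ~ val_ideal V 1.
Proof. by move=> [y Vy]; rewrite mul1r. Qed.

Lemma not_val_idealM x y : ~ val_ideal V x -> ~ val_ideal V y -> ~ val_ideal V (x * y).
Proof.
move=> nx ny [z Vz h]; apply: Vz; apply: (val_idealPn ny); apply: (val_idealPn nx).
by rewrite mulrA.
Qed.

Lemma val_idealM x y : V x -> val_ideal V y -> val_ideal V (x * y).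
Proof. by move=> Vx [z Vz Vyz]; exists z => //; rewrite -mulrA; exact: VM. Qed.

Lemma val_idealVn x : x \is a GRing.unit -> val_ideal V x <-> ~ V x^-1.
Proof.
move=> xU; split=> [[y Vy Vxy] Vx'|h]; last by exists x^-1; rewrite ?divrr.
by apply: Vy; rewrite -[y](mulKr xU); exact: VM.
Qed.

Lemma val_ideal_den : val_ideal V a.
Proof. by exists ai; [exact: valring_den|rewrite aai]. Qed.

End OneRing.

(* With [x = e * w], take [u = e * w + (1 - e) * g].                            *)
Lemma unitize x g : g \is a GRing.unit -> exists2 u, u \is a GRing.unit &
  forall V, valring V -> (infinite_at V x /\ infinite_at V (u - g)) \/ infinite_at V (u - x).
Proof.
move=> gU; have [e [w [ee wU xE]]] := dim1_idem settingA x.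
have wv : w * w^-1 = 1 by exact: divrr.
have gg : g * g^-1 = 1 by exact: divrr.
exists (e * w + (1 - e) * g).
  apply/unitrPr; exists (e * w^-1 + (1 - e) * g^-1).
  have -> : (e * w + (1 - e) * g) * (e * w^-1 + (1 - e) * g^-1) =
    e * e * (w * w^-1) + (e - e * e) * (w * g^-1 + g * w^-1) +
    (1 - e - e + e * e) * (g * g^-1) by ring.
  by rewrite wv gg ee subrr mul0r; ring.
move=> V valV; have [he|he] := infinite_at_idem valV ee; [left|right].
  split; first by rewrite xE mulrC; exact: infinite_atM.
  have -> : e * w + (1 - e) * g - g = (w - g) * e by ring.
  exact: infinite_atM.
have -> : e * w + (1 - e) * g - x = g * (1 - e) by rewrite xE; ring.
exact: infinite_atM.
Qed.

Lemma unitize_valring V x : valring V -> ~ infinite_at V x ->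
  exists2 u, u \is a GRing.unit & infinite_at V (u - x).
Proof.
move=> valV nx; have [u uU uP] := unitize x (unitr1 Q).
by exists u => //; have [[]|] := uP V valV.
Qed.

(** The last clause is the Archimedean property: not all powers of [t] divide [a]. *)
Definition uniformizer (V : set Q) t := [/\ t \is a GRing.unit, V t, ~ V t^-1,
  forall x, val_ideal V x -> V (x * t^-1) & exists n, ~ V (a * t^-1 ^+ n)].

(** Each [x] in [G] divides [a] and is congruent to some [a ^- m * r] modulo [a V]. Hence [x V] is
    controlled by the ideal [I x] of those [r] in [A] with [a ^- m * r] in [x V], and the maximal
    condition in [A] applies. *)
Lemma valring_max V (G : set Q) : valring V -> G !=set0 ->
  (forall x, G x -> [/\ x \is a GRing.unit, V x & V (a * x^-1)]) ->
  exists2 t, G t & forall x, G x -> V (t * x^-1) -> V (x * t^-1).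
Proof.
move=> valV [x0 Gx0] GP; have sV := valring_subring valV; have AV := sub_valring valV.
have [m [n0 hm]] := krull_akizuki settingA (B := fun=> V) (fun=> conj sV AV) (fun=> @subset_refl _ V).
pose I x : set Q := [set r | A r /\ V (ai ^+ m * r * x^-1)].
have [||_ [[t Gt <-] tmax]] := dim1_max settingA (F := [set I x | x in G]).
- by exists (I x0), x0.
- move=> _ [x Gx <-]; split; first by move=> r [].
  + by split; [exact: subring0|rewrite mulr0 mul0r; exact: subring0].
  + move=> r s [Ar Vr] [As Vs]; split; first exact: subringD.
    by rewrite mulrDr mulrDl; exact: subringD.
  + move=> c r Ac [Ar Vr]; split; first exact: subringM.
    have -> : ai ^+ m * (c * r) * x^-1 = c * (ai ^+ m * r * x^-1) by ring.
    by apply: subringM => //; exact: AV.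
exists t => // x Gx Vtx.
have [xU Vx Vax] := GP _ Gx; have [tU Vt Vat] := GP _ Gt.
have tt : t * t^-1 = 1 by exact: divrr.
have xx : x * x^-1 = 1 by exact: divrr.
have It : I x = I t.
  apply: tmax; first by exists x.
  move=> r [Ar Vr]; split=> //.
  have -> : ai ^+ m * r * x^-1 = ai ^+ m * r * t^-1 * (t * x^-1) by ring: tt.
  exact: subringM.
have [r [b [Ar Vb xE]]] := hm _ x (leqnn n0) Vx.
have rE : ai ^+ m * r = x - a * b by rewrite [in RHS]xE; ring.
have : I x r.
  split=> //; rewrite rE mulrBl xx.
  have -> : a * b * x^-1 = b * (a * x^-1) by ring.
  by apply: subringB => //; [exact: subring1|exact: subringM].
rewrite It => -[_]; rewrite rE => h.
have -> : x * t^-1 = (x - a * b) * t^-1 + b * (a * t^-1) by ring.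
by apply: subringD => //; exact: subringM.
Qed.

(** Choose [t V] largest among the ideals generated by units of [Q] that lie in [val_ideal V] and
    divide [a]. If all powers of [t] divided [a], the ideals [a * t ^- n V] would increase
    strictly. *)
Lemma uniformizerP V : valring V -> exists t, uniformizer V t.
Proof.
move=> valV; have sV := valring_subring valV; have AV := sub_valring valV.
have Va' := valring_den valV.
have [||t [tU Vt Vt' Vat] tmax] := @valring_max V
  [set x | [/\ x \is a GRing.unit, V x, ~ V x^-1 & V (a * x^-1)]] valV.
- exists a; split=> //; first exact: AV.
  by rewrite aai; exact: subring1.
- by move=> x [].
have tt : t * t^-1 = 1 by exact: divrr.
exists t; split=> //.
- suff main u : u \is a GRing.unit -> val_ideal V u -> V (u * t^-1).
    move=> x mx; have [ix|nx] := pselect (infinite_at V x); first by rewrite mulrC.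
    have [u uU ux] := unitize_valring valV nx.
    have h : infinite_at V (x - u) by rewrite -opprB; exact: infinite_atN.
    have -> : x * t^-1 = u * t^-1 + t^-1 * (x - u) by ring.
    apply: subringD => //; apply: main => //.
    have -> : u = x + (u - x) by ring.
    have [y Vy Vxy] := mx; exists y => //.
    by rewrite mulrDl; apply: subringD => //; rewrite mulrC.
  move=> uU mu; have Vu := val_ideal_mem valV mu.
  have Vu' := (val_idealVn valV uU).1 mu.
  have uu : u * u^-1 = 1 by exact: divrr.
  have [Vau|nVau] := pselect (V (a * u^-1)).
    have [Vut|Vtu] := @valring_dvd V valV (u * t^-1) (t * u^-1) ltac:(ring: uu tt) => //.
    exact: tmax.
  (* If [u] does not divide [a], then [a] divides [u], and [t] divides [a]. *)
  have Vua : V (u * ai).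
    by have [] // := @valring_dvd V valV (a * u^-1) (u * ai) ltac:(ring: uu aai).
  have -> : u * t^-1 = (u * ai) * (a * t^-1) by ring: aai.
  exact: subringM.
- apply: contrapT => /forallNP h.
  have {}h n : V (a * t^-1 ^+ n) by apply: contrapT.
  have tn n : t ^+ n * t^-1 ^+ n = 1 by exact: expr_inv1.
  have uE n : (a * t^-1 ^+ n)^-1 = t ^+ n * ai.
    by rewrite invrM ?unitrX ?unitrV // exprVn invrK.
  have [||_ [n _ <-] nmax] := @valring_max V (range (fun n => a * t^-1 ^+ n)) valV.
  + by exists (a * t^-1 ^+ 0), 0%N.
  + move=> _ [n _ <-]; split=> //; first by rewrite unitrM aU unitrX // unitrV.
    rewrite uE mulrCA aai mulr1; exact: subringX.
  + apply: Vt'.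
    have := nmax _ (ex_intro2 _ _ n.+1 I erefl); rewrite !uE !exprS.
    have -> : a * t^-1 ^+ n * (t * t ^+ n * ai) = t.
      by have := tn n; move: (t ^+ n) (t^-1 ^+ n) => p q pq; ring: pq aai.
    have -> : a * (t^-1 * t^-1 ^+ n) * (t ^+ n * ai) = t^-1.
      by have := tn n; move: (t ^+ n) (t^-1 ^+ n) => p q pq; ring: pq aai.
    exact.
Qed.

End ValuationRings.

(** * Weak approximation *)

Section Approximation.
Variables (Q : comUnitRingType) (A : set Q) (a : Q).
Hypothesis settingA : dim1_setting A a.

Let subA : subring A. Proof. by case: settingA. Qed.
Let aU : a \is a GRing.unit. Proof. by case: settingA. Qed.
Let Aa : A a. Proof. by case: settingA. Qed.
Let Apow : forall q, exists h, A (a ^+ h * q). Proof. by case: settingA. Qed.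

Local Notation ai := (a^-1).
Local Notation valring := (valring A).
Let aai : a * ai = 1. Proof. exact: divrr. Qed.
Let aaiX n : a ^+ n * ai ^+ n = 1. Proof. exact: expr_inv1. Qed.

Lemma val_idealD V x y : valring V -> val_ideal V x -> val_ideal V y -> val_ideal V (x + y).
Proof.
move=> valV mx my; have [t [tU Vt Vt' tP _]] := uniformizerP settingA valV.
exists t^-1 => //; rewrite mulrDl.
by apply: (subringD (valring_subring valV)); exact: tP.
Qed.

Lemma val_idealN (V : set Q) x : valring V -> val_ideal V x -> val_ideal V (- x).
Proof.
by move=> valV [y Vy Vxy]; exists y; rewrite // mulNr; exact: subringN (valring_subring valV) _ _.
Qed.

Lemma val_ideal_sub1 V x : valring V -> val_ideal V (x - 1) -> ~ val_ideal V x.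
Proof.
move=> valV m1 mx; apply: (@not_val_ideal1 _ V).
have -> : 1 = x - (x - 1) by ring.
by apply: val_idealD => //; exact: val_idealN.
Qed.

Lemma val_ideal_den_mul V x : valring V -> V (x * ai) -> val_ideal V x.
Proof.
move=> valV Vx; have -> : x = x * ai * a by ring: aai.
by apply: (val_idealM valV) => //; exact: (val_ideal_den settingA).
Qed.

Lemma valring_exp_ai V x k l : valring V -> (k <= l)%N -> V (x * ai ^+ l) -> V (x * ai ^+ k).
Proof.
move=> valV kl Vx; have sV := valring_subring valV.
have -> : x * ai ^+ k = x * ai ^+ l * a ^+ (l - k).
  rewrite -{1}(subnKC kl) exprD; have := aaiX (l - k).
  by move: (a ^+ _) (ai ^+ (l - k)) => p q pq; ring: pq.
by apply: subringM => //; apply: subringX => //; exact: sub_valring valV _ Aa.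
Qed.

(** The uniformizer [t] divides [y], and [a] divides [t ^+ n] once [t ^+ n] fails to divide [a]. *)
Lemma val_ideal_exp V y N : valring V -> val_ideal V y ->
  exists k0, forall k, (k0 <= k)%N -> V (y ^+ k * ai ^+ N).
Proof.
move=> valV my; have sV := valring_subring valV.
have [t [tU Vt Vt' tP [n nVt]]] := uniformizerP settingA valV.
have Vtn : V (t ^+ n * ai).
  have [] // := @valring_dvd _ A V valV (a * t^-1 ^+ n) (t ^+ n * ai).
  have := expr_inv1 n (divrr tU).
  by move: (t ^+ n) (t^-1 ^+ n) => p q pq; ring: pq aai.
exists (n * N)%N => k /subnK <-.
have -> : y ^+ (k - n * N + n * N) * ai ^+ N =
    y ^+ (k - n * N) * (y * t^-1) ^+ (n * N) * (t ^+ n * ai) ^+ N.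
  rewrite exprD !exprMn -exprM; have := expr_inv1 (n * N) (divrr tU).
  by move: (t ^+ _) (t^-1 ^+ _) => p q pq; ring: pq.
apply: subringM => //; last exact: subringX.
by apply: subringM => //; apply: subringX => //; [exact: (val_ideal_mem valV)|exact: tP].
Qed.

(** Rank one: a unit [u] in [W] but not in [V] has its inverse in the maximal ideal of [V], so [a]
    divides [u ^- k] in [V]; multiplying by [u ^+ k] puts [1 / a] in [W]. *)
Lemma valring_incomparable V W : valring V -> valring W -> V `<=` W -> V = W.
Proof.
move=> valV valW VW; rewrite eqEsubset; split=> // x Wx; apply: contrapT => Vx.
have sW := valring_subring valW.
have [|u uU ux] := unitize_valring settingA valV (x := x).
  by move=> /infinite_at_mem.
have Wu : W u.
  have -> : u = x + (u - x) by ring.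
  by apply: subringD => //; apply: VW; exact: infinite_at_mem.
have Vu : ~ V u by move=> /(valring_congr valV ux).
have mu : val_ideal V u^-1 by apply/(val_idealVn valV); rewrite ?unitrV // invrK.
have [k /(_ k (leqnn k))/VW Wk] := val_ideal_exp 1 valV mu.
apply: (valring_den settingA valW).
have -> : ai = u ^+ k * (u^-1 ^+ k * ai ^+ 1).
  have := expr_inv1 k (divrr uU).
  by move: (u ^+ _) (u^-1 ^+ _) => p q pq; rewrite expr1; ring: pq.
by apply: subringM => //; exact: subringX.
Qed.

(** With [x] in [W] only and [y] in [V] only, both replaced by units, the quotient of the first by
    the second is as required. *)
Lemma valring_separated V W : valring V -> valring W -> V <> W ->
  exists2 z, ~ V z & val_ideal W z.
Proof.
move=> valV valW VW; have sV := valring_subring valV; have sW := valring_subring valW.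
have [x Wx Vx] : exists2 x, W x & ~ V x.
  apply: contrapT => h; apply: VW; rewrite (valring_incomparable valW valV) //.
  by move=> x Wx; apply: contrapT => Vx; apply: h; exists x.
have [y Vy Wy] : exists2 y, V y & ~ W y.
  apply: contrapT => h; apply: VW; rewrite (valring_incomparable valV valW) //.
  by move=> y Vy; apply: contrapT => Wy; apply: h; exists y.
have main X Y u v : valring X -> valring Y -> X u -> ~ Y u ->
    (infinite_at X u /\ infinite_at X (v - 1)) \/ infinite_at X (v - u) ->
    (infinite_at Y u /\ infinite_at Y (v - 1)) \/ infinite_at Y (v - u) -> X v /\ ~ Y v.
  move=> valX valY Xu Yu hX [[/infinite_at_mem //]|hY]; split.
    by case: hX => [[_ h]|h]; apply/(valring_congr valX h) => //;
      exact: subring1 (valring_subring valX).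
  by move=> /(valring_congr valY hY).
have [u uU uP] := unitize settingA x (unitr1 Q).
have [v vU vP] := unitize settingA y (unitr1 Q).
have [Wu Vu] := main _ _ _ _ valW valV Wx Vx (uP _ valW) (uP _ valV).
have [Vv Wv] := main _ _ _ _ valV valW Vy Wy (vP _ valV) (vP _ valW).
have vv : v * v^-1 = 1 by exact: divrr.
exists (u * v^-1).
  move=> Vuv; apply: Vu; have -> : u = u * v^-1 * v by ring: vv.
  exact: subringM.
apply: (val_idealM valW) => //; apply/(val_idealVn valW); first by rewrite unitrV.
by rewrite invrK.
Qed.

Lemma eventually_all (T : eqType) (P : T -> nat -> Prop) (S : seq T) :
  (forall x, x \in S -> exists k0, forall k, (k0 <= k)%N -> P x k) ->
  exists k0, forall k x, (k0 <= k)%N -> x \in S -> P x k.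
Proof.
elim: S => [|x S IH] h; first by exists 0%N.
have [k1 h1] := h x (mem_head _ _).
have [y yS|k2 h2] := IH; first by apply: h; rewrite inE yS orbT.
exists (maxn k1 k2) => k y; rewrite geq_max => /andP[kk1 kk2].
by rewrite inE => /orP[/eqP->|]; [exact: h1|exact: h2].
Qed.

Section Separation.
Variable S : seq (set Q).
Hypothesis valS : forall W, W \in S -> valring W.

(* [c = 1 - 1 / u] where the unit [u] agrees with [1 + y ^ k] for large [k].    *)
Lemma separating_element y N : y \is a GRing.unit ->
  exists c, forall W, W \in S -> (~ W y -> W ((c - 1) * ai ^+ N)) /\
                                 (val_ideal W y -> W (c * ai ^+ N)).
Proof.
move=> yU; pose P (W : set Q) k := (~ W y -> W (y^-1 ^+ k * ai ^+ N.+1)) /\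
                       (val_ideal W y -> W (y ^+ k * ai ^+ N.+1)).
have [|k0 /(_ k0)kP] := @eventually_all _ P S.
  move=> W WS; have valW := valS WS.
  have [Wy|Wy] := pselect (W y).
    have [my|nmy] := pselect (val_ideal W y); last by exists 0%N.
    by have [k0 h] := val_ideal_exp N.+1 valW my; exists k0 => k /h.
  have my : val_ideal W y^-1 by apply/(val_idealVn valW); rewrite ?unitrV // invrK.
  have [k0 h] := val_ideal_exp N.+1 valW my; exists k0 => k /h hk; split=> //.
  by move=> /(val_ideal_mem valW).
pose p := y ^+ k0; pose p' := y^-1 ^+ k0.
have pp : p * p' = 1 by apply: expr_inv1; exact: divrr.
have [u uU uP] := unitize settingA (1 + p) (unitr1 Q).
have uu : u * u^-1 = 1 by exact: divrr.
have small (W : set Q) z : valring W -> W (z * ai ^+ N.+1) -> val_ideal W z.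
  by move=> valW h; apply: val_ideal_den_mul => //; rewrite -[ai]expr1; exact: valring_exp_ai h.
exists (1 - u^-1) => W WS; have valW := valS WS; have sW := valring_subring valW.
have [h1 h2] := kP W (leqnn _) WS; split=> [Wy|my].
  have Wp' := h1 Wy; have mp' := small _ _ valW Wp'.
  have Wp : ~ W p by case: mp' => z Wz h Wp; apply: Wz;
    rewrite -[z]mul1r -pp -mulrA; exact: subringM.
  have h : infinite_at W (u - (1 + p)).
    have [[/infinite_at_mem W1p _]|//] := uP W valW; case: Wp.
    have -> : p = (1 + p) - 1 by ring.
    by apply: subringB => //; exact: subring1.
  apply: (@val_idealPn _ W (u * p')).
    apply: val_ideal_sub1 => //.
    have -> : u * p' - 1 = p' + p' * (u - (1 + p)) by ring: pp.
    by apply: val_idealD => //; apply: (infinite_at_ideal settingA valW); exact: infinite_atM.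
  have -> : u * p' * ((1 - u^-1 - 1) * ai ^+ N) = - (p' * ai ^+ N) by ring: uu.
  by apply: subringN => //; exact: valring_exp_ai Wp'.
have Wp := h2 my; have mp := small _ _ valW Wp.
have n1p : ~ val_ideal W (1 + p) by apply: val_ideal_sub1 => //; rewrite addrC addKr.
have h : infinite_at W (u - (1 + p)).
  by have [[/(infinite_at_ideal settingA valW)//]|] := uP W valW.
apply: (@val_idealPn _ W u).
  apply: val_ideal_sub1 => //; have -> : u - 1 = p + (u - (1 + p)) by ring.
  by apply: val_idealD => //; exact: (infinite_at_ideal settingA valW).
have -> : u * ((1 - u^-1) * ai ^+ N) = p * ai ^+ N + ai ^+ N * (u - (1 + p)) by ring: uu.
by apply: subringD => //; exact: valring_exp_ai Wp.
Qed.

End Separation.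

(** Induction on [S]. Given [y] for the tail and [z] separating [V] from the head [W], take
    [y ^+ k * z] if [y] lies in [W]; otherwise take [c * z] with [c] near 1 at [V] and [W] and near
    0 on the tail. *)
Lemma isolating_element V (S : seq (set Q)) : valring V ->
  (forall W, W \in S -> valring W /\ W <> V) ->
  exists y, [/\ y \is a GRing.unit, ~ V y & forall W, W \in S -> val_ideal W y].
Proof.
move=> valV; elim: S => [|W S IH] hS.
  by exists ai; split; rewrite ?unitrV //; exact: (valring_den settingA).
have [y [yU Vy Sy]] : exists y, [/\ y \is a GRing.unit, ~ V y & forall W, W \in S -> val_ideal W y].
  by apply: IH => X XS; apply: hS; rewrite inE XS orbT.
have [valW WV] := hS W (mem_head _ _).
have valS X : X \in S -> valring X by move=> XS; have [] := hS X; rewrite ?inE ?XS ?orbT.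
have [z Vz Wz] := valring_separated valV valW (nesym WV).
have [h Az] := Apow z.
have kill (X : set Q) c : valring X -> X (c * ai ^+ h.+1) -> val_ideal X (c * z).
  move=> valX Xc; have -> : c * z = c * ai ^+ h.+1 * (a ^+ h * z) * a.
    by rewrite !exprS; have := aaiX h; move: (a ^+ h) (ai ^+ h) => p q pq; ring: aai pq.
  apply: (val_idealM valX); last exact: (val_ideal_den settingA).
  by apply: subringM (valring_subring valX) _ _ _ _ => //; exact: sub_valring valX _ Az.
suff [x [Vx Wx Sx]] : exists x, [/\ ~ V x, val_ideal W x & forall X, X \in S -> val_ideal X x].
  (* Using [a] as substitute where [x] is infinite keeps [u] in the required maximal ideals. *)
  have [u uU uP] := unitize settingA x aU.
  exists u; split=> //.
    have [[/infinite_at_mem //]|ux] := uP V valV.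
    by move=> /(valring_congr valV ux).
  have main X : valring X -> val_ideal X x -> val_ideal X u.
    move=> valX mx; have [[_ ua]|ux] := uP X valX.
      have -> : u = a + (u - a) by ring.
      apply: val_idealD => //; first exact: (val_ideal_den settingA).
      exact: (infinite_at_ideal settingA).
    have -> : u = x + (u - x) by ring.
    by apply: val_idealD => //; exact: (infinite_at_ideal settingA).
  by move=> X; rewrite inE => /orP[/eqP->|XS]; apply: main => //; [exact: valS|exact: Sx].
have [Wy|Wy] := pselect (W y).
  have [k0 /(_ k0 _ (leqnn _))kP] := @eventually_all _
    (fun (X : set Q) k => X (y ^+ k * ai ^+ h.+1)) S
    (fun X XS => val_ideal_exp h.+1 (valS X XS) (Sy X XS)).
  exists (y ^+ k0 * z); split.
  - elim: k0 {kP} => [|k IHk]; first by rewrite expr0 mul1r.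
    by rewrite exprS -mulrA; exact: (valring_coprime valV).
  - by apply: (val_idealM valW) => //; exact: subringX (valring_subring valW) _ _ _.
  - by move=> X XS; apply: kill; [exact: valS|exact: kP].
have [|c cP] := @separating_element [:: V, W & S] _ y h.+1 yU.
  by move=> X; rewrite !inE => /or3P[/eqP->|/eqP->|/valS].
have [/(_ Vy)cV _] := cP V (mem_head _ _).
have [/(_ Wy)cW _] : (~ W y -> W ((c - 1) * ai ^+ h.+1)) /\
    (val_ideal W y -> W (c * ai ^+ h.+1)) by apply: cP; rewrite !inE eqxx orbT.
exists (c * z); split.
- move=> Vcz; apply: Vz; apply: val_idealPn Vcz; apply: val_ideal_sub1 => //.
  by apply: val_ideal_den_mul => //; rewrite -[ai]expr1; exact: valring_exp_ai cV.
- apply: (val_idealM valW) => //; have -> : c = (c - 1) + 1 by ring.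
  apply: subringD (valring_subring valW) _ _ _ (subring1 (valring_subring valW)).
  by rewrite -[X in W X]mulr1 -(expr0 ai); exact: valring_exp_ai cW.
- move=> X XS; apply: kill; first exact: valS.
  by have [_ ] := cP X ltac:(by rewrite !inE XS !orbT); apply; exact: Sy.
Qed.

(** The sum of the [c V * q V], with [c V] near 1 at [V] and near 0 at the other members. The extra
    precision [h] absorbs the denominators of the [q V]. *)
Lemma weak_approximation (S : seq (set Q)) (q : set Q -> Q) N : uniq S ->
  (forall W, W \in S -> valring W) ->
  exists x, forall W, W \in S -> W ((x - q W) * ai ^+ N).
Proof.
move=> uS valS.
have [h hq] := @eventually_all _ (fun V k => A (a ^+ k * q V)) S ltac:(move=> V VS;
  have [k Ak] := Apow (q V); exists k => l /subnK <-; rewrite exprD -mulrA;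
  apply: subringM => //; exact: subringX).
have {}hq V : V \in S -> A (a ^+ h * q V) by exact: hq.
have /choice[c cP] : forall V, exists c, V \in S -> forall W, W \in S ->
    W ((c - (W == V)%:R) * ai ^+ (N + h)).
  move=> V; have [VS|_] := boolP (V \in S); last by exists 0.
  have [|y [yU Vy yP]] := @isolating_element V [seq W <- S | W != V] (valS _ VS).
    by move=> W; rewrite mem_filter => /andP[/eqP WV /valS].
  have [c cP] := separating_element valS (N + h) yU.
  exists c => _ W WS; have [h1 h2] := cP W WS.
  have [->|WV] := eqVneq W V; first by apply: (cP V VS).1.
  by rewrite subr0; apply: h2; apply: yP; rewrite mem_filter WV.
exists (\sum_(V <- S) c V * q V) => W WS.
have sW := valring_subring (valS _ WS).
have -> : q W = \sum_(V <- S) (W == V)%:R * q V.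
  rewrite (bigD1_seq W) //= eqxx mul1r big1 ?addr0 // => V.
  by rewrite eq_sym => /negbTE ->; rewrite mul0r.
rewrite -sumrB mulr_suml big_seq; apply: subring_sum => // V VS.
have -> : (c V * q V - (W == V)%:R * q V) * ai ^+ N =
    (c V - (W == V)%:R) * ai ^+ (N + h) * (a ^+ h * q V).
  by rewrite exprD; have := aaiX h; move: (a ^+ h) (ai ^+ h) => p r pr; ring: pr.
by apply: subringM => //; [exact: cP|apply: sub_valring (valS _ WS) _ _; exact: hq].
Qed.

End Approximation.

(** * Discrete valuations *)

Section DiscreteValuations.
Variables (Q : comUnitRingType) (A : set Q) (a : Q).
Hypothesis settingA : dim1_setting A a.

Let subA : subring A. Proof. by case: settingA. Qed.
Let aU : a \is a GRing.unit. Proof. by case: settingA. Qed.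
Let Aa : A a. Proof. by case: settingA. Qed.
Let Apow : forall q, exists h, A (a ^+ h * q). Proof. by case: settingA. Qed.

Local Notation ai := (a^-1).
Local Notation valring := (valring A).
Let aai : a * ai = 1. Proof. exact: divrr. Qed.
Let aaiX n : a ^+ n * ai ^+ n = 1. Proof. exact: expr_inv1. Qed.

(* Given infinitely many [V i], put [B n = V 0 `&` ... `&` V n].  The ideals    *)
(* [{r | a ^ -m r \in a B n}] of [A] become stationary, whereas there is        *)
(* [x \in B n.+1] lying in [a B n] but not in [a V n.+1].                       *)
Lemma finite_valrings : finite_set [set V | valring V].
Proof.
apply: contrapT => /infiniteP/pcard_leP[f].
have valf n : valring (f n) by exact: 'funS_f.
have finj : injective f by move=> i j; apply: 'inj_f; rewrite inE.
pose B n : set Q := [set x | forall i, (i <= n)%N -> f i x].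
have subB n : subring (B n) /\ A `<=` B n.
  split; last by move=> x Ax i _; exact: sub_valring (valf i) _ Ax.
  split.
  - by move=> i _; exact: subring1 (valring_subring (valf i)).
  - move=> x y Bx By i hi; apply: subringB (valring_subring (valf i)) _ _ _ _.
      exact: Bx.
    exact: By.
  - move=> x y Bx By i hi; apply: subringM (valring_subring (valf i)) _ _ _ _.
      exact: Bx.
    exact: By.
have decB n : B n.+1 `<=` B n by move=> x Bx i hi; apply: Bx; exact: leqW.
have [m [n0 hm]] := krull_akizuki settingA subB decB.
pose I n : set Q := [set r | A r /\ B n (ai ^+ m * r * ai)].
have decI n k : (n <= k)%N -> I k `<=` I n.
  by move=> nk r [Ar Br]; split=> // i hi; apply: Br; exact: leq_trans nk.
have [||_ [[n hn <-] Imin]] := dim1_min settingA (k := m.+1)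
    (F := [set I n | n in [set n | (n0 <= n)%N]]).
- by exists (I n0), n0 => //=.
- move=> _ [n _ <-]; have [sB AB] := subB n; split; last first.
    split; first exact: subringX.
    have -> : ai ^+ m * a ^+ m.+1 * ai = 1.
      by rewrite exprS; have := aaiX m; move: (a ^+ m) (ai ^+ m) => p q pq; ring: pq aai.
    exact: (subring1 sB).
  split; first by move=> r [].
  + by split; [exact: subring0|rewrite mulr0 mul0r; exact: (subring0 sB)].
  + move=> r s [Ar Br] [As Bs]; split; first exact: subringD.
    by rewrite mulrDr mulrDl; exact: (subringD sB).
  + move=> c r Ac [Ar Br]; split; first exact: subringM.
    have -> : ai ^+ m * (c * r) * ai = c * (ai ^+ m * r * ai) by ring.
    by apply: (subringM sB) => //; exact: AB.
have IE : I n.+1 = I n.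
  by apply: Imin; [exists n.+1 => //; exact: (leqW (hn : (n0 <= n)%N))|exact: decI (leqnSn n)].
have uS : uniq [seq f i | i <- iota 0 n.+2] by rewrite map_inj_uniq ?iota_uniq.
have [|x xP] := @weak_approximation _ _ _ settingA [seq f i | i <- iota 0 n.+2]
    (fun V => (V == f n.+1)%:R) 1 uS.
  by move=> W /mapP[i _ ->].
have {}xP i : (i <= n.+1)%N -> f i ((x - (i == n.+1)%:R) * ai).
  move=> hi; have := xP (f i); rewrite inj_eq // expr1; apply.
  by apply/mapP; exists i; rewrite // mem_iota.
have xlast : ~ f n.+1 (x * ai).
  move=> h; have := xP n.+1 (leqnn _); rewrite eqxx => h'.
  apply: (valring_den settingA (valf n.+1)).
  have -> : ai = x * ai - (x - 1) * ai by ring.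
  exact: subringB (valring_subring (valf n.+1)) _ _ h h'.
have xai i : (i <= n)%N -> f i (x * ai).
  move=> hi; have := xP i (leqW hi); rewrite (ltn_eqF (n := n.+1)) ?ltnS //.
  by rewrite subr0.
have fa i : f i a by exact: sub_valring (valf i) _ Aa.
have Bx : B n.+1 x.
  move=> i; rewrite leq_eqVlt => /orP[/eqP->|hi].
    have -> : x = (x - 1) * ai * a + 1 by ring: aai.
    apply: subringD (valring_subring (valf n.+1)) _ _ _ (subring1 (valring_subring (valf n.+1))).
    apply: subringM (valring_subring (valf n.+1)) _ _ _ (fa _).
    by have := xP n.+1 (leqnn _); rewrite eqxx.
  have -> : x = x * ai * a by ring: aai.
  by apply: subringM (valring_subring (valf i)) _ _ _ (fa _); exact: xai.
have [r [b [Ar Bb xE]]] := hm n.+1 x (leqW (hn : (n0 <= n)%N)) Bx.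
have rE : ai ^+ m * r = x - a * b by rewrite [in RHS]xE; ring.
have : I n r.
  split=> // i hi; rewrite rE; have -> : (x - a * b) * ai = x * ai - b by ring: aai.
  apply: subringB (valring_subring (valf i)) _ _ _ _; first exact: xai.
  by apply: Bb; exact: leqW.
rewrite -IE => -[_ /(_ _ (leqnn _))]; rewrite rE => h.
apply: xlast; have -> : x * ai = (x - a * b) * ai + b by ring: aai.
by apply: subringD (valring_subring (valf _)) _ _ h _; exact: Bb.
Qed.

Lemma valrings_enum : exists S : seq (set Q), uniq S /\ forall V, V \in S <-> valring V.
Proof.
have /finite_seqP[S SE] := finite_valrings.
exists (undup S); split; first exact: undup_uniq.
by move=> V; rewrite mem_undup; have := f_equal (fun X => X V) SE => /= ->.
Qed.

(* For [x = e * w], a valuation ring containing [(1 - e) A + e Q] but not       *)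
(* [(1 - e) / a] is infinite at [e].                                            *)
Lemma finite_everywhere_unit x :
  (forall V, valring V -> ~ infinite_at V x) -> x \is a GRing.unit.
Proof.
move=> xfin; have [e [w [ee wU xE]]] := dim1_idem settingA x.
suff e1 : 1 - e = 0 by rewrite xE -[e](subKr 1) e1 subr0 mul1r.
apply: contrapT => f0.
pose C0 : set Q := [set q | exists2 r, A r & exists s, q = (1 - e) * r + e * s].
have bU : ((1 - e) * a + e) * ((1 - e) * ai + e) = 1.
  have -> : ((1 - e) * a + e) * ((1 - e) * ai + e) =
    (1 - (e + e) + e * e) * (a * ai) + (e - e * e) * (a + ai) + e * e by ring.
  by rewrite aai ee; ring.
have bu : (1 - e) * a + e \is a GRing.unit by apply/unitrPr; eexists; exact: bU.
have bV : ((1 - e) * a + e)^-1 = (1 - e) * ai + e.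
  by apply: (mulrI bu); rewrite divrr // bU.
have [|||//||V [valV C0V]] := @valring_avoiding _ A C0 ((1 - e) * a + e).
- split.
  + by exists 1; [exact: subring1|exists 1; ring].
  + move=> _ _ [r Ar [s ->]] [r' Ar' [s' ->]]; exists (r - r'); first exact: subringB.
    by exists (s - s'); ring.
  + move=> _ _ [r Ar [s ->]] [r' Ar' [s' ->]]; exists (r * r'); first exact: subringM.
    exists (s * s').
    have -> : ((1 - e) * r + e * s) * ((1 - e) * r' + e * s') =
      (1 - (e + e) + e * e) * (r * r') + (e - e * e) * (r * s' + s * r') + e * e * (s * s').
      by ring.
    by rewrite ee; ring.
- by move=> r Ar; exists r => //; exists r; ring.
- by exists a => //; exists 1; ring.
- rewrite bV => -[r Ar [s rs]]; apply: f0; apply: (dim1_local settingA Ar).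
  have : a * ((1 - e) * ((1 - e) * ai + e - ((1 - e) * r + e * s))) = 0.
    by rewrite rs subrr !mulr0.
  have -> : a * ((1 - e) * ((1 - e) * ai + e - ((1 - e) * r + e * s))) =
    (1 - (e + e) + e * e) * (a * ai - a * r) + (e - e * e) * (a - a * s) by ring.
  by rewrite aai ee => <-; ring.
rewrite bV => nV; have sV := valring_subring valV.
have [/(infinite_atM w)|h] := infinite_at_idem valV ee.
  by rewrite mulrC -xE => /xfin; exact.
apply: nV; apply: (subringD sV); first by rewrite mulrC.
apply: C0V; exists 0; first exact: subring0.
by exists 1; ring.
Qed.

Lemma not_integral_valring u : u \is a GRing.unit -> ~ poly_image A u^-1 u ->
  exists2 V, valring V & ~ V u.
Proof.
move=> uU nu; have [|||||V [valV _]] := @valring_avoiding _ A (poly_image A u^-1) u^-1.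
- exact: subring_poly_image.
- exact: sub_poly_image.
- exact: mem_poly_image.
- by rewrite unitrV.
- by rewrite invrK.
- by rewrite invrK => Vu; exists V.
Qed.

Definition unif (V : set Q) : Q := xget 1 [set t | uniformizer a V t].

Lemma unifP V : valring V -> uniformizer a V (unif V).
Proof. by move=> valV; exact: (xgetPex 1 (uniformizerP settingA valV)). Qed.

(** The condition that the valuation of [x] is at least [k]; [val_eq] says that it is exactly [k].
    Elements of infinite value satisfy the first for every [k], so no extended integers occur. *)
Definition val_ge (V : set Q) (k : int) x := V (x * unif V ^ (- k)).
Definition val_eq V k x := val_ge V k x /\ ~ val_ge V (k + 1) x.

Section OneValuation.
Variable V : set Q.
Hypothesis valV : valring V.
Let sV := valring_subring valV.
Let t := unif V.
Let tU : t \is a GRing.unit. Proof. by case: (unifP valV). Qed.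
Let tD m n : t ^ (m + n) = t ^ m * t ^ n. Proof. exact: exprzDr. Qed.
Let tX (n : nat) : t ^ n = t ^+ n. Proof. by []. Qed.

Lemma val_ge0 x : val_ge V 0 x <-> V x.
Proof. by rewrite /val_ge oppr0 expr0z mulr1. Qed.

Lemma val_geD k x y : val_ge V k x -> val_ge V k y -> val_ge V k (x + y).
Proof. by rewrite /val_ge mulrDl; exact: subringD. Qed.

Lemma val_geN k x : val_ge V k x -> val_ge V k (- x).
Proof. by rewrite /val_ge mulNr; exact: subringN. Qed.

Lemma val_geM k l x y : val_ge V k x -> val_ge V l y -> val_ge V (k + l) (x * y).
Proof.
rewrite /val_ge opprD tD => hx hy.
by rewrite mulrACA; exact: subringM.
Qed.

Lemma val_ge_trans k l x : l <= k -> val_ge V k x -> val_ge V l x.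
Proof.
move=> lk; rewrite /val_ge => hx; have [n kE] : exists n : nat, k - l = n%:Z.
  by exists `|k - l|%N; rewrite gez0_abs // subr_ge0.
have -> : - l = - k + n%:Z by rewrite -kE; ring.
rewrite tD mulrA; apply: subringM => //; rewrite tX; apply: subringX => //.
by case: (unifP valV).
Qed.

Lemma infinite_at_val_ge k x : infinite_at V x -> val_ge V k x.
Proof. by move=> h; rewrite /val_ge mulrC. Qed.

Lemma val_ge1 x : val_ge V 1 x <-> val_ideal V x.
Proof.
have [_ _ nt tP _] := unifP valV; split=> [h|]; last exact: tP.
by exists t^-1.
Qed.

Lemma not_val_geM k l x y : ~ val_ge V (k + 1) x -> ~ val_ge V (l + 1) y ->
  ~ val_ge V (k + l + 1) (x * y).
Proof.
have e z j : val_ge V (j + 1) z <-> val_ideal V (z * t ^ (- j)).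
  by rewrite -val_ge1 /val_ge opprD tD mulrA.
move=> /e hx /e hy /e; rewrite opprD tD mulrACA.
exact: not_val_idealM.
Qed.

Lemma val_eqM k l x y : val_eq V k x -> val_eq V l y -> val_eq V (k + l) (x * y).
Proof. by move=> [? ?] [? ?]; split; [exact: val_geM|exact: not_val_geM]. Qed.

Lemma val_eq_inj k l x : val_eq V k x -> val_eq V l x -> k = l.
Proof.
suff h m n : val_eq V m x -> val_eq V n x -> m <= n.
  by move=> hk hl; apply/eqP; rewrite eq_le !h.
move=> [hm _] [_ hn]; rewrite leNgt; apply/negP => nm; apply: hn.
by apply: val_ge_trans hm; rewrite -ltzD1 ltrD2r.
Qed.

Lemma val_eq_ge k l x : val_eq V k x -> val_ge V l x <-> l <= k.
Proof.
move=> [hk nk]; split; last by move=> lk; exact: val_ge_trans hk.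
by move=> hl; rewrite leNgt; apply/negP => kl; apply: nk; apply: val_ge_trans hl; rewrite -ltzD1 ltrD2r.
Qed.

Lemma val_eqDl k x y : val_eq V k x -> val_ge V (k + 1) y -> val_eq V k (x + y).
Proof.
move=> [hx nx] hy; split.
  by apply: val_geD => //; apply: val_ge_trans hy; rewrite lerDl.
move=> h; apply: nx; have -> : x = x + y - y by ring.
by apply: val_geD => //; exact: val_geN.
Qed.

Lemma val_eq_infinite k x : val_eq V k x -> ~ infinite_at V x.
Proof. by move=> [_ nx] h; apply: nx; exact: infinite_at_val_ge. Qed.

Lemma val_eq_unif k : val_eq V k (t ^ k).
Proof.
rewrite /val_eq /val_ge -!tD subrr expr0z; split; first exact: subring1.
have -> : k - (k + 1) = -1 by ring.
by case: (unifP valV).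
Qed.

Lemma val_ge_den N x : V (x * ai ^+ N) -> val_ge V N x.
Proof.
move=> h; rewrite /val_ge.
have -> : x * t ^ (- N%:Z) = x * ai ^+ N * (a * t^-1) ^+ N.
  rewrite exprMn -exprnN -exprVn; have := aaiX N.
  by move: (a ^+ _) (ai ^+ _) => p q pq; ring: pq.
apply: subringM => //; apply: subringX => //.
have [_ _ _ tP _] := unifP valV; apply: tP; exact: (val_ideal_den settingA).
Qed.

Lemma val_lower_bound x : exists N : nat, val_ge V (- N%:Z) x.
Proof.
have [_ Vt Vt' _ [n nVt]] := unifP valV.
have Vtn : V (t ^+ n * ai).
  have [] // := @valring_dvd _ A V valV (a * t^-1 ^+ n) (t ^+ n * ai).
  have := expr_inv1 n (divrr tU).
  by move: (t ^+ n) (t^-1 ^+ n) => p q pq; ring: pq aai.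
have [h Ax] := Apow x; exists (n * h)%N; rewrite /val_ge opprK tX.
have -> : x * t ^+ (n * h) = (t ^+ n * ai) ^+ h * (a ^+ h * x).
  rewrite exprMn -exprM; have := aaiX h.
  by move: (a ^+ _) (ai ^+ _) => p q pq; ring: pq.
by apply: subringM => //; [exact: subringX|exact: sub_valring valV _ Ax].
Qed.

(** The value is bounded below because a power of [a] clears denominators, and above because some
    [q * x] lies outside [V]; between the bounds [val_ge] fails for the first time. *)
Lemma val_eq_exists x : ~ infinite_at V x -> exists k, val_eq V k x.
Proof.
move=> /existsNP[q nq]; have [N hN] := val_lower_bound x.
have [M hM] := val_lower_bound q.
have nM : ~ val_ge V M%:Z x.
  by move=> /(val_geM hM); rewrite addNr => /val_ge0.
have [n hn nn] : exists2 n : nat, val_ge V (n%:Z - N%:Z) x & ~ val_ge V (n.+1%:Z - N%:Z) x.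
  apply: contrapT => h; apply: nM.
  have main n : val_ge V (n%:Z - N%:Z) x.
    elim: n => [|n IH]; first by rewrite sub0r.
    by apply: contrapT => nn; apply: h; exists n.
  by have := main (M + N)%N; rewrite PoszD addrK.
exists (n%:Z - N%:Z); split=> //.
by have -> : n%:Z - N%:Z + 1 = n.+1%:Z - N%:Z by rewrite -addn1 PoszD; ring.
Qed.

End OneValuation.

(** Approximate the required power of each uniformizer beyond its own value; the result is finite
    everywhere, hence a unit. *)
Lemma unit_with_values (alpha : set Q -> int) :
  exists2 x, x \is a GRing.unit & forall V, valring V -> val_eq V (alpha V) x.
Proof.
have [S [uS SP]] := valrings_enum.
have [N hN] : exists N : nat, forall V, V \in S -> alpha V + 1 <= N%:Z.
  elim: (S) => [|V T [N hN]]; first by exists 0%N.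
  exists (absz (alpha V + 1)%R + N)%N => W; rewrite inE PoszD abszE => /orP[/eqP->|/hN h].
    by apply: le_trans (ler_norm _) _; rewrite lerDl.
  by apply: le_trans h _; rewrite lerDr.
have [|x xP] := @weak_approximation _ _ _ settingA (S) (fun V => unif V ^ alpha V) N
    (uS); first by move=> W /SP.
have xE V : valring V -> val_eq V (alpha V) x.
  move=> valV; have VS := (SP V).2 valV.
  have -> : x = unif V ^ alpha V + (x - unif V ^ alpha V) by ring.
  apply: val_eqDl => //; first exact: val_eq_unif.
  by apply: val_ge_trans (hN _ VS) _ => //; apply: val_ge_den => //; exact: xP.
exists x => //; apply: finite_everywhere_unit => V valV.
by apply: val_eq_infinite => //; exact: xE.
Qed.

End DiscreteValuations.

(** * Completions and conductors *)

(** The features of the completion used for the conductor, in terms of the [alpha]-adic topology.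
    [adic_dense] and [adic_dvd] identify the quotients of [R] and [C] by [alpha ^+ k]. *)
Record adic_completion (R : comNzRingType) (C : comPzRingType)
    (iota : {rmorphism R -> C}) (alpha : R) : Prop := {
  adic_dense : forall x k, exists r y, x = iota r + iota alpha ^+ k * y;
  adic_regular : forall x, iota alpha * x = 0 -> x = 0;
  adic_separated : forall x, (forall k, exists y, x = iota alpha ^+ k * y) -> x = 0;
  adic_series : forall c : nat -> R, exists S, forall k, exists y,
    S = iota (\sum_(i < k) alpha ^+ i * c i) + iota alpha ^+ k * y;
  adic_dvd : forall r k y, iota r = iota alpha ^+ k * y -> exists s, r = alpha ^+ k * s
}.

Section AdicCompletion.
Variables (R : comNzRingType) (C : comPzRingType).
Variables (iota : {rmorphism R -> C}) (alpha : R).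
Hypothesis comp : adic_completion iota alpha.
Local Notation b := (iota alpha).

Lemma adic_regularX k x : b ^+ k * x = 0 -> x = 0.
Proof.
elim: k x => [|k IH] x; first by rewrite expr0 mul1r.
by rewrite exprSr -mulrA => /IH; exact: (adic_regular comp).
Qed.

Hypotheses (noethR : noetherian R) (dimR : krull_dim R 1) (rega : regular alpha).

(* The ideals [L n = (z ^ n C : b ^ oo)] have a decreasing sequence of images   *)
(* in [C / b C = R / alpha R]; once it is stationary,                           *)
(* [L n <= L n.+1 + b L n], hence [L n = L n.+1] by completeness.               *)
Lemma adic_pi_regular z : exists n h w, b ^+ h * z ^+ n = z ^+ n.+1 * w.
Proof.
pose L n x := exists h y, b ^+ h * x = z ^+ n * y.
have L0 n : L n 0 by exists 0%N, 0; rewrite !mulr0.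
have LD n x y : L n x -> L n y -> L n (x + y).
  move=> [h [u hu]] [k [v hv]]; exists (h + k)%N, (b ^+ k * u + b ^+ h * v).
  have -> : b ^+ (h + k) * (x + y) = b ^+ k * (b ^+ h * x) + b ^+ h * (b ^+ k * y).
    by rewrite exprD; ring.
  by rewrite hu hv; ring.
have LM n x y : L n x -> L n (y * x).
  by move=> [h [u hu]]; exists h, (y * u); rewrite mulrCA hu; ring.
have Lsum n p (F : 'I_p -> C) : (forall i, L n (F i)) -> L n (\sum_i F i).
  by move=> hF; apply: (big_ind (L n)) => // x y; exact: LD.
have Lb n x : L n (b * x) -> L n x.
  by move=> [h [u hu]]; exists h.+1, u; rewrite exprSr -mulrA.
have LS n x : L n.+1 x -> L n x.
  by move=> [h [u hu]]; exists h, (z * u); rewrite hu exprSr -mulrA.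
pose I n : set R := [set r | exists x y, L n x /\ iota r = x + b * y].
have hI n : ideal setT (I n).
  split=> //.
  - by exists 0, 0; rewrite mulr0 addr0 rmorph0.
  - move=> r s [x [y [Lx rE]]] [x' [y' [Lx' sE]]]; exists (x + x'), (y + y').
    by split; [exact: LD|rewrite rmorphD rE sE; ring].
  - move=> c r _ [x [y [Lx rE]]]; exists (iota c * x), (iota c * y).
    by split; [exact: LM|rewrite rmorphM rE; ring].
have [||_ [[n _ <-] Imin]] := @regular_min _ noethR dimR alpha (range I) rega.
- by exists (I 0%N), 0%N.
- move=> _ [n _ <-]; split=> //; exists 0, 1; split=> //.
  by rewrite add0r mulr1.
have IE : I n.+1 = I n.
  by apply: Imin; [exists n.+1|move=> r [x [y [Lx rE]]]; exists x, y; split=> //; exact: LS].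
have [s Is] := noethR (hI n.+1).
have /choice[l lP] : forall r, exists x, I n.+1 r -> L n.+1 x /\ exists y, iota r = x + b * y.
  move=> r; have [[x [y [Lx rE]]]|] := pselect (I n.+1 r); last by exists 0.
  by exists x => _; split=> //; exists y.
have sI (i : 'I_(size s)) : I n.+1 s`_i.
  by rewrite Is; apply: mem_gen_ideal; exact: mem_nth.
have /choice[g gP] : forall x, exists p : ('I_(size s) -> R) * C, L n x ->
    L n p.2 /\ x = \sum_i iota (p.1 i) * l s`_i + b * p.2.
  move=> x; have [Lx|nLx] := pselect (L n x); last by exists (fun=> 0, 0).
  have [r [y xE]] := adic_dense comp x 1.
  have : I n.+1 r by rewrite IE; exists x, (- y); split=> //; rewrite xE expr1; ring.
  rewrite Is => -[c rE].
  have /choice[v vP] : forall i : 'I_(size s), exists v, iota s`_i = l s`_i + b * v.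
    by move=> i; have [_] := lP _ (sI i).
  exists (c, \sum_i iota (c i) * v i + y) => _ /=.
  have E : x = \sum_i iota (c i) * l s`_i + b * (\sum_i iota (c i) * v i + y).
    rewrite xE rE expr1 rmorph_sum /= mulrDr addrA; congr (_ + _).
    rewrite mulr_sumr -big_split /=; apply: eq_bigr => i _.
    by rewrite rmorphM vP; ring.
  split=> //; apply: Lb.
  have -> : b * (\sum_i iota (c i) * v i + y) = x + (-1) * \sum_i iota (c i) * l s`_i.
    by rewrite [in RHS]E; ring.
  apply: (LD) => //; apply: (LM); apply: Lsum => i.
  by apply: (LM); apply: LS; have [] := lP _ (sI i).
(* Iterating the decomposition expands [z ^+ n] in the finitely many [l s_i], with convergent power
   series in [alpha] as coefficients. *)
pose x k := iter k (fun y => (g y).2) (z ^+ n).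
have Lx k : L n (x k).
  elim: k => [|k IH]; last by have [] := gP _ IH.
  by exists 0%N, 1; rewrite expr0 mul1r mulr1.
pose c i k := (g (x k)).1 i.
have /choice[S SP] : forall i, exists S, forall k, exists y,
    S = iota (\sum_(j < k) alpha ^+ j * c i j) + b ^+ k * y.
  by move=> i; exact: adic_series comp (c i).
have xE k : z ^+ n = \sum_i iota (\sum_(j < k) alpha ^+ j * c i j) * l s`_i + b ^+ k * x k.
  elim: k => [|k IH].
    rewrite big1 ?add0r ?expr0 ?mul1r // => i _.
    by rewrite big_ord0 rmorph0 mul0r.
  rewrite IH; have [_ ->] := gP _ (Lx k); rewrite -/(x k.+1) mulrDr addrA mulrA -exprSr.
  congr (_ + _); rewrite mulr_sumr -big_split /=; apply: eq_bigr => i _.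
  by rewrite big_ord_recr /= rmorphD rmorphM rmorphXn /= mulrDl -mulrA.
have zE : z ^+ n = \sum_i S i * l s`_i.
  apply/eqP; rewrite -subr_eq0; apply/eqP; apply: (adic_separated comp) => k.
  have /choice[y yP] := SP ^~ k.
  exists (x k - \sum_i y i * l s`_i); rewrite (xE k) mulrBr addrAC mulr_sumr.
  rewrite [RHS]addrC; congr (_ + _); rewrite -sumrB -sumrN; apply: eq_bigr => i _.
  by rewrite (yP i); ring.
have [h [w hw]] : L n.+1 (z ^+ n).
  rewrite zE; apply: Lsum => i.
  by apply: (LM); have [] := lP _ (sI i).
by exists n, h, w.
Qed.

(** * Nilpotent elements of the completion and the conductor *)

Section Conductor.
Variables (Q : comUnitRingType) (f : {rmorphism R -> Q}).
Hypothesis injf : injective f.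
Hypothesis settingA : dim1_setting (range f) (f alpha).
Local Notation a := (f alpha).
Local Notation ai := (a^-1).
Local Notation valring := (valring (range f)).

Let aU : a \is a GRing.unit. Proof. by case: settingA. Qed.
Let aai : a * ai = 1. Proof. exact: divrr. Qed.
Let aaiX n : a ^+ n * ai ^+ n = 1. Proof. exact: expr_inv1. Qed.

(* If [z] is not nilpotent, the subring of the [q] in [Q] whose image in        *)
(* [C[1 / (b z)]] comes from [C] does not contain [1 / a], hence lies in a      *)
(* valuation ring [V].  But [y = b ^ h - z w] vanishes in [C[1 / (b z)]]        *)
(* although an approximation of [y] in [R] has the same value at [V] as         *)
(* [a ^ h].                                                                     *)
Lemma adic_nilpotent z :
  (forall M, exists r y, z = iota r + b ^+ M * y /\
     forall V, valring V -> V (f r * ai ^+ M)) ->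
  exists n, z ^+ n = 0.
Proof.
move=> zsmall; apply: contrapT => nz.
have [n [h [w zw]]] := adic_pi_regular z.
pose C0 : set Q := [set q | exists k r c N, a ^+ k * q = f r /\
  z ^+ N * (iota r - b ^+ k * c) = 0].
have AC0 : range f `<=` C0.
  move=> _ [r _ <-]; exists 0%N, r, (iota r), 0%N; rewrite !expr0 !mul1r.
  by rewrite subrr.
have subC0 : subring C0.
  split; first by apply: AC0; exists 1; rewrite ?rmorph1.
  - move=> p q [k [r [c [N [pE hr]]]]] [l [s [d [M [qE hs]]]]].
    exists (k + l)%N, (alpha ^+ l * r - alpha ^+ k * s), (c - d), (N + M)%N; split.
      by rewrite rmorphB !rmorphM !rmorphXn /= -pE -qE exprD; ring.
    rewrite rmorphB !rmorphM !rmorphXn /=.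
    have -> : z ^+ (N + M) * (b ^+ l * iota r - b ^+ k * iota s - b ^+ (k + l) * (c - d)) =
      z ^+ M * b ^+ l * (z ^+ N * (iota r - b ^+ k * c)) -
      z ^+ N * b ^+ k * (z ^+ M * (iota s - b ^+ l * d)) by rewrite !exprD; ring.
    by rewrite hr hs !mulr0 subr0.
  - move=> p q [k [r [c [N [pE hr]]]]] [l [s [d [M [qE hs]]]]].
    exists (k + l)%N, (r * s), (c * d), (N + M)%N; split.
      by rewrite rmorphM /= -pE -qE exprD; ring.
    have -> : z ^+ (N + M) * (iota (r * s) - b ^+ (k + l) * (c * d)) =
      z ^+ M * iota s * (z ^+ N * (iota r - b ^+ k * c)) +
      z ^+ N * b ^+ k * c * (z ^+ M * (iota s - b ^+ l * d)).
      by rewrite rmorphM !exprD; ring.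
    by rewrite hr hs !mulr0 addr0.
have C0ai : ~ C0 ai.
  move=> [k [r [c [N [rE hr]]]]]; apply: nz; exists N.
  have ra : alpha * r = alpha ^+ k.
    by apply: injf; rewrite rmorphM rmorphXn /= -rE; ring: aai.
  have bk : b ^+ k = b * iota r by rewrite -rmorphXn -ra rmorphM.
  (* Thus [z ^+ N] is divisible by every power of [b], so it vanishes. *)
  have z1 : z ^+ N = b * (c * z ^+ N).
    apply/eqP; rewrite -subr_eq0; apply/eqP; apply: (@adic_regularX k).
    have -> : b ^+ k * (z ^+ N - b * (c * z ^+ N)) = b * (z ^+ N * (iota r - b ^+ k * c)).
      by rewrite mulrBr {1}bk; ring.
    by rewrite hr mulr0.
  apply: (adic_separated comp) => K; exists (c ^+ K * z ^+ N).
  elim: K => [|K IH]; first by rewrite !expr0 !mul1r.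
  by rewrite {1}IH {1}z1 !exprS; ring.
have [|V [valV C0V _]] := valring_avoiding subC0 AC0 _ aU C0ai.
  by apply: AC0; exists alpha.
have sV := valring_subring valV.
have [r [y1 [zE /(_ V valV)Vr]]] := zsmall h.+1.
have [s [y2 wE]] := adic_dense comp w h.+1.
(* The numerator approximates [b ^+ h - z * w], which is killed by [z ^+ n]; so the quotient lies in
   [C0]. *)
have Vq : V ((a ^+ h - f r * f s) * ai ^+ h.+1).
  apply: C0V; exists h.+1, (alpha ^+ h - r * s),
    (y1 * w + iota r * y2), n; split.
    by rewrite rmorphB rmorphM rmorphXn /=; ring: (aaiX h.+1).
  rewrite rmorphB rmorphM rmorphXn /=.
  have -> : b ^+ h - iota r * iota s - b ^+ h.+1 * (y1 * w + iota r * y2) = b ^+ h - z * w.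
    by rewrite zE [in RHS]wE [in LHS]wE; ring.
  rewrite mulrBr [z ^+ n * b ^+ h]mulrC zw; rewrite exprSr; ring.
apply: (valring_den settingA valV).
have -> : ai = (a ^+ h - f r * f s) * ai ^+ h.+1 + f s * (f r * ai ^+ h.+1).
  rewrite exprS; have := aaiX h; move: (a ^+ h) (ai ^+ h) => p q pq; ring: pq.
apply: subringD => //; apply: subringM => //; apply: (sub_valring valV).
by exists s.
Qed.

(* For [x] integral at all valuations, the Krull-Akizuki relation yields        *)
(* [a ^ m x = r_0 + a r_1 + ... + a ^ (k - 1) r_(k - 1) + a ^ (k + m) x_k];     *)
(* by the previous lemma the series converges to [a ^ m x].                     *)
Lemma conductor : reduced C ->
  exists m, forall x, (forall V, valring V -> V x) -> range f (a ^+ m * x).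
Proof.
move=> redC; pose B : set Q := [set x | forall V, valring V -> V x].
have sB : subring B.
  split.
  - by move=> V valV; exact: subring1 (valring_subring valV).
  - move=> x y Bx By V valV.
    by apply: subringB (valring_subring valV) _ _ _ _; [exact: Bx|exact: By].
  - move=> x y Bx By V valV.
    by apply: subringM (valring_subring valV) _ _ _ _; [exact: Bx|exact: By].
have AB : range f `<=` B by move=> x Ax V valV; exact: sub_valring valV _ Ax.
have [m [n0 hm]] := krull_akizuki settingA (B := fun=> B) (fun=> conj sB AB)
  (fun=> @subset_refl _ B).
exists m => x Bx.
have /choice[g gP] : forall y, exists p : R * Q, B y ->
    B p.2 /\ y = ai ^+ m * f p.1 + a * p.2.
  move=> y; have [By|nBy] := pselect (B y); last by exists (0, 0).
  have [_ [c [[r _ <-] Bc yE]]] := hm n0 y (leqnn _) By.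
  by exists (r, c).
pose X k := iter k (fun y => (g y).2) x.
pose c k := (g (X k)).1.
have BX k : B (X k) by elim: k => //= k IH; have [] := gP _ IH.
have xE k : a ^+ m * x = f (\sum_(i < k) alpha ^+ i * c i) + a ^+ (k + m) * X k.
  elim: k => [|k IH]; first by rewrite big_ord0 rmorph0 add0r.
  rewrite IH big_ord_recr /= rmorphD rmorphM rmorphXn /= -addrA; congr (_ + _).
  have [_ XE] := gP _ (BX k); rewrite {1}XE addSn exprS exprD.
  by rewrite mulrDr; have := aaiX m; move: (a ^+ m) (ai ^+ m) => p q pq; ring: pq.
have [S SP] := adic_series comp c.
have [h [t _ tE]] := dim1_denominator settingA x.
(* [S] is the limit of the expansion of [a ^+ m * x], and [a ^+ h] clears the denominator of [x];
   the difference is approximated by elements of [R] of arbitrarily large value. *)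
have : exists n, (b ^+ h * S - iota (alpha ^+ m * t)) ^+ n = 0.
  apply: adic_nilpotent => M; have [y yE] := SP M.
  exists (alpha ^+ h * (\sum_(i < M) alpha ^+ i * c i) - alpha ^+ m * t), (b ^+ h * y).
  split; first by rewrite yE rmorphB !rmorphM !rmorphXn /=; ring.
  move=> V valV.
  have -> : f (alpha ^+ h * (\sum_(i < M) alpha ^+ i * c i) - alpha ^+ m * t) * ai ^+ M =
      - (a ^+ (h + m) * X M).
    rewrite rmorphB !rmorphM !rmorphXn /= tE.
    have -> : a ^+ m * (a ^+ h * x) = a ^+ h * (a ^+ m * x) by ring.
    rewrite (xE M) mulrDr opprD addrA subrr add0r !exprD.
    by have := aaiX M; move: (a ^+ M) (ai ^+ M) => p q pq; ring: pq.
  have sV := valring_subring valV.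
  apply: subringN => //; apply: subringM => //; last exact: BX.
  by apply: subringX => //; apply: (sub_valring valV); exists alpha.
move=> [n /redC /eqP]; rewrite subr_eq0 => /eqP bS.
have [y yE] := SP (m)%N.
have : iota (alpha ^+ m * t - alpha ^+ h * (\sum_(i < m) alpha ^+ i * c i)) =
    b ^+ (h + m) * y.
  by rewrite rmorphB -bS yE rmorphM rmorphXn /= exprD; ring.
move=> /(adic_dvd comp)[s sE].
exists ((\sum_(i < m) alpha ^+ i * c i) + alpha ^+ m * s) => //.
have : a ^+ h * (a ^+ m * x - f (\sum_(i < m) alpha ^+ i * c i) - a ^+ m * f s) = 0.
  have -> : a ^+ h * (a ^+ m * x - f (\sum_(i < m) alpha ^+ i * c i) - a ^+ m * f s) =
    a ^+ m * (a ^+ h * x) - a ^+ h * f (\sum_(i < m) alpha ^+ i * c i) -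
    a ^+ (h + m) * f s by rewrite exprD; ring.
  by rewrite -tE -!rmorphXn -!rmorphM -rmorphB sE rmorphM subrr.
rewrite -[RHS](mulr0 (a ^+ h)) => /(mulrI (unitrX h aU))/eqP.
by rewrite -addrA -opprD subr_eq0 => /eqP ->; rewrite rmorphD rmorphM rmorphXn.
Qed.

End Conductor.
End AdicCompletion.

(** * The total ring of fractions *)

Section Localizations.
Variables (R : comNzRingType) (S : multset R).
Local Notation tol := (@Loc.tol R S).

Lemma tol_eq0 r : tol r = 0 <-> exists2 u, S u & u * r = 0.
Proof.
split=> [/eqmodP/asboolP[u Su] /=|[u Su ur]].
  by rewrite !mulr1 subr0 => ?; exists u.
by apply: Loc.eq_pi; apply/asboolP; exists u; rewrite //= !mulr1 subr0.
Qed.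

Lemma tol_frac x : exists r s, S s /\ tol s * x = tol r.
Proof.
elim/quotW: x => x; exists x.1, (sval x.2); split; first exact: Loc.denP.
rewrite -[LHS]/(Loc.mul _ _) Loc.pi_mul; apply: Loc.eq_pi1 => /=; ring.
Qed.

Lemma tol_inv s : S s -> exists y, tol s * y = 1.
Proof.
move=> Ss; exists (\pi_(Loc.type S) (Loc.frac 1 Ss : Loc.dom S)).
by rewrite -[LHS]/(Loc.mul _ _) Loc.pi_mul; apply: Loc.eq_pi1 => /=; ring.
Qed.

End Localizations.

Section TotalFractions.
Variable R : comNzRingType.
Implicit Types (r c : R).
Local Notation Q := (total_frac R).
Local Notation tf := (@to_frac R).

Lemma to_frac_inj : injective tf.
Proof.
move=> x y /eqP; rewrite -subr_eq0 -rmorphB => /eqP/tol_eq0[u ru ur].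
by apply/eqP; rewrite -subr_eq0; apply/eqP; apply: ru; rewrite mulr0.
Qed.

Lemma to_frac_fraction x : exists r c, regular c /\ tf c * x = tf r.
Proof. exact (@tol_frac R (regular_multset R) x). Qed.

Lemma to_frac_inv c : regular c -> exists y, tf c * y = 1.
Proof. exact: (@tol_inv R (regular_multset R)). Qed.

(** Chosen inverses turn the ring of fractions into a [comUnitRingType] with the same ring
    operations. *)
Definition frac_is_unit : pred Q := fun x => `[< exists y, y * x = 1 >].
Definition frac_inv (x : Q) : Q := xget x [set y | y * x = 1].

Lemma frac_mulVr : {in frac_is_unit, left_inverse 1 frac_inv *%R}.
Proof. by move=> x /asboolP; exact: (xgetPex x). Qed.

Lemma frac_unitP x y : y * x = 1 -> frac_is_unit x.
Proof. by move=> yx; apply/asboolP; exists y. Qed.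

Lemma frac_inv_out : {in [predC frac_is_unit], frac_inv =1 id}.
Proof.
move=> x /negP nx; rewrite /frac_inv; case: xgetP => // y _ yx.
by case: nx; exact: frac_unitP yx.
Qed.

Definition total_frac_unit : comUnitRingType :=
  HB.pack_for comUnitRingType (GRing.ComNzRing.sort Q)
    (GRing.ComNzRing_hasMulInverse.Build (GRing.ComNzRing.sort Q)
      frac_mulVr frac_unitP frac_inv_out).

Definition to_frac_unit : {rmorphism R -> total_frac_unit} := tf.

End TotalFractions.

Section Dimension1.
Variable R : comNzRingType.
Hypotheses (hCM : cohen_macaulay_dim1 R) (redR : reduced R).
Implicit Types (r c : R).
Local Notation J := (jacobson [set: R]).
Local Notation Q := (total_frac_unit R).
Local Notation tf := (@to_frac_unit R).

Let noethR : noetherian R. Proof. by case: hCM. Qed.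
Let dimR : krull_dim R 1. Proof. by case: hCM. Qed.

(* A maximal ideal [m] without regular elements has an annihilator not          *)
(* contained in [m], so that the maximal ideal of the localization at [m] is 0. *)
Lemma maximal_ideal_regular (m : set R) : maximal_ideal setT m ->
  exists2 c, m c & regular c.
Proof.
move=> hm; have [hI mT mmax] := hm.
have [||x mx xP] := @reduced_generic _ noethR redR m.
- by exists 0; exact: ideal0.
- by move=> x y; exact: idealD.
exists x => // u v /eqP; rewrite -subr_eq0 -mulrBr => /eqP xb.
apply/eqP; rewrite -subr_eq0; apply/eqP; set b := u - v in xb *.
apply: contrapT => b0.
have mb : ~ m b by move=> mb; apply: b0; exact: xP.
have bm y : m y -> b * y = 0.
  move=> my; apply: xP; first exact: idealM.
  by rewrite mulrA xb mul0r.
have [_ _ /(_ m hm)[[s [[sT sreg] _ s1]] _]] := hCM.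
(* Depth 1 supplies a regular sequence [q = r / d] in the localization. If [r] is in [m], then [q]
   is 0 and not regular; otherwise [q] is invertible and generates the unit ideal. *)
case: s s1 sT sreg => [//|q [|//]] _ sT sreg.
have [r [d [md dq]]] := tol_frac q.
have [mr|nmr] := pselect (m r).
  apply: sT; have q0 : q = 0.
    have [d' dd'] := tol_inv (md : prime_compl (maximal_prime hm) d).
    rewrite -[q]mul1r -dd' mulrAC dq.
    suff -> : Loc.tol (prime_compl (maximal_prime hm)) r = 0 by rewrite mul0r.
    by apply/tol_eq0; exists b => //; exact: bm.
  have [|c] := sreg 0%N 1 isT.
    by rewrite /= q0 mul0r; exists (fun=> 0); rewrite big_ord0.
  rewrite big_ord0 => /eqP; by rewrite oner_eq0.
apply: sT; rewrite predeqE => z; split=> // _.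
have [r' rr'] := tol_inv (nmr : prime_compl (maximal_prime hm) r).
exists (fun=> z * r' * Loc.tol _ d); rewrite big_ord1 /=.
by rewrite -mulrA dq -mulrA [r' * _]mulrC rr' mulr1.
Qed.

Hypothesis hsl : semilocal R.

Lemma jacobson_regular : exists2 c, J c & regular c.
Proof.
have /finite_seqP[S SE] := hsl.
have SP M : M \in S <-> maximal_ideal setT M.
  by have := f_equal (fun X => X M) SE => /= ->.
have /choice[g gP] : forall M, exists c, M \in S -> M c /\ regular c.
  move=> M; have [/SP hM|nM] := pselect (M \in S); last by exists 0.
  by have [c Mc rc] := maximal_ideal_regular hM; exists c.
exists (\prod_(M <- S) g M).
  split=> // M hM; have MS := (SP M).2 hM.
  rewrite (perm_big _ (perm_to_rem MS)) big_cons /=; apply: idealMC; first by case: hM.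
  by have [] := gP _ MS.
rewrite big_seq; elim/big_ind : _ => [||M /gP[]//]; first exact: lreg1.
by move=> x y; exact: lregM.
Qed.

Section Setting.
Variable alpha : R.
Hypotheses (Ja : J alpha) (rega : regular alpha).
Local Notation A := (range tf).

Lemma to_frac_unit_inj : injective tf. Proof. exact: to_frac_inj. Qed.

Lemma to_frac_regular c : regular c -> tf c \is a GRing.unit.
Proof. by move=> /to_frac_inv[y cy]; apply/unitrPr; exists y. Qed.

Lemma subring_base : subring A.
Proof.
split; first by exists 1; rewrite ?rmorph1.
- by move=> _ _ [x _ <-] [y _ <-]; exists (x - y); rewrite ?rmorphB.
- by move=> _ _ [x _ <-] [y _ <-]; exists (x * y); rewrite ?rmorphM.
Qed.

Lemma preimage_ideal (I : set Q) : ideal A I -> ideal setT (tf @^-1` I).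
Proof.
move=> [IA I0 ID IM]; split=> //=; rewrite ?rmorph0 //.
- by move=> x y Ix Iy; rewrite rmorphD; exact: ID.
- by move=> c x _ Ix; rewrite rmorphM; apply: IM => //; exists c.
Qed.

Lemma preimage_ideal_inj (I I' : set Q) : I `<=` A -> I' `<=` A ->
  tf @^-1` I `<=` tf @^-1` I' -> I `<=` I'.
Proof. by move=> IA IA' h x Ix; have [r _ rE] := IA _ Ix; rewrite -rE; apply: h; rewrite /= rE. Qed.

Lemma total_frac_setting : dim1_setting A (tf alpha).
Proof.
split.
- exact: subring_base.
- exact: to_frac_regular.
- by exists alpha.
- move=> q; have [r [c [regc cq]]] := to_frac_fraction q.
  (* The denominator [c] divides a power of [alpha]. *)
  have [h [d dE]] := jacobson_expr_dvd noethR dimR regc Ja.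
  exists h, (d * r) => //; rewrite -rmorphXn dE !rmorphM /= -mulrA; congr (_ * _).
  exact: esym cq.
- move=> f _ [r _ <-]; have [s hs] := jacobson_unit noethR r Ja.
  have hs' : (1 - tf alpha * tf r) * tf s = 1.
    by rewrite -rmorphM -(rmorph1 tf) -rmorphB -rmorphM [alpha * r]mulrC hs.
  by move=> h; rewrite -[f]mulr1 -hs' mulrA h mul0r.
- move=> k F [I0 FI0] FP.
  have [||_ [[I FI <-] Imin]] := @regular_min _ noethR dimR (alpha ^+ k)
    [set tf @^-1` I | I in F] (lregX rega).
  + by exists (tf @^-1` I0), I0.
  + move=> _ [I /FP[hI Ia] <-]; split; first exact: preimage_ideal.
    by rewrite /= rmorphXn.
  exists I; split=> // I' FI' I'I.
  have [[IA _ _ _] _] := FP _ FI; have [[IA' _ _ _] _] := FP _ FI'.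
  rewrite eqEsubset; split=> //; apply: preimage_ideal_inj => //.
  rewrite (Imin (tf @^-1` I')) //; first by exists I'.
  by move=> x; exact: I'I.
- move=> F [I0 FI0] FP.
  have [||_ [[I FI <-] Imax]] := @noetherian_max _ noethR [set tf @^-1` I | I in F].
  + by exists (tf @^-1` I0), I0.
  + by move=> _ [I /FP hI <-]; exact: preimage_ideal.
  exists I; split=> // I' FI' II'.
  have [IA _ _ _] := FP _ FI; have [IA' _ _ _] := FP _ FI'.
  rewrite eqEsubset; split=> //; apply: preimage_ideal_inj => //.
  rewrite (Imax (tf @^-1` I')) //; first by exists I'.
  by move=> x; exact: II'.
- move=> q; have [r [c [regc cq]]] := to_frac_fraction q.
  have [y ry regu] := reduced_add_regular noethR redR r.
  have uU := to_frac_regular regu; have cU := to_frac_regular regc.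
  have rr : tf r * tf r = tf r * tf (r + y).
    by rewrite -!rmorphM; congr (tf _); rewrite mulrDr ry addr0.
  move: (tf (r + y)) uU rr => u uU rr; have uu : u * u^-1 = 1 by exact: divrr.
  (* [r / (r + y)] is idempotent because [r * y = 0]. *)
  exists (tf r * u^-1), (u * (tf c)^-1); split.
  + by rewrite mulrACA rr; ring: uu.
  + by rewrite unitrM uU unitrV.
  + have -> : tf r * u^-1 * (u * (tf c)^-1) = tf r * (tf c)^-1 by ring: uu.
    by rewrite -(cq : tf c * q = tf r) mulrAC divrr ?mul1r.
Qed.

End Setting.
End Dimension1.

(** * The Jacobson-adic completion *)

Section JacobsonCompletion.
Variable R : comNzRingType.
Hypotheses (noethR : noetherian R) (dimR : krull_dim R 1).
Variable alpha : R.
Local Notation J := (jacobson [set: R]).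
Hypotheses (Ja : J alpha) (rega : regular alpha).
Local Notation C := (completion J).
Local Notation pow := (ideal_pow setT J).

Lemma ideal_pow_expr k : pow k (alpha ^+ k).
Proof.
elim: k => [//|k IH]; rewrite /= exprS; exists [:: (alpha, alpha ^+ k)].
  by move=> p; rewrite inE => /eqP->.
by rewrite big_seq1.
Qed.

Lemma ideal_pow_dvd k x : pow k (alpha ^+ k * x).
Proof. by rewrite mulrC; apply: Completion.powM; exact: ideal_pow_expr. Qed.

Lemma ideal_powD_sub k m (X : set R) : X 0 -> (forall x y, X x -> X y -> X (x + y)) ->
  (forall u v, pow k u -> pow m v -> X (u * v)) -> pow (k + m)%N `<=` X.
Proof.
elim: k X => [|k IH] X X0 XD XM.
  by move=> x Jx; rewrite -[x]mul1r; exact: XM.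
move=> _ [s sP ->]; rewrite big_seq.
apply: (big_ind X) => // p /sP[p1 p2].
apply: (IH (fun q => X (p.1 * q))) p2; first by rewrite mulr0.
  by move=> x y; rewrite mulrDr; exact: XD.
move=> u v Ju Jv; rewrite mulrA; apply: (XM) => //.
by exists [:: (p.1, u)]; [move=> q; rewrite inE => /eqP->|rewrite big_seq1].
Qed.

(** A fixed power of [J] lies in [(alpha)]; hence the Jacobson-adic and [alpha]-adic topologies
    agree. *)
Lemma ideal_pow_adic n : exists k, forall x, pow k x -> exists y, x = alpha ^+ n * y.
Proof.
have [k0 hk] := jacobson_pow_sub noethR dimR rega Ja.
elim: n => [|n [k IH]]; first by exists 0%N => x _; exists x; rewrite mul1r.
exists (k0 + k)%N; apply: ideal_powD_sub.
- by exists 0; rewrite mulr0.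
- by move=> _ _ [y ->] [z ->]; exists (y + z); rewrite mulrDr.
- move=> u v /hk[c ->] /IH[d ->]; exists (c * d); rewrite exprS; ring.
Qed.

Implicit Types (x : cauchy_seq J).

Lemma cauchy_adic x n : exists N, forall p q, (N <= p)%N -> (N <= q)%N ->
  exists y, val x p - val x q = alpha ^+ n * y.
Proof.
have [k hk] := ideal_pow_adic n.
have /asboolP/(_ k)[N hN] := valP x.
by exists N => p q pN qN; apply: hk; exact: hN.
Qed.

Definition mk_cauchy (s : nat -> R) (h : s \in cauchy J) : cauchy_seq J := exist _ s h.

Lemma cauchy_adicP (s : nat -> R) : (forall n, exists N, forall p q, (N <= p)%N -> (N <= q)%N ->
  exists y, s p - s q = alpha ^+ n * y) -> s \in cauchy J.
Proof.
move=> h; apply/asboolP => n; have [N hN] := h n; exists N => p q pN qN.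
by have [y ->] := hN p q pN qN; exact: ideal_pow_dvd.
Qed.

Lemma null_adicP x : x \in null (I := J) <->
  forall n, exists N, forall p, (N <= p)%N -> exists y, val x p = alpha ^+ n * y.
Proof.
split=> [/asboolP h n|h].
  have [k hk] := ideal_pow_adic n; have [N hN] := h k.
  by exists N => p pN; apply: hk; exact: hN.
apply/asboolP => n; have [N hN] := h n; exists N => p /hN[y ->].
exact: ideal_pow_dvd.
Qed.

Lemma completion_eq0 x : \pi_C x = 0 <-> x \in null (I := J).
Proof.
have <- : \pi_C (0 : cauchy_seq J) = 0 by rewrite !piE.
split=> [/eqP|h].
  by rewrite -Quotient.idealrBE subr0.
by apply: Completion.eq_pi; rewrite subr0.
Qed.

Lemma const_cauchy (r : R) : (fun=> r) \in cauchy J.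
Proof.
by apply: cauchy_adicP => n; exists 0%N => p q _ _; exists 0; rewrite subrr mulr0.
Qed.

Definition to_completion (r : R) : C := \pi_C (mk_cauchy (const_cauchy r)).

Lemma to_completion_is_zmod_morphism : zmod_morphism to_completion.
Proof.
move=> r s; rewrite /to_completion !piE; congr (\pi_C _); exact: val_inj.
Qed.

Lemma to_completion_is_monoid_morphism : monoid_morphism to_completion.
Proof.
split=> [|r s].
  by rewrite -[RHS]/(Completion.one J); congr (\pi_C _); exact: val_inj.
rewrite -[RHS]/(Completion.mul _ _) Completion.pi_mul; congr (\pi_C _); exact: val_inj.
Qed.

HB.instance Definition _ := GRing.isZmodMorphism.Build R C to_completion
  to_completion_is_zmod_morphism.
HB.instance Definition _ := GRing.isMonoidMorphism.Build R C to_completion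
  to_completion_is_monoid_morphism.

Lemma to_completion_mul r x : to_completion r * \pi_C x =
  \pi_C (mk_cauchy (const_cauchy r) * x).
Proof. by rewrite -[LHS]/(Completion.mul _ _) Completion.pi_mul. Qed.

(* Dividing a sequence of multiples of [alpha ^ n] gives a Cauchy sequence as   *)
(* [alpha] is regular.                                                          *)
Lemma completion_dvd x n N : (forall p, (N <= p)%N -> exists y, val x p = alpha ^+ n * y) ->
  exists y, \pi_C x = to_completion alpha ^+ n * y.
Proof.
move=> h; have /choice[g gP] : forall p, exists y, (N <= p)%N -> val x p = alpha ^+ n * y.
  move=> p; have [/h[y yE]|_] := leqP N p; first by exists y.
  by exists 0.
have gC : g \in cauchy J.
  apply: cauchy_adicP => k; have [M hM] := cauchy_adic x (n + k).
  exists (maxn N M) => p q; rewrite !geq_max => /andP[pN pM] /andP[qN qM].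
  have [y] := hM p q pM qM; rewrite !gP // -mulrBr exprD -mulrA.
  by move=> /(lregX (n := n) rega) e; exists y.
exists (\pi_C (mk_cauchy gC)); rewrite -rmorphXn to_completion_mul.
apply: Completion.eq_pi; apply/null_adicP => k; exists N => p pN.
by exists 0; rewrite mulr0 -[LHS]/(val x p - alpha ^+ n * g p) gP // subrr.
Qed.

Lemma completion_adic : adic_completion to_completion alpha.
Proof.
have piB (x y : cauchy_seq J) : \pi_C x - \pi_C y = \pi_C (x - y) by rewrite !piE.
split.
- elim/quotW => x k; have [N hN] := cauchy_adic x k.
  have [|y yE] := @completion_dvd (x - mk_cauchy (const_cauchy (val x N))) k N.
    by move=> p pN; have [y yE] := hN p N pN (leqnn _); exists y.
  by exists (val x N), y; rewrite -yE -piB addrC subrK.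
- elim/quotW => x; rewrite to_completion_mul => /completion_eq0/null_adicP h.
  apply/completion_eq0/null_adicP => n; have [N hN] := h n.+1.
  exists N => p /hN[y]; rewrite exprS -mulrA => e; exists y; exact: rega e.
- elim/quotW => x h; apply/completion_eq0/null_adicP => n.
  have [y] := h n; elim/quotW: y => y.
  rewrite -rmorphXn to_completion_mul => /eqP; rewrite -subr_eq0 piB => /eqP.
  move=> /completion_eq0/null_adicP/(_ n)[N hN]; exists N => p /hN[z].
  rewrite -[LHS]/(val x p - alpha ^+ n * val y p) => zE.
  by exists (val y p + z); rewrite mulrDr -zE; ring.
- move=> c; pose s k := \sum_(i < k) alpha ^+ i * c i.
  have sB k p : (k <= p)%N -> exists y, s p - s k = alpha ^+ k * y.
    move=> /subnK <-; elim: (p - k)%N => [|d [y IH]].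
      by exists 0; rewrite subrr mulr0.
    exists (y + alpha ^+ d * c (d + k)%N); rewrite addSn {1}/s big_ord_recr /= -/(s _).
    by rewrite addrAC IH exprD; ring.
  have sC : s \in cauchy J.
    apply: cauchy_adicP => n; exists n => p q np nq.
    have [y yE] := sB _ _ np; have [z zE] := sB _ _ nq.
    by exists (y - z); rewrite mulrBr -yE -zE; ring.
  exists (\pi_C (mk_cauchy sC)) => k.
  have [|y yE] := @completion_dvd (mk_cauchy sC - mk_cauchy (const_cauchy (s k))) k k.
    exact: sB.
  by exists y; rewrite -yE -piB addrC subrK.
- move=> r k; elim/quotW => x; rewrite -rmorphXn to_completion_mul => /eqP.
  rewrite -subr_eq0 piB => /eqP/completion_eq0/null_adicP/(_ k)[N /(_ N (leqnn _))[y]].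
  rewrite -[LHS]/(r - alpha ^+ k * val x N) => yE.
  by exists (val x N + y); rewrite mulrDr -yE; ring.
Qed.

End JacobsonCompletion.

(** * Valuations of the local rings *)

Section LocalValuations.
Variable R : comNzRingType.
Hypotheses (hCM : cohen_macaulay_dim1 R) (redR : reduced R).
Variable alpha : R.
Hypotheses (Ja : jacobson [set: R] alpha) (rega : regular alpha).
Variables (m : set R) (hm : maximal_ideal setT m).

Let noethR : noetherian R. Proof. by case: hCM. Qed.
Let dimR : krull_dim R 1. Proof. by case: hCM. Qed.
Local Notation Q := (total_frac_unit R).
Local Notation tf := (@to_frac_unit R).
Local Notation a := (tf alpha).
Local Notation ai := (a^-1).
Local Notation valring := (valring (range tf)).
Let settingA := total_frac_setting hCM redR Ja rega.
Let aU : a \is a GRing.unit. Proof. by case: settingA. Qed.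
Let aai : a * ai = 1. Proof. exact: divrr. Qed.
Let aaiX n : a ^+ n * ai ^+ n = 1. Proof. exact: expr_inv1. Qed.

Definition centered_in (V : set Q) := forall s, ~ m s -> ~ val_ideal V (tf s).

Local Notation Rm := (localization_at (maximal_prime hm)).
Local Notation Qm := (total_frac Rm).

Definition to_local : {rmorphism R -> Rm} := @Loc.tol R (prime_compl (maximal_prime hm)).
Local Notation loc := to_local.
Definition lam : {rmorphism R -> Qm} := @to_frac Rm \o loc.

Lemma outsideM s t : ~ m s -> ~ m t -> ~ m (s * t).
Proof. exact: (prime_complM (maximal_prime hm)). Qed.

Lemma to_local_eq0 r : loc r = 0 <-> exists2 s, ~ m s & s * r = 0.
Proof. exact: tol_eq0. Qed.

Lemma lam_eq0 r : lam r = 0 -> exists2 s, ~ m s & s * r = 0.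
Proof. by rewrite -(rmorph0 (@to_frac Rm)) => /(@to_frac_inj Rm (loc r))/to_local_eq0. Qed.

Lemma to_local_inv s : ~ m s -> exists y, loc s * y = 1.
Proof. exact: (@tol_inv R (prime_compl (maximal_prime hm))). Qed.

Lemma to_local_frac x : exists r s, ~ m s /\ loc s * x = loc r.
Proof. exact (@tol_frac R (prime_compl (maximal_prime hm)) x). Qed.

Lemma to_local_regular c : regular c -> regular (loc c).
Proof.
move=> regc x y /eqP; rewrite -subr_eq0 -mulrBr => /eqP cxy.
apply/eqP; rewrite -subr_eq0; apply/eqP; move: (x - y) cxy => z cz.
have [r [d [md dz]]] := to_local_frac z; have [d' dd'] := to_local_inv md.
have : loc (c * r) = 0 by rewrite rmorphM -dz mulrCA cz mulr0.
move=> /to_local_eq0[s ms scr].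
rewrite -[z]mul1r -dd' mulrAC dz (_ : loc r = 0) ?mul0r //.
by apply/to_local_eq0; exists s => //; apply: regc; rewrite mulr0 mulrCA.
Qed.

Lemma lam_den_inv : exists y, lam alpha * y = 1.
Proof. exact: to_frac_inv (to_local_regular rega). Qed.

Definition loc_rep (q : Qm) s k r := ~ m s /\ lam (s * alpha ^+ k) * q = lam r.

(** A numerator [y] of a regular element of [R_m] need not be regular in [R]. A [w] with [y * w = 0]
    and [y + w] regular vanishes in [R_m], so [y] may be replaced by [y + w], which divides a power
    of [alpha]. *)
Lemma loc_repP q : exists s k r, loc_rep q s k r.
Proof.
have [D [C [regC Cq]]] := to_frac_fraction q.
have [y [t [mt tC]]] := to_local_frac C; have [x [u [mu uD]]] := to_local_frac D.
have [w yw regyw] := reduced_add_regular noethR redR y.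
have : loc w = 0.
  have [t' tt'] := to_local_inv mt.
  apply: regC; rewrite mulr0.
  have -> : C * loc w = t' * (loc t * C) * loc w by rewrite mulrA [t' * _]mulrC tt' mul1r.
  by rewrite tC -mulrA -rmorphM yw rmorph0 mulr0.
move=> /to_local_eq0[s ms sw].
have [h [d dE]] := jacobson_expr_dvd noethR dimR regyw Ja.
exists (u * s), h, (d * s * t * x); split; first exact: outsideM.
have -> : u * s * alpha ^+ h = d * s * (u * y) + d * u * (s * w) by rewrite dE; ring.
have E : lam u * (lam y * q) = lam t * lam x.
  rewrite -![lam _]/(@to_frac Rm (loc _)) -tC -uD !rmorphM -Cq; ring.
rewrite sw mulr0 addr0 !rmorphM -[RHS]mulrA -E; ring.
Qed.

Lemma loc_repM q s k r q' s' k' r' : loc_rep q s k r -> loc_rep q' s' k' r' ->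
  loc_rep (q * q') (s * s') (k + k') (r * r').
Proof.
move=> [ms qE] [ms' q'E]; split; first exact: outsideM.
rewrite [RHS]rmorphM -qE -q'E exprD !rmorphM; ring.
Qed.

Lemma loc_repB q s k r q' s' k' r' : loc_rep q s k r -> loc_rep q' s' k' r' ->
  loc_rep (q - q') (s * s') (k + k') (s' * alpha ^+ k' * r - s * alpha ^+ k * r').
Proof.
move=> [ms qE] [ms' q'E]; split; first exact: outsideM.
rewrite [RHS]rmorphB [X in _ = X - _]rmorphM [X in _ = _ - X]rmorphM -qE -q'E exprD.
rewrite !rmorphM; ring.
Qed.

Section OneValuation.
Variable V : set Q.
Hypotheses (valV : valring V) (cenV : centered_in V).
Let sV := valring_subring valV.
Let AV r : V (tf r). Proof. by apply: sub_valring valV _ _; exists r. Qed.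

Definition local_valring : set Qm :=
  [set q | exists s k r, loc_rep q s k r /\ V (tf r * ai ^+ k)].

(** Two representations agree after multiplication by elements outside [m], and such factors can be
    cancelled from membership in [V]. *)
Lemma local_valringP q s k r : loc_rep q s k r -> local_valring q <-> V (tf r * ai ^+ k).
Proof.
move=> rq; split; last by exists s, k, r.
move=> [s' [k' [r' [rq' Vr']]]]; have [ms qE] := rq; have [ms' qE'] := rq'.
have : lam (s' * alpha ^+ k' * r - s * alpha ^+ k * r') = 0.
  rewrite rmorphB [X in X - _]rmorphM [X in _ - X]rmorphM -qE -qE'; ring.
move=> /lam_eq0[u mu].
rewrite mulrBr => /eqP; rewrite subr_eq0 => /eqP uE.
apply: (@val_idealPn _ V (tf (u * s'))); first exact/cenV/outsideM.
have -> : tf (u * s') * (tf r * ai ^+ k) = tf (u * s) * (tf r' * ai ^+ k').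
  have : tf (u * (s' * alpha ^+ k' * r)) = tf (u * (s * alpha ^+ k * r')) by rewrite uE.
  rewrite !rmorphM !rmorphXn /=.
  have := aaiX k; have := aaiX k'.
  move: (a ^+ k) (a ^+ k') (ai ^+ k) (ai ^+ k') => p p' p1 p1' pp' pp e.
  transitivity (tf u * (tf s' * p' * tf r) * p1' * p1); first by ring: pp'.
  by rewrite e; ring: pp.
exact: subringM.
Qed.

Lemma local_valring_valuation : valuation_rings Rm local_valring.
Proof.
split.
- split.
  + exists 1, 0%N, 1; split; last by rewrite mulr1 rmorph1; exact: subring1.
    by split; [exact: prime_compl1 (maximal_prime hm)|rewrite !mulr1].
  + move=> q q' [s [k [r [rq Vr]]]] [s' [k' [r' [rq' Vr']]]].
    apply/(local_valringP (loc_repB rq rq')).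
    have -> : tf (s' * alpha ^+ k' * r - s * alpha ^+ k * r') * ai ^+ (k + k') =
        tf s' * (tf r * ai ^+ k) - tf s * (tf r' * ai ^+ k').
      rewrite rmorphB !rmorphM !rmorphXn /= exprD.
      have := aaiX k; have := aaiX k'.
      by move: (a ^+ k) (a ^+ k') (ai ^+ k) (ai ^+ k') => p p' p1 p1' pp' pp; ring: pp pp'.
    by apply: subringB => //; exact: subringM.
  + move=> q q' [s [k [r [rq Vr]]]] [s' [k' [r' [rq' Vr']]]].
    apply/(local_valringP (loc_repM rq rq')).
    by rewrite rmorphM exprD mulrACA; exact: subringM.
- move=> _ [z _ <-]; have [r [s [ms sz]]] := to_local_frac z.
  exists s, 0%N, r; split; last by rewrite mulr1.
  by split=> //; rewrite mulr1 -[lam s]/(@to_frac Rm (loc s)) -rmorphM sz.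
- split=> // /(_ _ I) h; have [y ay] := lam_den_inv.
  have ry : loc_rep y 1 1 1.
    split; first exact: prime_compl1 (maximal_prime hm).
    by rewrite mul1r expr1 ay !rmorph1.
  have := (local_valringP ry).1 (h y).
  by rewrite rmorph1 mul1r expr1; exact: (valring_den settingA).
- move=> q q' nq nq'.
  have [s [k [r rq]]] := loc_repP q; have [s' [k' [r' rq']]] := loc_repP q'.
  move=> /(local_valringP (loc_repM rq rq')).
  rewrite rmorphM exprD mulrACA; apply: (valring_coprime valV).
    by move=> /(local_valringP rq).
  by move=> /(local_valringP rq').
Qed.

End OneValuation.

Lemma local_valring_inj V W : valring V -> centered_in V -> valring W -> centered_in W ->
  local_valring V = local_valring W -> V = W.
Proof.
move=> valV cV valW cW VW; rewrite predeqE => x.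
have [h [r _ rE]] := dim1_denominator settingA x.
have [y ay] := lam_den_inv.
have ry : loc_rep (y ^+ h * lam r) 1 h r.
  split; first exact: prime_compl1 (maximal_prime hm).
  by rewrite mul1r rmorphXn mulrA expr_inv1 // mul1r.
have -> : x = tf r * ai ^+ h by rewrite rE mulrAC aaiX mul1r.
by rewrite -(local_valringP valV cV ry) -(local_valringP valW cW ry) VW.
Qed.

(** Valuation rings centered in [m] embed into those of [R_m] through [local_valring], and these
    inject into the residue classes modulo [m]. *)
Lemma residue_classes_injection (S : set (set Q)) : large_residue_fields R ->
  (forall V, S V -> valring V /\ centered_in V) ->
  exists g : set Q -> set R, (forall V, S V -> quotient_set setT m (g V)) /\
    (forall V W, S V -> S W -> g V = g W -> V = W).
Proof.
move=> /(_ m hm)/pcard_leP[g] hS; exists (g \o local_valring); split.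
  by move=> V /hS[valV cV]; apply: 'funS_g; exact: local_valring_valuation.
move=> V W /hS[valV cV] /hS[valW cW] /= gVW.
apply: local_valring_inj => //; apply: 'inj_g gVW; rewrite inE;
  exact: local_valring_valuation.
Qed.

End LocalValuations.

(** * Valuations and the integral closure *)

Section ChineseRemainder.
Variable R : comNzRingType.
Implicit Types M : set R.

Lemma maximal_ideal_comaximal M M' : maximal_ideal setT M -> maximal_ideal setT M' ->
  M <> M' -> exists x, M' x /\ M (x - 1).
Proof.
move=> [hM MT Mmax] [hM' MT' Mmax'] MM'.
have [y My' My] : exists2 y, M' y & ~ M y.
  apply: contrapT => h; have [||//] := Mmax' M hM; last by [].
  by move=> y My'; apply: contrapT => My; apply: h; exists y.
have [e|e] := Mmax (ideal_adj M y) (ideal_adjP y hM) (@sub_ideal_adj _ M y).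
  by case: My; rewrite -e; exact: mem_ideal_adj.
have [p Mp [r e1]] : ideal_adj M y 1 by rewrite e.
exists (r * y); split; first exact: idealM.
have -> : r * y - 1 = (-1) * p by rewrite {1}e1; ring.
exact: idealM.
Qed.

Lemma chinese_remainder (S : seq (set R)) (c : set R -> R) : uniq S ->
  (forall M, M \in S -> maximal_ideal setT M) ->
  exists x, forall M, M \in S -> M (x - c M).
Proof.
move=> uS maxS.
have /choice[g gP] : forall p : set R * set R, exists x,
    p.1 \in S -> p.2 \in S -> p.1 <> p.2 -> p.2 x /\ p.1 (x - 1).
  move=> [M M']; have [[MS [MS' MM']]|h] := pselect (M \in S /\ M' \in S /\ M <> M').
    have [x xP] := maximal_ideal_comaximal (maxS _ MS) (maxS _ MS') MM'.
    by exists x.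
  by exists 0 => MS MS' MM'; case: h.
pose e M := \prod_(M' <- S | M' != M) g (M, M').
have e1 M : M \in S -> M (e M - 1).
  move=> MS; have [hM _ _] := maxS _ MS; rewrite /e big_seq_cond.
  apply: (big_ind (fun x => M (x - 1))).
  - by rewrite subrr; exact: ideal0.
  - move=> x y Mx My; have -> : x * y - 1 = y * (x - 1) + (y - 1) by ring.
    by apply: idealD => //; exact: idealM.
  - by move=> M' /andP[MS' /eqP MM']; have [] := gP (M, M') MS MS' (nesym MM').
have e0 M M' : M \in S -> M' \in S -> M' != M -> M' (e M).
  move=> MS MS' MM'; have [hM' _ _] := maxS _ MS'.
  rewrite /e (perm_big _ (perm_to_rem MS')) big_cons MM' /= mulrC; apply: idealM => //.
  by have [] := gP (M, M') MS MS' (fun h => elimN eqP MM' (esym h)).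
exists (\sum_(M <- S) e M * c M) => M MS; have [hM _ _] := maxS _ MS.
rewrite (bigD1_seq M) //= addrAC.
have -> : e M * c M - c M = c M * (e M - 1) by ring.
apply: idealD => //; first by apply: idealM => //; exact: e1.
rewrite big_seq_cond; apply: ideal_sum => // M' /andP[MS' MM'].
by rewrite mulrC; apply: idealM => //; apply: e0; rewrite 1?eq_sym.
Qed.

End ChineseRemainder.

Lemma monic_root_expand (R K : comNzRingType) (f : {rmorphism R -> K}) (p : {poly R}) d x :
  p \is monic -> size p = d.+1 -> root (map_poly f p) x ->
  x ^+ d = - \sum_(i < d) f p`_i * x ^+ i.
Proof.
move=> mp sp /eqP; rewrite (horner_coef_wide _ (n := d.+1)); last first.
  by rewrite -sp size_poly.
have pd : p`_d = 1 by move: mp; rewrite monicE /lead_coef sp => /eqP.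
rewrite big_ord_recr /= coef_map pd -[X in _ + X * _]/(f 1) rmorph1 mul1r addrC => /eqP.
rewrite addr_eq0 => /eqP ->; congr (- _); apply: eq_bigr => i _.
by rewrite coef_map.
Qed.

Section IntegralClosure.
Variables (R : comNzRingType) (Q : comUnitRingType) (f : {rmorphism R -> Q}) (alpha : R).
Hypothesis settingA : dim1_setting (range f) (f alpha).
Local Notation valring := (valring (range f)).

(** If [x] were outside [V], dividing its integral equation by a power of a unit [u] that agrees
    with [x] up to infinite value would express [x], up to a factor outside [val_ideal V], by
    elements of [V]. *)
Lemma integral_valring V x : valring V -> integralOver f x -> V x.
Proof.
move=> valV [p mp px]; have sV := valring_subring valV; apply: contrapT => Vx.
have [|u uU ux] := unitize_valring settingA valV (x := x).
  by move=> /infinite_at_mem.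
have Vu : ~ V u by move=> /(valring_congr valV ux).
have Vu' := valring_inv valV uU Vu.
have uu : u * u^-1 = 1 by exact: divrr.
pose w := x * u^-1.
have w1 : infinite_at V (w - 1).
  have -> : w - 1 = - (u^-1 * (u - x)) by rewrite /w; ring: uu.
  by apply: infinite_atN; exact: infinite_atM.
have Vw : V w by apply/(valring_congr valV w1); exact: subring1.
have nw : ~ val_ideal V w.
  by apply: (val_ideal_sub1 settingA valV); exact: (infinite_at_ideal settingA valV).
have nwX n : ~ val_ideal V (w ^+ n).
  elim: n => [|n IH]; first exact: not_val_ideal1.
  by rewrite exprS; exact: not_val_idealM.
have [d sp] : exists d, size p = d.+2.
  have : (1 < size p)%N.
    rewrite ltnNge; apply/negP => /size1_polyC pE; move: mp px; rewrite pE.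
    rewrite monicE lead_coefC => /eqP ->.
    by rewrite polyC1 rmorph1 rootE -polyC1 hornerC oner_eq0.
  by case: (size p) => [|[|d]] // _; exists d.
have xE := monic_root_expand mp sp px.
apply: Vx; apply: (val_idealPn (nwX d)).
have -> : w ^+ d * x = - \sum_(i < d.+1) f p`_i * w ^+ i * u^-1 ^+ (d - i).
  have -> : w ^+ d * x = x ^+ d.+1 * u^-1 ^+ d by rewrite exprMn exprS; ring.
  rewrite xE mulNr mulr_suml; congr (- _); apply: eq_bigr => i _.
  have -> : u^-1 ^+ d = u^-1 ^+ (d - i) * u^-1 ^+ i.
    by rewrite -exprD subnK // -ltnS.
  by rewrite exprMn; ring.
apply: subringN => //; apply: subring_sum => // i _.
apply: subringM => //; last exact: subringX.
apply: subringM => //; last exact: subringX.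
by apply: sub_valring valV _ _; exists p`_i.
Qed.

(** Write [x = e * u] with [e] idempotent and [u] a unit lying in all valuation rings. Then [u] is
    in [A[1 / u]] by [not_integral_valring], and clearing denominators gives a monic equation. *)
Lemma valring_integral x : (forall V, valring V -> V x) -> integralOver f x.
Proof.
move=> Bx; have [e [w [ee wU xE]]] := dim1_idem settingA x.
pose u := e * w + (1 - e).
have ww : w * w^-1 = 1 by exact: divrr.
have uU : u \is a GRing.unit.
  apply/unitrPr; exists (e * w^-1 + (1 - e)).
  have -> : u * (e * w^-1 + (1 - e)) =
    e * e * (w * w^-1) + (e - e * e) * (w + w^-1) + (1 - e - e + e * e) by rewrite /u; ring.
  by rewrite ww ee subrr mul0r; ring.
have inte : integralOver f e.
  exists ('X^2 - 'X).
    rewrite monicE lead_coefDl ?lead_coefXn // size_polyN size_polyX size_polyXn //.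
  rewrite rmorphB /= map_polyXn map_polyX rootE !hornerE /= expr2 ee subrr //.
have Bu V : valring V -> V u.
  move=> valV; apply: subringD (valring_subring valV) _ _ _ _; first by rewrite -xE; exact: Bx.
  apply: subringB (valring_subring valV) _ _ _ _; first exact: subring1 (valring_subring valV).
  exact: integral_valring.
suff intu : integralOver f u.
  have -> : x = e * u.
    by rewrite xE /u mulrDr mulrA ee mulrBr ee mulr1 subrr addr0.
  exact: integral_mul.
have [p pA uE] : poly_image (range f) u^-1 u.
  apply: contrapT => /(not_integral_valring settingA uU)[V valV]; apply; exact: Bu.
have uu : u * u^-1 = 1 by exact: divrr.
have /choice[r rP] : forall i, exists r, f r = p`_i.
  by move=> i; have [r _ rE] := pA i; exists r.
pose d := size p.
(* Multiplying [u = sum of r_i u ^- i] by [u ^+ d] gives [u ^+ d.+1 = q.[u]]. *)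
pose q := \sum_(i < d) r i *: 'X^(d - i) : {poly R}.
have sq : (size q < size ('X^(d.+1) : {poly R}))%N.
  rewrite size_polyXn ltnS; apply: leq_trans (size_sum _ _ _) _; apply/bigmax_leqP => i _.
  apply: leq_trans (size_scale_leq _ _) _; rewrite size_polyXn ltnS.
  exact: leq_subr.
exists ('X^(d.+1) - q).
  by rewrite monicE lead_coefDl ?lead_coefXn // size_polyN.
rewrite rootE rmorphB /= map_polyXn hornerD hornerN hornerXn subr_eq0; apply/eqP.
rewrite rmorph_sum horner_sum exprS {1}uE horner_coef mulr_suml.
apply: eq_bigr => i _.
rewrite -[X in X.[u]]/(map_poly f (r i *: 'X^(d - i))) map_polyZ map_polyXn hornerZ hornerXn.
rewrite rP.
have -> : u ^+ d = u ^+ (d - i) * u ^+ i by rewrite -exprD subnK // ltnW.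
by have := expr_inv1 i uu; move: (u ^+ i) (u^-1 ^+ i) => y z yz; ring: yz.
Qed.

Lemma integral_residue V v : valring V -> V v ->
  exists2 y : Q, integralOver f y & val_ideal V (y - v).
Proof.
move=> valV Vv; have [S [uS SP]] := valrings_enum settingA.
have [|y yP] := @weak_approximation _ _ _ settingA S (fun W => if W == V then v else 0) 1 uS.
  by move=> W /SP.
have yV : val_ideal V (y - v).
  have /SP/yP := valV; rewrite eqxx expr1; exact: (val_ideal_den_mul settingA valV).
exists y => //; apply: valring_integral => W valW.
have [->|WV] := eqVneq W V.
  have -> : y = (y - v) + v by ring.
  apply: subringD (valring_subring valV) _ _ _ Vv; exact: (val_ideal_mem valV).
have /SP/yP := valW; rewrite (negbTE WV) subr0 expr1 => /(val_ideal_den_mul settingA valW).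
exact: (val_ideal_mem valW).
Qed.

Local Notation IC := (integralOver f : set Q).

(** The contraction [n] of [val_ideal V] to the integral closure is maximal, since the closure
    reaches every residue of [V] ([integral_residue]). Rationality at [n] then replaces an integral
    lift of [v] by an element of [R]. *)
Lemma residue_rational V v :
  (forall n, maximal_ideal IC n -> quotient_set IC n = quotient_set (range f) n) ->
  valring V -> V v ->
  exists c, val_ideal V (v - f c).
Proof.
move=> resR valV Vv; have sV := valring_subring valV.
pose n : set Q := [set x | IC x /\ val_ideal V x].
have icV (x : Q) : IC x -> V x by exact: integral_valring.
have icP (x : Q) : (forall W, valring W -> W x) -> IC x.
  exact: valring_integral.
have icVW (x : Q) W : valring W -> IC x -> W x.
  by move=> valW; exact: integral_valring.
have icD (x y : Q) : IC x -> IC y -> IC (x + y).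
  move=> hx hy; apply: icP => W valW; apply: subringD (valring_subring valW) _ _ _ _;
    exact: icVW.
have icM (x y : Q) : IC x -> IC y -> IC (x * y).
  move=> hx hy; apply: icP => W valW; apply: subringM (valring_subring valW) _ _ _ _;
    exact: icVW.
have ic1 : IC (1 : Q).
  by apply: icP => W valW; exact: subring1 (valring_subring valW).
have ic0 : IC (0 : Q).
  by apply: icP => W valW; exact: subring0 (valring_subring valW).
have icN (x : Q) : IC x -> IC (- x).
  move=> hx; apply: icP => W valW; apply: subringN (valring_subring valW) _ _.
  exact: icVW.
have maxn : maximal_ideal (IC) n.
  split.
  - split; first by move=> x [].
    + split=> //; apply: (infinite_at_ideal settingA valV) => q.
      by rewrite mulr0; exact: subring0.
    + by move=> x y [hx mx] [hy my]; split; [exact: icD|exact: (val_idealD settingA)].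
    + move=> c x hc [hx mx]; split; first exact: icM.
      by apply: (val_idealM valV) => //; exact: icV.
  - move=> e; have : n (1 : Q) by rewrite e.
    by move=> [_]; exact: not_val_ideal1.
  - move=> I [IV I0 ID IM] nI.
    have [e|e] := pselect (I `<=` n); first by left; rewrite eqEsubset.
    right; have [x Ix nx] : exists2 x : Q, I x & ~ val_ideal V x.
      apply: contrapT => h; apply: e => x Ix; split; first exact: IV.
      by apply: contrapT => nx; apply: h; exists x.
    have icx : IC x by exact: IV.
    have [|u uU ux] := unitize_valring settingA valV (x := x).
      by move=> /(infinite_at_ideal settingA valV).
    have nu : ~ val_ideal V u.
      move=> mu; apply: nx; have -> : x = u - (u - x) by ring.
      apply: (val_idealD settingA valV) => //; apply: (val_idealN valV).
      exact: (infinite_at_ideal settingA valV).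
    have Vu : V u^-1 by apply: (val_idealPn nu); rewrite divrr //; exact: subring1.
    have [y icy yu] := integral_residue valV Vu.
    have n1 : n (1 - y * x).
      split; first by apply: icD => //; apply: icN; exact: icM.
      have -> : 1 - y * x = - ((y - u^-1) * x) + u^-1 * (u - x).
        by rewrite mulrBr mulVr //; ring.
      apply: (val_idealD settingA valV).
        apply: (val_idealN valV); rewrite mulrC; apply: (val_idealM valV) => //.
        exact: icV.
      by apply: (infinite_at_ideal settingA valV); exact: infinite_atM.
    have I1 : I (1 : Q).
      have -> : (1 : Q) = (1 - y * x) + y * x by ring.
      by apply: ID; [exact: nI|exact: IM].
    rewrite eqEsubset; split=> // z icz.
    by rewrite -[z]mulr1; exact: IM.
have [y icy yv] := integral_residue valV Vv.
have : quotient_set (IC) n [set y + z | z in n] by exists y.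
rewrite (resR _ maxn) => -[_ [c _ <-] cE].
have : [set y + z | z in n] y.
  exists (0 : Q); last exact: addr0.
  split=> //; apply: (infinite_at_ideal settingA valV) => q.
  by rewrite mulr0; exact: subring0.
rewrite -cE => -[z [_ mz] zE]; exists c.
have yE : y = f c + (z : Q) by rewrite -zE.
have -> : v - f c = - (y - v) + (z : Q) by rewrite yE; ring.
by apply: (val_idealD settingA valV) => //; exact: (val_idealN valV).
Qed.

End IntegralClosure.

(** * Comparison with the valuations of the definitions *)

Section ValuationsOfR.
Variable R : comNzRingType.
Hypotheses (hCM : cohen_macaulay_dim1 R) (redR : reduced R).
Variable alpha : R.
Hypotheses (Ja : jacobson [set: R] alpha) (rega : regular alpha).

Let noethR : noetherian R. Proof. by case: hCM. Qed.
Let dimR : krull_dim R 1. Proof. by case: hCM. Qed.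
Local Notation Q := (total_frac_unit R).
Local Notation tf := (@to_frac_unit R).
Local Notation a := (tf alpha).
Local Notation ai := (a^-1).
Local Notation valring := (valring (range tf)).
Local Notation unif := (unif a).
Local Notation val_ge := (val_ge a).
Local Notation val_eq := (val_eq a).
Let settingA := total_frac_setting hCM redR Ja rega.
Let aU : a \is a GRing.unit. Proof. by case: settingA. Qed.

(** In [x = e * w], regularity of [x] forces the idempotent [e] to be 1. *)
Lemma regular_unit (x : Q) : regular x <-> x \is a GRing.unit.
Proof.
split=> [regx|xU]; last exact: mulrI xU.
apply: (finite_everywhere_unit settingA) => V valV infx.
have [e [w [ee wU xE]]] := dim1_idem settingA x.
have : x * (1 - e) = x * 0.
  have -> : x * (1 - e) = w * (e - e * e) by rewrite xE; ring.
  by rewrite ee subrr !mulr0.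
move=> /regx/eqP; rewrite subr_eq0 => /eqP e1.
by apply: (not_infinite_at_unit settingA valV wU); rewrite -[w]mul1r e1 -xE.
Qed.

Section OneValuation.
Variable V : set Q.
Hypothesis valV : valring V.
Let sV := valring_subring valV.

Lemma maximal_val_ideal : maximal_ideal V (val_ideal V).
Proof.
split.
- split; first by move=> x; exact: (val_ideal_mem valV).
  + apply: (infinite_at_ideal settingA valV) => q; rewrite mulr0; exact: subring0.
  + by move=> x y; exact: (val_idealD settingA).
  + by move=> c x; exact: (val_idealM valV).
- by move=> e; apply: (@not_val_ideal1 _ V); rewrite e; exact: subring1.
- move=> I [IV I0 ID IM] mI.
  have [e|e] := pselect (I `<=` val_ideal V); first by left; rewrite eqEsubset.
  right; have [x Ix nx] : exists2 x, I x & ~ val_ideal V x.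
    by apply: contrapT => h; apply: e => x Ix; apply: contrapT => nx; apply: h; exists x.
  have [|u uU ux] := unitize_valring settingA valV (x := x).
    by move=> /(infinite_at_ideal settingA valV).
  have Iu : I u.
    have -> : u = x + (u - x) by ring.
    by apply: ID => //; apply: mI; exact: (infinite_at_ideal settingA valV).
  have nu : ~ val_ideal V u.
    move=> mu; apply: nx; have -> : x = u - (u - x) by ring.
    apply: (val_idealD settingA valV) => //; apply: (val_idealN valV).
    exact: (infinite_at_ideal settingA valV).
  have Vu : V u^-1 by apply: (val_idealPn nu); rewrite divrr //; exact: subring1.
  rewrite eqEsubset; split=> // z Vz.
  have -> : z = z * u^-1 * u by rewrite mulrVK.
  by apply: IM => //; exact: subringM.
Qed.

(** Containing the unit [u], the ideal [M] contains all elements infinite at [V]. So an element of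
    [M] outside [val_ideal V] could be changed into one invertible in [V]. *)
Lemma val_ideal_unique (M : set Q) u : maximal_ideal V M -> M u ->
  u \is a GRing.unit -> M = val_ideal V.
Proof.
move=> [[MV M0 MD MM] MnV Mmax] Mu uU.
have [||//|e] := Mmax (val_ideal V).
- by case: maximal_val_ideal.
- move=> x Mx; apply: contrapT => nx.
  have [|v vU vx] := unitize_valring settingA valV (x := x).
    by move=> /(infinite_at_ideal settingA valV).
  have Mv : M v.
    have -> : v = x + u^-1 * (v - x) * u by rewrite mulrAC mulVr // mul1r; ring.
    by apply: (MD) => //; apply: (MM) => //; exact: vx.
  have nv : ~ val_ideal V v.
    move=> mv; apply: nx; have -> : x = v - (v - x) by ring.
    apply: (val_idealD settingA valV) => //; apply: (val_idealN valV).
    exact: (infinite_at_ideal settingA valV).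
  have Vv : V v^-1 by apply: (val_idealPn nv); rewrite divrr //; exact: subring1.
  apply: MnV; rewrite eqEsubset; split=> // z Vz.
  have -> : z = z * v^-1 * v by rewrite mulrVK.
  by apply: (MM) => //; exact: subringM.
- by case: maximal_val_ideal => _ + _; rewrite e.
Qed.

Lemma val_maxE : val_max (V : set (total_frac R)) = val_ideal V.
Proof.
apply: xget_unique.
  split; first exact: maximal_val_ideal.
  by exists a; split; [exact: (val_ideal_den settingA valV)|exact/regular_unit].
by move=> M [hM [u [Mu /regular_unit uU]]]; exact: val_ideal_unique Mu uU.
Qed.

Lemma ideal_pow_val n x : ideal_pow V (val_ideal V) n x <-> val_ge V n x.
Proof.
elim: n x => [|n IH] x /=; first by rewrite val_ge0.
rewrite -addn1 PoszD addrC; split=> [[s sP ->]|h].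
  rewrite big_seq; apply: (big_ind (val_ge V (1 + n%:Z))).
  - by apply: infinite_at_val_ge => q; rewrite mulr0; exact: subring0.
  - by move=> y z; exact: (val_geD valV).
  - move=> p /sP[p1 /IH p2]; apply: (val_geM settingA valV) => //.
    exact/(val_ge1 settingA valV).
have [e1 _] := val_eq_unif settingA valV 1.
have [tU _ _ _ _] := unifP settingA valV.
exists [:: (unif V, x * (unif V)^-1)]; last by rewrite big_seq1 /= mulrCA divrr ?mulr1.
move=> p; rewrite inE => /eqP-> /=; split.
  by apply/(val_ge1 settingA valV); rewrite expr1z in e1.
apply/IH; have -> : n%:Z = (1 + n%:Z) + (-1) by ring.
apply: (val_geM settingA valV) => //.
by have [] := val_eq_unif settingA valV (-1).
Qed.

Lemma val_max_powE k (x : Q) : val_max_pow (V : set (total_frac R)) k x <-> val_ge V k x.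
Proof.
case: k => n; rewrite /val_max_pow val_maxE; first exact: ideal_pow_val.
split=> [h|h y /ideal_pow_val hy]; last first.
  apply/(val_ge0 a); have -> : 0 = Negz n + n.+1%:Z by rewrite NegzE addNr.
  exact: (val_geM settingA valV).
have /h : ideal_pow V (val_ideal V) n.+1 (unif V ^ n.+1%:Z : Q).
  by apply/ideal_pow_val; have [] := val_eq_unif settingA valV n.+1%:Z.
have -> : n.+1%:Z = - Negz n by rewrite NegzE opprK.
exact.
Qed.

(** Links [valuation], with its extended values, to [val_eq], in which values are computed. *)
Lemma valuationE k (x : Q) :
  valuation (V : set (total_frac R)) x = k%:E <-> val_eq V k x.
Proof.
have eqP l : val_eq V l x -> valuation (V : set (total_frac R)) x = l%:E.
  move=> hl; rewrite /valuation; case: asboolP => [h|_].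
    have [_ []] := hl; exact/val_max_powE.
  congr (_%:E); apply: xget_unique.
    split; first by apply/val_max_powE; case: hl.
    by move=> j /val_max_powE/(val_eq_ge settingA valV _ hl).
  move=> j [/val_max_powE/(val_eq_ge settingA valV _ hl) jl lj]; apply/eqP.
  rewrite eq_le jl /=; apply: lj; apply/val_max_powE; by case: hl.
split; last exact: eqP.
have [infx|ninf] := pselect (infinite_at V x).
  rewrite /valuation; case: asboolP => // -[] j.
  by apply/val_max_powE; exact: infinite_at_val_ge.
have [l hl] := val_eq_exists settingA valV ninf.
by rewrite (eqP _ hl) => -[<-].
Qed.

Definition center : set R := [set r | val_ideal V (tf r)].

(** The center is a prime containing the regular element [alpha]. *)
Lemma maximal_center : maximal_ideal setT center.
Proof.
apply: (regular_prime_maximal noethR dimR (c := alpha)) => //; last first.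
  exact: (val_ideal_den settingA valV).
have AV r : V (tf r) by apply: sub_valring valV _ _; exists r.
split.
- split=> //; rewrite /center /=.
  + rewrite rmorph0; apply: (infinite_at_ideal settingA valV) => q.
    by rewrite mulr0; exact: subring0.
  + by move=> x y mx my; rewrite rmorphD; exact: (val_idealD settingA).
  + by move=> c x _ mx; rewrite rmorphM; exact: (val_idealM valV).
- move=> e; apply: (@not_val_ideal1 _ V); rewrite -(rmorph1 tf).
  by have : center 1 by rewrite e.
- move=> x y _ _; rewrite /center /= rmorphM => mxy; apply: contrapT => /not_orP[mx my].
  exact: (not_val_idealM mx my).
Qed.

Lemma centered_in_center : centered_in center V.
Proof. by move=> s. Qed.

Lemma val_eq_outside_center r : ~ center r -> val_eq V 0 (tf r).
Proof.
move=> nr; split.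
  by apply/(val_ge0 a); apply: sub_valring valV _ _; exists r.
by rewrite add0r => /(val_ge1 settingA valV).
Qed.

End OneValuation.

End ValuationsOfR.

(** * Value sets of fractional ideals *)

Section ValueSets.
Variable R : comNzRingType.
Hypotheses (hCM : cohen_macaulay_dim1 R) (redR : reduced R) (hsl : semilocal R).
Variable alpha : R.
Hypotheses (Ja : jacobson [set: R] alpha) (rega : regular alpha).

Let noethR : noetherian R. Proof. by case: hCM. Qed.
Let dimR : krull_dim R 1. Proof. by case: hCM. Qed.
Local Notation Q := (total_frac_unit R).
Local Notation tf := (@to_frac_unit R).
Local Notation a := (tf alpha).
Local Notation ai := (a^-1).
Local Notation valring := (valring (range tf)).
Local Notation val_ge := (val_ge a).
Local Notation val_eq := (val_eq a).
Let settingA := total_frac_setting hCM redR Ja rega.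
Let aU : a \is a GRing.unit. Proof. by case: settingA. Qed.
Let aai : a * ai = 1. Proof. exact: divrr. Qed.

Lemma maximal_ideals_enum : exists S : seq (set R), uniq S /\
  forall M, M \in S <-> maximal_ideal setT M.
Proof.
have /finite_seqP[S SE] := hsl.
exists (undup S); split; first exact: undup_uniq.
by move=> V; rewrite mem_undup; have := f_equal (fun X => X V) SE => /= ->.
Qed.

Lemma chinese_remainder_maximal (c : set R -> R) :
  exists x, forall M, maximal_ideal setT M -> M (x - c M).
Proof.
have [S [uS SP]] := maximal_ideals_enum.
have [|x xP] := @chinese_remainder _ S c uS; first by move=> M /SP.
by exists x => M /SP; exact: xP.
Qed.

Lemma tf_val_eq0 V r : valring V -> ~ center V r -> val_eq V 0 (tf r).
Proof. by move=> valV; exact: (val_eq_outside_center hCM redR Ja rega valV). Qed.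

Lemma tf_val_ge0 V r : valring V -> val_ge V 0 (tf r).
Proof. by move=> valV; apply/val_ge0; apply: sub_valring valV _ _; exists r. Qed.

Lemma tf_val_ge1 V r : valring V -> center V r -> val_ge V 1 (tf r).
Proof. by move=> valV cr; apply/(val_ge1 settingA valV). Qed.

Lemma center_maximal V : valring V -> maximal_ideal setT (center V).
Proof. exact: (maximal_center hCM redR Ja rega). Qed.

Lemma val_eq_unit V x : valring V -> x \is a GRing.unit -> exists k, val_eq V k x.
Proof.
move=> valV xU; apply: (val_eq_exists settingA valV).
exact: (not_infinite_at_unit settingA valV).
Qed.

Lemma val_eq_add_lt V k l x y : valring V -> k < l -> val_eq V k x -> val_ge V l y ->
  val_eq V k (x + y).
Proof.
move=> valV kl hx hy; apply: (val_eqDl settingA valV) => //.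
by apply: (val_ge_trans settingA valV) hy; rewrite lezD1.
Qed.

Lemma val_eq_min V A B x y : valring V -> A <> B -> val_eq V A x -> val_eq V B y ->
  val_eq V (Num.min A B) (x + y).
Proof.
move=> valV AB hx hy; have [AltB|BltA|e] := ltgtP A B; last by case: AB.
  by apply: (val_eq_add_lt valV AltB) => //; case: hy.
by rewrite addrC; apply: (val_eq_add_lt valV BltA) => //; case: hx.
Qed.

(** * Values of combinations of two elements *)

Section LinearCombinations.
Variables (x y : Q) (A B : set Q -> int).
Hypothesis xA : forall V, valring V -> val_eq V (A V) x.
Hypothesis yB : forall V, valring V -> val_eq V (B V) y.

Lemma val_ge_min V r s : valring V ->
  val_ge V (Num.min (A V) (B V)) (tf r * x + tf s * y).
Proof.
move=> valV; apply: (val_geD valV).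
  rewrite -[Num.min _ _]add0r; apply: (val_geM settingA valV); first exact: tf_val_ge0.
  have [+ _] := xA valV; apply: (val_ge_trans settingA valV); by rewrite ge_min lexx.
rewrite -[Num.min _ _]add0r; apply: (val_geM settingA valV); first exact: tf_val_ge0.
have [+ _] := yB valV; apply: (val_ge_trans settingA valV); by rewrite ge_min lexx orbT.
Qed.

Lemma val_eq_min_congr V p q p' q' : valring V -> center V (p' - p) -> center V (q' - q) ->
  val_eq V (Num.min (A V) (B V)) (tf p * x + tf q * y) ->
  val_eq V (Num.min (A V) (B V)) (tf p' * x + tf q' * y).
Proof.
move=> valV cp cq h.
have -> : tf p' * x + tf q' * y =
    (tf p * x + tf q * y) + (tf (p' - p) * x + tf (q' - q) * y) by rewrite !rmorphB; ring.
apply: (val_eqDl settingA valV) => //; apply: (val_geD valV); rewrite addrC.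
  apply: (val_geM settingA valV); first exact: tf_val_ge1.
  have [+ _] := xA valV; apply: (val_ge_trans settingA valV); by rewrite ge_min lexx.
apply: (val_geM settingA valV); first exact: tf_val_ge1.
have [+ _] := yB valV; apply: (val_ge_trans settingA valV); by rewrite ge_min lexx orbT.
Qed.

(** By [val_ge_min] the value then exceeds the minimum, and may be infinite. *)
Definition cancels V c := ~ val_eq V (Num.min (A V) (B V)) (x + tf c * y).

Lemma not_cancels_lt V c : valring V -> A V < B V -> ~ cancels V c.
Proof.
move=> valV AB; apply; rewrite min_l ?ltW //.
apply: (val_eq_add_lt valV AB); first exact: xA.
rewrite -[B V]add0r; apply: (val_geM settingA valV); first exact: tf_val_ge0.
by case: (yB valV).
Qed.

(** For equal values, [(c - d) * y] has value above [B V], so [c - d] is in the center. For distinct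
    values, only elements of the center can cancel. *)
Lemma cancels_unique V c d : valring V -> cancels V c -> cancels V d -> center V (c - d).
Proof.
move=> valV bc bd; have [cI _ _] := center_maximal valV.
have [AB|AB] := eqVneq (A V) (B V).
  apply: contrapT => /(tf_val_eq0 valV) cd.
  have big e : cancels V e -> val_ge V (B V + 1) (x + tf e * y).
    move=> be; apply: contrapT => nge; apply: be; rewrite AB minxx; split=> //.
    have := val_ge_min 1 e valV; by rewrite AB minxx rmorph1 mul1r.
  have [_] := val_eqM settingA valV cd (yB valV); apply; rewrite add0r.
  have -> : tf (c - d) * y = (x + tf c * y) + - (x + tf d * y) by rewrite rmorphB; ring.
  by apply: (val_geD valV); [exact: big|apply: (val_geN valV); exact: big].
have main e : cancels V e -> center V e.
  move=> be; apply: contrapT => /(tf_val_eq0 valV) ne; apply: be.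
  apply: val_eq_min => //; [exact/eqP|exact: xA|].
  by rewrite -[B V]add0r; apply: (val_eqM settingA valV) => //; exact: yB.
by apply: idealB => //; exact: main.
Qed.

(* If every [x + c y] cancels at some [V] centered in [m], sending [V] to a     *)
(* valuation at which the residue class attached to [V] cancels is an injection *)
(* of the finite set of these [V] into itself.  It cannot miss a [V] with       *)
(* [A V < B V], so that [y] itself has minimal values.                          *)
Lemma local_minimum m : large_residue_fields R -> maximal_ideal setT m ->
  exists p q, forall V, valring V -> center V = m ->
    val_eq V (Num.min (A V) (B V)) (tf p * x + tf q * y).
Proof.
move=> lrf hm; have [hI _ _] := hm.
have [[c hc]|nc] := pselect (exists c, forall V, valring V -> center V = m -> ~ cancels V c).
  exists 1, c => V valV Vm; rewrite rmorph1 mul1r.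
  by apply: contrapT => /(hc V valV Vm).
have /choice[b bP] : forall c, exists V, [/\ valring V, center V = m & cancels V c].
  move=> c; apply: contrapT => h; apply: nc; exists c => V valV Vm bVc.
  by apply: h; exists V.
exists 0, 1 => V0 valV0 V0m; rewrite rmorph0 mul0r add0r rmorph1 mul1r.
suff BA : B V0 <= A V0 by rewrite min_r //; exact: yB.
rewrite leNgt; apply/negP => AB.
have [S [uS SP]] := valrings_enum settingA.
pose S' := [seq V <- S | `[< center V = m >]].
have S'P V : V \in S' <-> valring V /\ center V = m.
  rewrite mem_filter; split=> [/andP[/asboolP Vm /SP valV] //|[valV Vm]].
  by apply/andP; split; [exact/asboolP|exact/SP].
have [|g [gq ginj]] := residue_classes_injection hCM redR Ja rega hm (S := [set` S']) lrf.
  by move=> V /S'P[valV <-]; split=> //; exact: centered_in_center.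
have /choice[r rP] : forall V, exists c, V \in S' -> g V = [set c + z | z in m].
  move=> V; have [/gq[c _ cE]|nV] := boolP (V \in S'); last by exists 0.
  by exists c.
have coset (c d : R) : m (c - d) -> [set c + z | z in m] `<=` [set d + z | z in m].
  move=> mcd _ [z mz <-]; exists (c - d + z); last by ring.
  exact: idealD.
have coset_eq (c d : R) : m (c - d) -> [set c + z | z in m] = [set d + z | z in m].
  move=> mcd; rewrite eqEsubset; split; first exact: coset.
  by apply: coset; rewrite -opprB -mulN1r; exact: idealM.
pose h V := b (r V).
have hinj : {in S' &, injective h}.
  move=> V W VS WS hVW; apply: ginj => //; rewrite (rP _ VS) (rP _ WS); apply: coset_eq.
  have [valX Xm bV] := bP (r V); have [_ _ bW] := bP (r W).
  have bW' : cancels (b (r V)) (r W) by rewrite (hVW : b (r V) = b (r W)).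
  by have := cancels_unique valX bV bW'; rewrite Xm.
have hS : {subset map h S' <= S'}.
  by move=> _ /mapP[V VS ->]; apply/S'P; have [] := bP (r V).
have : V0 \in map h S'.
  have [||_ ->] := @uniq_min_size _ (map h S') S' _ hS; last exact/S'P.
    by rewrite map_inj_in_uniq // filter_uniq.
  by rewrite size_map.
move=> /mapP[V VS VE]; have [_ _] := bP (r V); rewrite -[b _]/(h V) -VE.
exact: not_cancels_lt.
Qed.

(** The coefficients matter at [V] only modulo its center, so the local solutions can be glued. *)
Lemma global_minimum : large_residue_fields R ->
  exists p q, forall V, valring V -> val_eq V (Num.min (A V) (B V)) (tf p * x + tf q * y).
Proof.
move=> lrf.
have /choice[pq pqP] : forall m, exists pq : R * R, maximal_ideal setT m ->
    forall V, valring V -> center V = m ->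
    val_eq V (Num.min (A V) (B V)) (tf pq.1 * x + tf pq.2 * y).
  move=> m; have [hm|nm] := pselect (maximal_ideal setT m); last by exists (0, 0).
  by have [p [q h]] := local_minimum lrf hm; exists (p, q).
have [p pP] := chinese_remainder_maximal (fun m => (pq m).1).
have [q qP] := chinese_remainder_maximal (fun m => (pq m).2).
exists p, q => V valV; have cV := center_maximal valV.
by apply: val_eq_min_congr (pqP _ cV V valV erefl) => //; [exact: pP|exact: qP].
Qed.

(* Subtract from [x] the multiple [c y] with [c] congruent to [x / y] at [V0]   *)
(* and a unit everywhere, then add [a ^ N x] to remove infinite values.         *)
Lemma cancellation V0 : residually_rational R -> valring V0 -> A V0 = B V0 ->
  exists p q k, forall V, valring V ->
    [/\ val_eq V (k V) (tf p * x + tf q * y),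
        V = V0 -> A V < k V,
        Num.min (A V) (B V) <= k V &
        A V <> B V -> k V = Num.min (A V) (B V)].
Proof.
move=> resR valV0 AB0.
have xU : x \is a GRing.unit.
  apply: (finite_everywhere_unit settingA) => V valV; apply: val_eq_infinite; exact: xA.
have yU : y \is a GRing.unit.
  apply: (finite_everywhere_unit settingA) => V valV; apply: val_eq_infinite; exact: yB.
have yy : y * y^-1 = 1 by exact: divrr.
have v0 : val_eq V0 0 (x * y^-1).
  have [l hl] := val_eq_unit valV0 (x := y^-1) ltac:(by rewrite unitrV).
  have h1 := val_eqM settingA valV0 (yB valV0) hl.
  have : val_eq V0 0 (unif a V0 ^ 0) by exact: (val_eq_unif settingA valV0).
  rewrite expr0z -yy => h0; have e := val_eq_inj settingA valV0 h1 h0.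
  by have := val_eqM settingA valV0 (xA valV0) hl; rewrite AB0 e.
have [|c cP] := residue_rational settingA resR valV0 (v := x * y^-1).
  by apply/(val_ge0 a); case: v0.
have nc : ~ center V0 c.
  move=> /(tf_val_ge1 valV0)/(val_ge1 settingA valV0) mc; have [_] := v0; apply.
  rewrite add0r; apply/(val_ge1 settingA valV0).
  have -> : x * y^-1 = (x * y^-1 - tf c) + tf c by ring.
  exact: (val_idealD settingA valV0).
(* [d] has the residue of [c] at the center of [V0] and lies outside every maximal ideal, so [d * y]
   has the values of [y]. *)
have [d dP] := chinese_remainder_maximal (fun m => if m == center V0 then c else 1).
have dV V : valring V -> ~ center V d.
  move=> valV md; have hm := center_maximal valV; have [mI mT _] := hm.
  have := dP _ hm; case: eqVneq => [e|_] mdc.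
    apply: nc; rewrite -e; have -> : c = d - (d - c) by ring.
    exact: idealB.
  apply: mT; apply: (ideal1 mI); have -> : 1 = d - (d - 1) :> R by ring.
  exact: idealB.
pose z := x - tf d * y.
have zmin V : valring V -> val_ge V (Num.min (A V) (B V)) z.
  move=> valV; have := val_ge_min 1 (- d) valV.
  by rewrite rmorph1 mul1r rmorphN mulNr.
have dy V : valring V -> val_eq V (B V) (tf d * y).
  move=> valV; rewrite -[B V]add0r; apply: (val_eqM settingA valV); last exact: yB.
  by apply: tf_val_eq0 => //; exact: dV.
have zne V : valring V -> A V <> B V -> val_eq V (Num.min (A V) (B V)) z.
  move=> valV AB; apply: val_eq_min => //; first exact: xA.
  have [h1 h2] := dy V valV; split; first exact: (val_geN valV).
  by move=> /(val_geN valV); rewrite opprK.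
have z0 : val_ge V0 (A V0 + 1) z.
  have -> : z = (x * y^-1 - tf c) * y + tf (c - d) * y.
    by rewrite rmorphB /z; ring: yy.
  have yge : val_ge V0 (B V0) y by case: (yB valV0).
  rewrite AB0 [B V0 + 1]addrC; apply: (val_geD valV0).
    by apply: (val_geM settingA valV0) => //; exact/(val_ge1 settingA valV0).
  apply: (val_geM settingA valV0) => //; apply: tf_val_ge1 => //.
  have hm := center_maximal valV0; have [mI _ _] := hm.
  by have := dP _ hm; rewrite eqxx => /(idealM (-1) mI); rewrite mulN1r opprB.
have aX N V : valring V -> val_ge V N%:Z (a ^+ N).
  move=> valV; apply: (val_ge_den settingA valV); rewrite expr_inv1 //.
  exact: subring1 (valring_subring valV).
have aXx N V : valring V -> val_ge V (N%:Z + A V) (a ^+ N * x).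
  by move=> valV; apply: (val_geM settingA valV); [exact: aX|case: (xA valV)].
have [S [uS SP]] := valrings_enum settingA.
have [V /SP valV|N0 hN0] := @eventually_all _ (fun V N => forall k, val_eq V k z ->
    val_ge V (k + 1) (a ^+ N * x)) S.
  have [infz|ninf] := pselect (infinite_at V z).
    by exists 0%N => N _ k /val_eq_infinite.
  have [k hk] := val_eq_exists settingA valV ninf.
  exists (absz (k + 1 - A V)%R) => N hN l /(val_eq_inj settingA valV hk) <-.
  apply: (val_ge_trans settingA valV) (aXx N V valV).
  by rewrite -lerBlDr; apply: le_trans (ler_norm _) _; rewrite -abszE lez_nat.
(* [N] is positive so that the added term has value above [A V] everywhere. *)
pose N := N0.+1; pose w := z + a ^+ N * x.
have wU V : valring V -> exists k, val_eq V k w.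
  move=> valV; have [infz|ninf] := pselect (infinite_at V z).
    have [k [hk nk]] : exists k, val_eq V k (a ^+ N * x).
      by apply: val_eq_unit => //; rewrite unitrM unitrX.
    exists k; rewrite /w addrC; apply: (val_eqDl settingA valV) => //.
    exact: infinite_at_val_ge.
  have [k hk] := val_eq_exists settingA valV ninf.
  exists k; apply: (val_eqDl settingA valV) => //.
  by apply: (hN0 N V) => //; exact/SP.
have /choice[k kP] : forall V, exists k, valring V -> val_eq V k w.
  move=> V; have [valV|nV] := pselect (valring V); last by exists 0.
  by have [k hk] := wU V valV; exists k.
have ANx V : valring V -> val_ge V (A V + 1) (a ^+ N * x).
  move=> valV; apply: (val_ge_trans settingA valV) (aXx N V valV).
  by rewrite addrC lerD2r.
exists (1 + alpha ^+ N), (- d), k => V valV.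
have -> : tf (1 + alpha ^+ N) * x + tf (- d) * y = w.
  by rewrite rmorphD rmorph1 rmorphXn rmorphN /w /z; ring.
have hk := kP V valV; split=> //.
- move=> e; rewrite -lezD1; apply/(val_eq_ge settingA valV _ hk).
  by rewrite e; apply: (val_geD valV0) => //; exact: ANx.
- apply/(val_eq_ge settingA valV _ hk); apply: (val_geD valV); first exact: zmin.
  apply: (val_ge_trans settingA valV) (ANx V valV).
  by rewrite ge_min lerDl.
- move=> AB; apply: (val_eq_inj settingA valV hk).
  apply: (val_eqDl settingA valV); first exact: zne.
  apply: (val_ge_trans settingA valV) (ANx V valV).
  by rewrite lerD2r ge_min lexx.
Qed.

End LinearCombinations.

(** * The three properties of the value set *)

Section FractionalIdeal.
Variable E : set Q.
Hypothesis hE : regular_fractional_ideal (E : set (total_frac R)).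
Local Notation I := (valuation_rings R).

Let ED x y : E x -> E y -> E (x + y).
Proof. by case: hE => -[_ + _ _] _; exact. Qed.
Let EZ r x : E x -> E (tf r * x).
Proof. by case: hE => -[_ _ + _] _; exact. Qed.

(** Finite values at all valuation rings make an element a unit, hence regular. *)
Lemma value_setP (gamma : I -> int) : value_set (E : set (total_frac R)) gamma <->
  exists2 x : Q, E x & forall V : I, val_eq (val V) (gamma V) x.
Proof.
have valI (V : I) : valring (val V) by exact: set_valP V.
split=> [[x [Ex regx] h]|[x Ex h]].
  by exists x => // V; exact/(valuationE hCM redR Ja rega (valI V)).
exists x; last by move=> V; exact/(valuationE hCM redR Ja rega (valI V)).
split=> //; apply/(regular_unit hCM redR Ja rega).
apply: (finite_everywhere_unit settingA) => V valV.
exact: (val_eq_infinite (h (exist _ V (mem_set valV)))).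
Qed.

(* [gamma] is extended by the junk value 0 to sets that are no valuation ring.  *)
Lemma extend_values (gamma : I -> int) (P : set Q -> int -> Prop) :
  (forall V : I, P (val V) (gamma V)) ->
  exists g : set Q -> int, (forall V, valring V -> P V (g V)) /\ forall V : I, g (val V) = gamma V.
Proof.
move=> h.
have /choice[g gP] : forall V, exists k, forall W : I, val W = V -> k = gamma W.
  move=> V; have [valV|nV] := pselect (valuation_rings R V).
    exists (gamma (exist _ V (mem_set valV))) => W WV; congr gamma.
    exact/val_inj/esym.
  exists 0 => W WV; case: nV; rewrite -WV; exact: set_valP.
have gE (V : I) : g (val V) = gamma V by exact: gP.
exists g; split=> // V valV.
have := h (exist _ V (mem_set valV)); by rewrite -gE.
Qed.

Lemma value_set_E1 : large_residue_fields R -> propE1 (value_set (E : set (total_frac R))).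
Proof.
move=> lrf gamma delta /value_setP[x Ex xg] /value_setP[y Ey yd].
have [A [xA AE]] := extend_values (P := fun V k => val_eq V k x) xg.
have [B [yB BE]] := extend_values (P := fun V k => val_eq V k y) yd.
have [p [q pqP]] := global_minimum xA yB lrf.
apply/value_setP; exists (tf p * x + tf q * y).
  by apply: ED; exact: EZ.
by move=> V; rewrite -AE -BE; apply: pqP; exact: set_valP.
Qed.

Lemma value_set_E2 : residually_rational R -> propE2 (value_set (E : set (total_frac R))).
Proof.
move=> resR gamma delta j /value_setP[x Ex xg] /value_setP[y Ey yd] gdj.
have [A [xA AE]] := extend_values (P := fun V k => val_eq V k x) xg.
have [B [yB BE]] := extend_values (P := fun V k => val_eq V k y) yd.
have valI (V : I) : valring (val V) by exact: set_valP V.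
have [|p [q [k kP]]] := cancellation xA yB resR (valI j); first by rewrite AE BE.
exists (fun V : I => k (val V)); split.
- apply/value_setP; exists (tf p * x + tf q * y); first by apply: ED; exact: EZ.
  by move=> V; have [] := kP _ (valI V).
- by have [_ /(_ erefl)] := kP _ (valI j); rewrite AE.
- move=> V Vj; have [_ _ h1 h2] := kP _ (valI V).
  by rewrite -AE -BE; split.
Qed.

(** If the values of [x] are at least those of [y * a ^+ m], with [m] from [conductor] and [y]
    regular in [E], then [x / y] is in [R] and [x] is in [E]. *)
Lemma value_set_E0 : analytically_reduced R -> propE0 (value_set (E : set (total_frac R))).
Proof.
move=> anR.
have [m mP] := conductor (completion_adic noethR dimR Ja rega) noethR dimR rega
  (@to_frac_unit_inj R) settingA anR.
have [_ [y0 [Ey0 /(regular_unit hCM redR Ja rega) yU0]]] := hE.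
pose y : Q := y0; have Ey : E y := Ey0; have yU : y \is a GRing.unit := yU0.
have yU' : y * a ^+ m \is a GRing.unit by rewrite unitrM yU unitrX.
have /choice[D DP] : forall V, exists k, valring V -> val_eq V k (y * a ^+ m).
  move=> V; have [valV|nV] := pselect (valring V); last by exists 0.
  by have [k hk] := val_eq_unit valV yU'; exists k.
exists (fun V : I => D (val V)) => n.
have [N [_ NE]] := @extend_values (fun V => (n V)%:Z) (fun _ _ => True) ltac:(by []).
have [x xU xP] := unit_with_values settingA (fun V => D V + N V).
apply/value_setP; exists x; last first.
  by move=> V; rewrite -NE; apply: xP; exact: set_valP.
have [r _ rE] : range tf (a ^+ m * (x * (y * a ^+ m)^-1)).
  apply: mP => V valV.
  have [l hl] := val_eq_unit valV (x := x * (y * a ^+ m)^-1)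
    ltac:(by rewrite unitrM xU unitrV).
  have := val_eqM settingA valV (DP V valV) hl.
  rewrite mulrC divrK // => /(val_eq_inj settingA valV (xP V valV)) /addrI NV.
  apply/(val_ge0 a)/(val_eq_ge settingA valV _ hl); rewrite -NV.
  by have := NE (exist _ V (mem_set valV)) => /= ->.
have -> : x = tf r * y; last exact: EZ.
rewrite rE; have := divrr yU'; move: (y * a ^+ m)^-1 => z yz.
by rewrite -[LHS]mulr1 -yz; ring.
Qed.

End FractionalIdeal.
End ValueSets.

Theorem corollary3p2p3 (R : comNzRingType)
    (hCM : cohen_macaulay_dim1 R) (hsl : semilocal R) (hred : reduced R)
    (hlrf : large_residue_fields R)
    (E : set (total_frac R)) (hE : regular_fractional_ideal E) :
  (analytically_reduced R -> propE1 (value_set E)) /\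
  (residually_rational R -> propE2 (value_set E)) /\
  (admissible R -> good (value_set E)).
Proof.
have [alpha Ja rega] := jacobson_regular hCM hred hsl.
have E1 := value_set_E1 hCM hred hsl Ja rega hE hlrf.
have E2 := value_set_E2 hCM hred hsl Ja rega hE.
have E0 := value_set_E0 hCM hred Ja rega hE.
split=> [_ //|]; split=> // -[_ _ anR resR _].
by split; [exact: E0|exact: E1|exact: E2].
Qed.
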